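(* Suppose that $0<W(\rho_w)<\infty$ and $0<V'(W(\rho_w))<\infty$. Let $N,\hat N,X$ and $\Xi_n$ be as defined in the context. Each of the following additional conditions is sufficient in order for $$N_n\xrightarrow{d}\hat N\qquad\text{and}\qquad\lim_{n\to\infty}\sup_{A\subset\mathbb N^+}\left|\mathbb P\big((K_1,\dots,K_{N_n})\in A\big)-\mathbb P(\Xi_n\in A)\right|=0$$ to hold. (i) $\rho_v=W(\rho_w)$ and $v_n=L_v(n)n^{-b}\rho_v^{-n}$, $w_n=L_w(n)n^{-a}\rho_w^{-n}$ for $n\ge1$, for slowly varying functions $L_v,L_w$, an exponent $b>2$, and an exponent $a$ such that either $1<a<b$, or $a=b$ and $L_v(n)=o(L_w(n))$. (ii) $\infty\ge\rho_v>W(\rho_w)$ and $\frac{w_n}{w_{n+1}}\to\rho_w>0$ and $\frac1{w_n}\sum_{i+j=n}w_iw_j\to2W(\rho_w)<\infty$ as $n\to\infty$. (iii) $\mathbb E[N^{1+a+\delta}]<\infty$ and $w_n=L_w(n)n^{-a}\rho_w^{-n}$ for $n\ge1$, for constants $a>1$, $\delta>0$ and a slowly varying function $L_w$. (iv) $w_n\sim c_wn^{-a}\rho_w^{-n}$ for constants $a>1$, $c_w>0$, and additionally one of the following holds: (a) $\mathbb E[N^{1+a}]<\infty$; (b) $1<a<2$; (c) $a=2$ and $\mathbb E[N(\log N)^{2+\delta}]<\infty$ for some $\delta>0$; (d) $2<a<3$ and $\mathbb P(N=n)=o(\mathbb P(X=n))$; (e) $a=3$ and $\mathbb P(N=n)=o(1/(n^3\log\log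 n))$.
   Context: Gibbs partitions. Let $(v_i)_{i\ge1}$, $(w_i)_{i\ge0}$ be sequences of non-negative reals, $V(x)=\sum_{i\ge1}v_ix^i$, $W(x)=\sum_{i\ge0}w_ix^i$, $U(x)=V(W(x))=\sum_{n\ge0}u_nx^n$, so that $u_n=\sum_{k\ge1}v_k\sum_{x_1+\dots+x_k=n}w_{x_1}\cdots w_{x_k}$ (sum over $x_i\in\mathbb N_0$). Let $\rho_v,\rho_w$ be the radii of convergence of $V,W$ (in every condition above $0<\rho_w<\infty$); values such as $W(\rho_w)$, $V'(W(\rho_w))$ denote values of the respective series. For $n\ge1$ with $u_n>0$, the Gibbs partition $P_n$ is the random partition of $\{1,\dots,n\}$ with $\mathbb P(P_n=P)=\frac{1}{n!\,u_n}|P|!\,v_{|P|}\prod_{Q\in P}|Q|!\,w_{|Q|}$ (empty components are allowed if $w_0>0$). $N_n$ is its number of components and $K_1,\dots,K_{N_n}$ are their sizes listed in exchangeable order; precisely $\mathbb P(N_n=k,(K_1,\dots,K_k)=(x_1,\dots,x_k))=v_kw_{x_1}\cdots w_{x_k}/u_n$ for $k\ge1$, $x_i\in\mathbb N_0$, $\sum x_i=n$. A function $L:\mathbb R_{>0}\to\mathbb R_{>0}$ is slowly varying if $L(tx)/L(x)\to1$ as $x\to\infty$ for all $t>0$. $X$ is a random non-negative integer with $\mathbb E[z^X]=W(\rho_wz)/W(\rho_w)$, and $X_1,X_2,\dots$ are independent copies of $X$. $N$ and $\hat N$ are random positive integers with $\mathbb E[z^N]=V(W(\rho_w)z)/V(W(\rho_w))$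 and $\mathbb E[z^{\hat N}]=zV'(W(\rho_w)z)/V'(W(\rho_w))$, independent of $(X_i)_{i\ge1}$. Let $S_{\hat N-1}=\sum_{i=1}^{\hat N-1}X_i$. Given $\hat N$, let $J$ be uniform on $\{1,\dots,\hat N\}$, conditionally independent of everything else. Let $\mathbb N^+=\bigcup_{n\ge1}\mathbb N_0^n$ be the set of finite non-empty sequences of non-negative integers, and $$\Xi_n=(X_1,\dots,X_{J-1},\,n-S_{\hat N-1},\,X_J,\dots,X_{\hat N-1}).$$ (If $n-S_{\hat N-1}<0$ then $\Xi_n\notin\mathbb N^+$.)
   Formalization: Slowly varying functions are additionally required to be measurable (Karamata's convention); without measurability the claim fails, e.g. in (iii) with V(x)=x^2 and a Hamel-basis L for which L(n+1)/L(n) does not tend to 1. *)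

(* Defs.v *)
From HB Require Import structures.
From mathcomp Require Import all_boot all_order all_algebra.
From mathcomp Require Import all_classical all_reals all_analysis.
Set Implicit Arguments.
Unset Strict Implicit.
Unset Printing Implicit Defensive.
Import Order.TTheory GRing.Theory Num.Theory.
Import numFieldNormedType.Exports.
Local Open Scope classical_set_scope.
Local Open Scope ring_scope.

(* Sum of the power series with coefficients [f] at [x]; only used for
   nonnegative [f] and [x], where it is the supremum of the partial sums. *)
Definition pser (R : realType) (f : nat -> R) (x : R) : \bar R :=
  (\sum_(0 <= i <oo) (f i * x ^+ i)%:E)%E.

Definition pser_radius (R : realType) (f : nat -> R) : \bar R :=
  ereal_sup [set `|x|%:E | x in [set x : R | cvgn (pseries f x)]].

(* The coefficient u_n of V(W(x)). The sum over k may be infinite when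
   w_0 > 0, hence the extended-real value. The tuples x range over
   {0..n}^k, which loses nothing since their entries sum to n. *)
Definition gibbs_u (R : realType) (v w : nat -> R) (n : nat) : \bar R :=
  (\sum_(1 <= k <oo)
     (v k * \sum_(x : {ffun 'I_k -> 'I_n.+1} | (\sum_(i < k) x i)%N == n)
              \prod_(i < k) w (x i))%:E)%E.

(* [K] is distributed like the sequence (K_1, ..., K_{N_n}) of component sizes,
   in exchangeable order, of the Gibbs partition of {1, ..., n}; the number of
   components N_n is [size] of this sequence. *)
Definition gibbs_sizes (R : realType) (v w : nat -> R) (n : nat)
    (d : measure_display) (T : measurableType d) (Q : probability T R)
    (K : T -> seq nat) : Prop :=
  (forall s : seq nat, measurable (K @^-1` [set s])) /\
  forall s : seq nat, s != [::] -> sumn s = n ->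
    Q (K @^-1` [set s]) =
    (v (size s) * \prod_(x <- s) w x / fine (gibbs_u v w n))%:E.

(* Measurability is part of Karamata's notion of slow variation; without it
   there are (Hamel basis) examples of L bounded away from 0 and oo for which
   L(n+1)/L(n) does not tend to 1. *)
Definition slowly_varying (R : realType) (L : R -> R) : Prop :=
  [/\ forall x : R, 0 < x -> 0 < L x,
      measurable_fun [set x : R | 0 < x] L
    & forall t : R, 0 < t -> L (t * x) / L x @[x --> +oo] --> (1 : R)].

Definition has_pgf (R : realType) (d : measure_display) (T : measurableType d)
    (P : probability T R) (Y : T -> nat) (G : R -> R) : Prop :=
  forall z : R, 0 <= z <= 1 ->
    ('E_P[fun t => (z ^+ Y t)%R] = (G z)%:E)%E.

(* The sigma-algebra generated by a set of nat-valued functions. *)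
Definition sigma_of (T : Type) (Ys : set (T -> nat)) : set (set T) :=
  <<s \bigcup_(Y in Ys) preimage_set_system setT Y measurable >>.

Definition indep_classes (R : realType) (d : measure_display)
    (T : measurableType d) (P : probability T R) (F G : set (set T)) : Prop :=
  forall A B : set T, F A -> G B -> (P (A `&` B) = P A * P B)%E.

Definition mutually_indep (R : realType) (d : measure_display)
    (T : measurableType d) (P : probability T R) (Y : nat -> T -> nat) : Prop :=
  forall (s : seq nat) (B : nat -> set nat), uniq s ->
    P (\bigcap_(i in [set` s]) Y i @^-1` B i) =
    (\prod_(i <- s) P (Y i @^-1` B i))%E.

(* Conditional independence of [Y] and the events of [F] given the discrete
   variable [Z], i.e. P(Y=j, E | Z=m) = P(Y=j | Z=m) P(E | Z=m), multiplied by
   P(Z=m)^2 so that no division by a null probability occurs. *)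
Definition cond_indep (R : realType) (d : measure_display)
    (T : measurableType d) (P : probability T R) (Y Z : T -> nat)
    (F : set (set T)) : Prop :=
  forall (j m : nat) (E : set T), F E ->
    (P (Y @^-1` [set j] `&` E `&` Z @^-1` [set m]) * P (Z @^-1` [set m]) =
     P (Y @^-1` [set j] `&` Z @^-1` [set m]) * P (E `&` Z @^-1` [set m]))%E.

Definition cond_uniform (R : realType) (d : measure_display)
    (T : measurableType d) (P : probability T R) (Y Z : T -> nat) : Prop :=
  forall j m : nat, (1 <= j <= m)%N ->
    (P (Y @^-1` [set j] `&` Z @^-1` [set m]) =
     (m%:R^-1)%:E * P (Z @^-1` [set m]))%E.

(* The variable X_i is [X i.-1]. The inserted entry may be negative, hence the
   values in [seq int]. *)
Definition Xi (T : Type) (X : nat -> T -> nat) (Nhat J : T -> nat) (n : nat)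
    (t : T) : seq int :=
  let xs := [seq (X i t)%:Z | i <- iota 0 (Nhat t).-1] in
  take (J t).-1 xs ++ (n%:Z - \sum_(x <- xs) x) :: drop (J t).-1 xs.

Definition Nplus : set (seq nat) := [set s | s != [::]].

(* Event that a sequence of integers is an element of [A], for A a set of
   sequences of natural numbers. *)
Definition int_event (T : Type) (Y : T -> seq int) (A : set (seq nat)) : set T :=
  [set t | exists2 s, A s & Y t = [seq x%:Z | x <- s]].

(* Pointwise convergence of distribution functions at the continuity points of
   the limit; each variable may live on its own probability space. *)
Definition cvg_in_distribution (R : realType) (d : nat -> measure_display)
    (T : forall n, measurableType (d n)) (Q : forall n, probability (T n) R)
    (Y : forall n, T n -> R)
    (d' : measure_display) (S : measurableType d') (P : probability S R)
    (Z : S -> R) : Prop :=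
  forall x : R,
    {for x, continuous (fun r : R => P [set t | Z t <= r])} ->
    Q n [set t | Y n t <= x] @[n --> \oo] --> P [set t | Z t <= x].

(* Main.v *)
Require Import Defs.
From HB Require Import structures.
From mathcomp Require Import all_boot all_order all_algebra.
From mathcomp Require Import all_classical all_reals all_analysis.
From mathcomp Require Import measurable_realfun.
From mathcomp Require Import ring lra zify.
Set Implicit Arguments.
Unset Strict Implicit.
Unset Printing Implicit Defensive.
Import Order.TTheory GRing.Theory Num.Theory.
Import numFieldNormedType.Exports.
Local Open Scope classical_set_scope.
Local Open Scope ring_scope.

(** With the tilted weights [p i = w_i rho ^ i / W(rho)], the law of [X], and
   [q k = v_k W(rho) ^ k], a multiple of the law of [N], the component sizes are
   [(x_1, ..., x_k)] with probability [q k * p x_1 * ... * p x_k / U_n], where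
   [U_n = u_n rho ^ n] is the sum over [k] of [q k * cpow p k n], and [cpow p k] is
   the law of a sum of [k] copies of [X]. The theorem is an instance of the
   principle of a single big jump: if a sum of [k] terms is large, this is due to
   one term, for which there are [k] choices. Hence [cpow p k n ~ k * p n] and
   [U_n ~ D * p n] with [D] the sum of the [k * q k], and the number of
   components becomes size-biased.

   Three properties of the weights ([single_jump]) carry this out: [p] is
   long-tailed, [p] is subexponential, and large [k] contribute little
   ([tail_negligible]). They give an upper bound on [U_n] by
   [(1 + e) * D * p (n - m)] for each bounded [m] ([partition_function_upper]). Now
   take a value of the limit sequence with [k] entries, all but the inserted one
   at most [B], these others having sum [m]. Its probability is
   [k * q k / D * 1 / k] times the product of the [p] of the other entries, and
   its probability for the Gibbs partition has the additional factor
   [D * p (n - m) / U_n >= 1 / (1 + e)]. So, up to a set of small probability, the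
   law of the limit sequence is at most [1 + e] times that of the component sizes;
   between two laws of total mass one such a one-sided bound makes the total
   variation small ([total_variation_bound]). Convergence of the number of
   components follows, as it is the size of the sequence.

   It remains to derive [single_jump] from each of the conditions. Regular
   variation enters through Potter's bounds, obtained from Karamata's uniform
   convergence theorem ([slow_variation_uniform]); they give the long tail and,
   since [p] is then comparable with [p n] on [n / 2, n], subexponentiality. The
   work is in [tail_negligible], where [cpow p k n] has to be bounded uniformly in
   [k]. If [V] converges beyond [W(rho)], Kesten's bound ([cpow_kesten]) does it.
   If [N] has a moment of order [1 + a], with some room when the slowly varying
   factor of [w] is not constant, it is enough that one of the [k] terms is at
   least [n / k] ([cpow_le_max_term]). Otherwise [big_jump] bounds
   [cpow p k n] by a multiple of [k * p n] as long as [k] truncated terms have mean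
   total at most [n / 12], and larger [k] are treated by a local concentration bound
   when [X] may have infinite mean ([cpow_concentration]), or else by the smallness
   of [q k] with respect to [p k] together with a bound on the renewal function
   ([renewal_bound]). *)

(** * Convolution powers *)

Section Convolution.
Context {R : realType}.
Implicit Types f g h : nat -> R.

Definition convol f g (n : nat) : R := \sum_(i < n.+1) f i * g (n - i)%N.

Fixpoint cpow f (k : nat) : nat -> R :=
  if k is k'.+1 then convol f (cpow f k') else fun n => (n == 0%N)%:R.

Lemma cpowS f k n :
  cpow f k.+1 n = \sum_(i < n.+1) f i * cpow f k (n - i)%N.
Proof. by []. Qed.

Lemma cpow_ge0 f k n : (forall i, 0 <= f i) -> 0 <= cpow f k n.
Proof.
move=> f0; elim: k n => [|k IH] n /=; first exact: ler0n.
by apply: sumr_ge0 => i _; rewrite mulr_ge0.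
Qed.

Lemma convol_rev f g n : convol f g n = \sum_(i < n.+1) f (n - i)%N * g i.
Proof.
rewrite /convol (reindex_inj rev_ord_inj) /=; apply: eq_bigr => i _.
by rewrite subSS subKn // -ltnS.
Qed.

Lemma eq_cpow f g k n : (forall i, (i <= n)%N -> f i = g i) ->
  cpow f k n = cpow g k n.
Proof.
elim: k n => [//|k IH] n fg; rewrite !cpowS; apply: eq_bigr => i _.
rewrite fg; last by rewrite -ltnS.
by rewrite (IH (n - i)%N) // => j jn; apply/fg/(leq_trans jn)/leq_subr.
Qed.

Lemma cpow1 f n : cpow f 1 n = f n.
Proof.
rewrite cpowS big_ord_recr /= subnn eqxx mulr1 big1 ?add0r // => i _.
by rewrite subn_eq0 leqNgt ltn_ord mulr0.
Qed.

Lemma sum_convol_le f g N : (forall i, 0 <= f i) -> (forall i, 0 <= g i) ->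
  \sum_(n < N) convol f g n <= (\sum_(i < N) f i) * (\sum_(i < N) g i).
Proof.
move=> f0 g0.
have -> : \sum_(n < N) convol f g n
    = \sum_(n < N) \sum_(i < N | (i <= n)%N) f i * g (n - i)%N.
  apply: eq_bigr => n _; rewrite /convol.
  rewrite (big_ord_widen_cond N xpredT (fun i => f i * g (n - i)%N)) //.
rewrite (exchange_big_dep xpredT) //= mulr_suml; apply: ler_sum => i _.
rewrite -mulr_sumr ler_wpM2l //.
rewrite -(big_mkord (fun n => i <= n)%N (fun n => g (n - i)%N)).
rewrite -(big_mkord xpredT g).
rewrite (big_cat_nat (n := i)) //=; last exact: ltnW.
rewrite big_nat_cond big_pred0 ?add0r; last first.
  by move=> n; case: (ltnP n i); rewrite ?andbF.
rewrite -{1}(add0n i) big_addn.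
rewrite [leRHS](big_cat_nat (n := N - i)) ?leq_subr//=.
rewrite [X in X <= _](_ : _ = \sum_(0 <= j < N - i) g j).
  by rewrite lerDl sumr_ge0.
by apply: eq_big => j; rewrite ?leq_addl// addnK.
Qed.

(** The weight [expR (lam * n)] is a character of addition, so it passes through
   each convolution. Bounding partial sums instead of series keeps questions of
   convergence out of the combinatorics. *)
Lemma cpow_exp_moment f (lam : R) (Phi : R) k N :
  (forall i, 0 <= f i) ->
  (forall M, \sum_(i < M) f i * expR (lam * i%:R) <= Phi) ->
  \sum_(n < N) cpow f k n * expR (lam * n%:R) <= Phi ^+ k.
Proof.
move=> f0 fPhi; pose W i := expR (lam * i%:R).
have W0 i : 0 <= W i by exact: expR_ge0.
have Phi0 : 0 <= Phi by rewrite (le_trans _ (fPhi 0%N)) // big_ord0.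
elim: k => [|k IH].
  case: N => [|N]; first by rewrite big_ord0 expr0.
  by rewrite big_ord_recl /= mulr0 expR0 mulr1 big1 ?addr0 // => i _; rewrite mul0r.
apply: (@le_trans _ _ (\sum_(n < N) convol (fun i => f i * W i) (fun i => cpow f k i * W i) n)).
  apply: ler_sum => n _; rewrite cpowS mulr_suml; apply: ler_sum => i _.
  rewrite [leRHS]mulrACA -/(W n) -expRD -mulrDr -natrD subnKC //.
  by rewrite -ltnS.
apply: (le_trans (sum_convol_le _ _ _)) => [i|i|].
- by rewrite mulr_ge0.
- by rewrite mulr_ge0 // cpow_ge0.
rewrite exprS; apply: ler_pM => //; apply: sumr_ge0 => i _.
  by rewrite mulr_ge0.
by rewrite mulr_ge0 // cpow_ge0.
Qed.

(** The single term [n] of the sum that defines the exponential moment. *)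
Lemma cpow_chernoff f (lam Phi : R) k n :
  (forall i, 0 <= f i) ->
  (forall M, \sum_(i < M) f i * expR (lam * i%:R) <= Phi) ->
  cpow f k n <= expR (- (lam * n%:R)) * Phi ^+ k.
Proof.
move=> f0 fPhi; have := cpow_exp_moment k n.+1 f0 fPhi.
rewrite big_ord_recr /= => H.
rewrite -(ler_pM2r (expR_gt0 (lam * n%:R))) mulrAC -expRD addNr expR0 mul1r.
apply: le_trans H; rewrite lerDr sumr_ge0 // => i _.
by rewrite mulr_ge0 ?expR_ge0 // cpow_ge0.
Qed.

(** The factors [f] are exchanged for [h] one at a time. Each exchange leaves
   one factor [f - h], which is at most [s] and vanishes beyond [y], so that the
   [k - 1] other factors have to reach at least [n - y]: this is paid for with
   their exponential moments. Applied along dyadic levels, this single step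
   gives both [big_jump] and [cpow_concentration]. *)
Lemma cpow_peel f h (s y lam Phi : R) k n :
  (forall i, 0 <= h i) -> (forall i, h i <= f i) ->
  (forall i, f i - h i <= s) -> (forall i, y < i%:R -> f i = h i) ->
  0 <= s -> 0 <= lam ->
  (forall M, \sum_(i < M) f i * expR (lam * i%:R) <= Phi) ->
  cpow f k n <=
    cpow h k n + k%:R * s * expR (- (lam * (n%:R - y))) * Phi ^+ k.-1.
Proof.
move=> h0 hf fhs fy s0 lam0 fPhi.
have f0 i : 0 <= f i by exact: le_trans (hf i).
have Phi0 : 0 <= Phi by rewrite (le_trans _ (fPhi 0%N)) // big_ord0.
elim: k n => [|k IH] n; first by rewrite !mul0r addr0.
have -> : cpow f k.+1 n = \sum_(i < n.+1) h i * cpow f k (n - i)%N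
    + \sum_(i < n.+1) (f i - h i) * cpow f k (n - i)%N.
  by rewrite -big_split; apply: eq_bigr => i _ /=; rewrite -mulrDl addrC subrK.
have second : \sum_(i < n.+1) (f i - h i) * cpow f k (n - i)%N <=
    s * expR (- (lam * (n%:R - y))) * Phi ^+ k.
  apply: le_trans (ler_wpM2l _ (cpow_exp_moment k n.+1 f0 fPhi)); last first.
    by rewrite mulr_ge0 // expR_ge0.
  rewrite [leRHS]mulr_sumr [leRHS](reindex_inj rev_ord_inj) /=.
  apply: ler_sum => i _; rewrite subSS.
  have c0 : 0 <= cpow f k (n - i)%N by exact: cpow_ge0.
  have [yi|iy] := ltP y i%:R.
    by rewrite fy // subrr mul0r !mulr_ge0 // ?expR_ge0.
  rewrite [leRHS](_ : _ = s * expR (lam * (y - i%:R)) * cpow f k (n - i)%N).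
    rewrite ler_wpM2r // (le_trans (fhs i)) // ler_peMr //.
    by rewrite (le_trans _ (expR_ge1Dx _)) // lerDl mulr_ge0 // subr_ge0.
  have -> : expR (lam * (y - i%:R)) =
      expR (- (lam * (n%:R - y))) * expR (lam * (n - i)%:R).
    by rewrite -expRD natrB -1?ltnS //; congr expR; ring.
  ring.
apply: (le_trans (lerD (lexx _) second)).
rewrite -(natr1 k) mulrDl mulrDl mulrDl mul1r addrA lerD2r.
case: k IH {second} => [|k] IH.
  by rewrite !mul0r addr0 le_eqVlt; apply/orP; left; apply/eqP.
apply: (@le_trans _ _ (\sum_(i < n.+1) (h i * cpow h k.+1 (n - i)%N +
   k.+1%:R * s * expR (- (lam * (n%:R - y))) * Phi ^+ k * (h i * expR (lam * i%:R))))).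
  apply: ler_sum => i _; apply: le_trans (ler_wpM2l (h0 i) (IH _)) _.
  rewrite mulrDr lerD2l le_eqVlt; apply/orP; left; apply/eqP.
  have -> : expR (- (lam * ((n - i)%:R - y))) =
      expR (- (lam * (n%:R - y))) * expR (lam * i%:R).
    by rewrite -expRD natrB -1?ltnS //; congr expR; ring.
  rewrite /=; ring.
rewrite big_split lerD2l -mulr_sumr /= [in leRHS]exprSr !mulrA ler_wpM2l //.
  by rewrite !mulr_ge0 ?exprn_ge0 ?expR_ge0 ?ler0n.
apply: le_trans (fPhi n.+1); apply: ler_sum => i _.
by rewrite ler_wpM2r ?expR_ge0.
Qed.

Lemma cpow_le_mass f k n : (forall i, 0 <= f i) ->
  (forall M, \sum_(i < M) f i <= 1) -> cpow f k n <= 1.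
Proof.
move=> f0 f1; have := @cpow_chernoff f 0 1 k n f0.
rewrite mul0r oppr0 expR0 expr1n mulr1; apply => M.
by under eq_bigr do rewrite mul0r expR0 mulr1.
Qed.

Lemma cpow_sum_le f k N : (forall i, 0 <= f i) ->
  (forall M, \sum_(i < M) f i <= 1) -> \sum_(n < N) cpow f k n <= 1.
Proof.
move=> f0 f1; have := @cpow_exp_moment f 0 1 k N f0; rewrite expr1n.
under eq_bigr do rewrite mul0r expR0 mulr1.
by apply => M; under eq_bigr do rewrite mul0r expR0 mulr1.
Qed.

(** The expected number of visits to [n] of the random walk with steps [f]
   is at most that to [0], which is geometric. *)
Lemma renewal_bound f K n : (forall i, 0 <= f i) ->
  (forall M, \sum_(i < M) f i <= 1) -> f 0%N < 1 ->
  \sum_(k < K) cpow f k n <= (1 - f 0%N)^-1.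
Proof.
move=> f0 f1 f01; have u0 : 0 < (1 - f 0%N)^-1 by rewrite invr_gt0 subr_gt0.
elim: K n => [|K IH] n; first by rewrite big_ord0 ltW.
rewrite big_ord_recl /=.
rewrite /convol exchange_big /=.
have H (i : 'I_n.+1) : \sum_(k < K) f i * cpow f k (n - i)%N
    <= f i * (1 - f 0%N)^-1 by rewrite -mulr_sumr ler_wpM2l.
case: n H => [|n] H.
  rewrite big_ord1; apply: (le_trans (lerD (lexx _) (H ord0))) => /=.
  have : (1 - f 0%N) * (1 - f 0%N)^-1 = 1 by rewrite mulfV // subr_eq0 gt_eqF.
  lra.
rewrite /= add0r; apply: (le_trans (ler_sum _ (fun i _ => H i))).
by rewrite -mulr_suml; apply: ler_piMl (f1 _); exact: ltW.
Qed.

(** A sum of [k] terms that reaches [n] has a term that is at least [n / k]: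
   once the values from [n / k] on are removed by [cpow_peel], nothing is left. *)
Lemma cpow_max_bound f (s : R) k n : (forall i, 0 <= f i) ->
  (forall M, \sum_(i < M) f i <= 1) ->
  (forall i, (i <= n)%N -> (n <= i * k)%N -> f i <= s) -> 0 <= s ->
  (0 < n)%N ->
  cpow f k n <= k%:R * s.
Proof.
move=> f0 f1 fs s0 n0.
pose f' i := if (i <= n)%N then f i else 0.
pose h i := if (i * k < n)%N then f' i else 0.
have f'0 i : 0 <= f' i by rewrite /f'; case: ifP.
have h0 i : 0 <= h i by rewrite /h; case: ifP.
have hf i : h i <= f' i by rewrite /h; case: ifP.
rewrite (@eq_cpow f f') => [|i in_]; last by rewrite /f' in_.
have mass M : \sum_(i < M) f' i * expR (0 * i%:R) <= 1.
  apply: le_trans (f1 M); apply: ler_sum => i _.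
  by rewrite mul0r expR0 mulr1 /f'; case: ifP.
apply: le_trans (@cpow_peel f' h s n%:R 0 1 k n h0 hf _ _ s0 (lexx 0) mass) _.
- move=> i; rewrite /h /f'; case: (leqP i n) => [in_|_]; last first.
    by rewrite if_same subrr.
  by case: (ltnP (i * k) n) => H; rewrite ?subrr // subr0 fs.
- by move=> i; rewrite ltr_nat /h /f' => /ltn_geF ->; rewrite if_same.
rewrite mul0r oppr0 expR0 expr1n !mulr1 gerDr.
suff H : forall j m, (forall i, h i != 0 -> (i * k < n)%N) ->
     cpow h j m != 0 -> (m * k <= j * n)%N /\ ((0 < j)%N -> (m * k < j * n)%N).
  suff /eqP -> : cpow h k n == 0 by [].
  apply/negPn/negP => hk0; have [|_ {}H] := H k n _ hk0.
    by move=> i; rewrite /h; case: ifP => //; rewrite eqxx.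
  case: (posnP k) => [k0|k0]; last by move: (H k0); rewrite mulnC ltnn.
  by move: hk0; rewrite k0 /= (gtn_eqF n0) eqxx.
move=> j; elim: j => [|j IH] m hn.
  by rewrite /=; case: m => [|m]; rewrite ?eqxx //= mul0n.
rewrite cpowS => cn.
have [i /andP[hi ci]] : exists i : 'I_m.+1, (h i != 0) && (cpow h j (m - i)%N != 0).
  apply/existsP; move: cn; apply: contraNT; rewrite negb_exists => /forallP H.
  rewrite big1 // => i _; apply/eqP; rewrite mulf_eq0.
  by have := H i; rewrite negb_and !negbK.
have [le1 _] := IH _ hn ci.
have := hn _ hi; have im : (i <= m)%N by rewrite -ltnS.
have : ((m - i) * k + i * k = m * k)%N by rewrite -mulnDl subnK.
by rewrite mulSn => <- lt1; split => [|_]; lia.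
Qed.

End Convolution.

(** * Long tails and subexponentiality *)

Section Subexponential.
Context {R : realType}.
Implicit Types (p q g h : nat -> R) (e : R).

(** Summability of a nonnegative sequence in Cauchy form, which spares naming
   the value of the sum. *)
Definition small_tails g :=
  forall e : R, 0 < e -> exists A, forall M, \sum_(A <= i < M) g i <= e.

Lemma small_tails_ge g A e : (forall i, 0 <= g i) ->
  (forall M, \sum_(A <= i < M) g i <= e) ->
  forall A' M, (A <= A')%N -> \sum_(A' <= i < M) g i <= e.
Proof.
move=> g0 H A' M AA'; have [AM|MA] := leqP A' M.
  apply: le_trans (H M); rewrite [leRHS](big_cat_nat (n := A')) //=.
  by rewrite lerDr sumr_ge0.
rewrite big_geq ?(ltnW MA) //; have := H A; by rewrite big_geq.
Qed.

Lemma small_tails_le g h : (exists N, forall i, (N <= i)%N -> g i <= h i) ->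
  (forall i, 0 <= h i) -> small_tails h -> small_tails g.
Proof.
move=> [N gh] h0 hs e e0; have [A HA] := hs e e0.
exists (maxn A N) => M.
apply: le_trans (small_tails_ge h0 HA M (leq_maxl A N)).
rewrite big_nat_cond [leRHS]big_nat_cond; apply: ler_sum => i.
by rewrite geq_max andbT => /andP[/andP[_ Ni] _]; exact: gh.
Qed.

Lemma small_tailsZ g (c : R) : 0 <= c -> small_tails g ->
  small_tails (fun i => c * g i).
Proof.
move=> c0 gs e e0; have c1 : 0 < c + 1 by rewrite ltr_wpDl.
have [A HA] := gs (e / (c + 1)) (divr_gt0 e0 c1).
exists A => M; rewrite -mulr_sumr; apply: le_trans (ler_wpM2l c0 (HA M)) _.
by rewrite mulrCA ler_piMr ?(ltW e0) // ler_pdivrMr // mul1r lerDl.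
Qed.

Lemma small_tails_bounded g (D : R) : (forall i, 0 <= g i) ->
  (forall M, \sum_(i < M) g i <= D) -> small_tails g.
Proof.
move=> g0 gD e e0.
have cg : cvgn (series g).
  apply: nondecreasing_is_cvgn.
    apply/nondecreasing_seqP => n; rewrite seriesSr lerDl //.
  exists D => _ [n _ <-]; rewrite /series /= big_mkord; exact: gD.
have : cauchy (series g @ \oo) by exact: cvg_cauchy.
move/cauchy_seriesP => /(_ e e0) [[A B] /= [[nA _ HA] [nB _ HB]] H].
exists (maxn nA nB) => M.
have [MA|AM] := leqP M (maxn nA nB); first by rewrite big_geq // ltW.
rewrite -[leLHS]ger0_norm ?sumr_ge0 //; apply/ltW/(H (maxn nA nB, M)); split => /=.
  by apply: HA => /=; rewrite leq_maxl.
by apply: HB => /=; rewrite (leq_trans (leq_maxr nA _)) // ltnW.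
Qed.

Lemma near_bounded_forall (P : nat -> nat -> Prop) A :
  (forall j, (j < A)%N -> \forall n \near \oo, P j n) ->
  \forall n \near \oo, forall j, (j < A)%N -> P j n.
Proof.
elim: A => [|A IH] H; first by near=> n.
have H1 : \forall n \near \oo, forall j, (j < A)%N -> P j n.
  by apply: IH => j jA; apply: H; rewrite ltnS ltnW.
apply: filterS2 H1 (H A (ltnSn A)) => n h1 h2 j.
by rewrite ltnS leq_eqVlt => /orP[/eqP ->|/h1].
Unshelve. all: by end_near. Qed.

Definition long_tailed p :=
  (\forall n \near \oo, 0 < p n) /\
  forall e : R, 0 < e ->
    \forall n \near \oo, (1 - e) * p n.+1 <= p n <= (1 + e) * p n.+1.

Lemma long_tailed_shift p j e : long_tailed p -> 0 < e ->
  \forall n \near \oo, (1 - e) * p n <= p (n - j)%N <= (1 + e) * p n.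
Proof.
move=> [ppos pr]; elim: j e => [|j IH] e e0.
  apply: filterS ppos => n pn; rewrite subn0; apply/andP; split; nra.
pose e1 := Num.min (e / 3) 1.
have e10 : 0 < e1 by rewrite lt_min ltr01 divr_gt0.
have e11 : e1 <= 1 by rewrite ge_min lexx orbT.
have e1e : e1 <= e / 3 by rewrite ge_min lexx.
have [N _ HN] := pr e1 e10; have [N' _ HN'] := ppos.
have L : \forall n \near \oo, (N + N' + j.+1 <= n)%N by exact: nbhs_infty_ge.
apply: filterS2 (IH e1 e10) L => n /andP[h1 h2] Ln.
have nj : (n - j = (n - j.+1).+1)%N by lia.
have /andP[h3 h4] := HN (n - j.+1)%N ltac:(rewrite /=; lia).
rewrite -nj in h3 h4.
have pn := HN' n ltac:(rewrite /=; lia); have pnj := HN' (n - j)%N ltac:(rewrite /=; lia).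
rewrite /= in pn pnj.
apply/andP; split; nra.
Qed.

(** Subexponentiality says that the convolution square at [n] is asymptotic to
   [2 * p n], since either of the two summands can be the large one. Leaving out
   the terms with [j] bounded removes one of these two ways. *)
Definition subexp p := forall e : R, 0 < e -> exists A0, forall A, (A0 <= A)%N ->
  \forall n \near \oo, \sum_(A <= j < n.+1) p j * p (n - j)%N <= (1 + e) * p n.

Section Law.
Variable p : nat -> R.
Hypothesis p0 : forall i, 0 <= p i.
Hypothesis p1 : forall M, \sum_(i < M) p i <= 1.
Hypothesis p_lt : long_tailed p.

Let cpow_split k n A : (A <= n.+1)%N ->
  cpow p k.+1 n = \sum_(j < A) p (n - j)%N * cpow p k j
    + \sum_(A <= j < n.+1) p (n - j)%N * cpow p k j.
Proof.
move=> An; rewrite cpowS -/(convol p (cpow p k) n) convol_rev.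
by rewrite -(big_mkord xpredT (fun j => p (n - j)%N * cpow p k j)) (big_cat_nat (n := A)) //= big_mkord.
Qed.

Let near_shift A e : 0 < e ->
  \forall n \near \oo, forall j, (j < A)%N -> p (n - j)%N <= (1 + e) * p n.
Proof.
move=> e0; apply: near_bounded_forall => j _.
by apply: filterS (long_tailed_shift j p_lt e0) => n /andP[].
Qed.

Let head_le k n A e : 0 <= e -> 0 <= p n ->
  (forall j, (j < A)%N -> p (n - j)%N <= (1 + e) * p n) ->
  \sum_(j < A) p (n - j)%N * cpow p k j <= (1 + e) * p n.
Proof.
move=> e0 pn H.
apply: (@le_trans _ _ ((1 + e) * p n * \sum_(j < A) cpow p k j)).
  rewrite mulr_sumr; apply: ler_sum => j _.
  by rewrite ler_wpM2r ?cpow_ge0 // H.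
by rewrite ler_piMr ?cpow_sum_le // mulr_ge0 // addr_ge0.
Qed.

(** By induction on [k]: either the sum of the first [k] terms stays bounded and
   the last term is large, which gives [p n] by the long tail, or that sum is
   large, about [k * p j], and subexponentiality applies. *)
Lemma cpow_le_asymp k e : subexp p -> 0 < e ->
  \forall n \near \oo, cpow p k n <= (k%:R + e) * p n.
Proof.
move=> psub; elim: k e => [|k IH] e e0.
  have L : \forall n \near \oo, (1 <= n)%N by exact: nbhs_infty_ge.
  apply: filterS L => n n1 /=; rewrite (gtn_eqF n1) add0r.
  by rewrite mulr_ge0 // ltW.
have k0 : 0 <= k%:R :> R by exact: ler0n.
pose e1 := e / (k%:R + 3 + e).
have d0 : 0 < k%:R + 3 + e by lra.
have e10 : 0 < e1 by rewrite divr_gt0.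
have e1E : e1 * (k%:R + 3 + e) = e by rewrite /e1 divfK // gt_eqF.
have e11 : e1 <= 1 by rewrite ler_pdivrMr // mul1r; lra.
have [A0 HA0] := psub e1 e10.
have [A1 _ HA1] := IH e1 e10.
pose A := maxn A0 A1.
have L : \forall n \near \oo, (A <= n)%N by exact: nbhs_infty_ge.
apply: filterS3 (HA0 A (leq_maxl _ _)) (near_shift A e10) L => n h1 h2 An.
rewrite (cpow_split k (leqW An)).
have T : \sum_(A <= j < n.+1) p (n - j)%N * cpow p k j
    <= (k%:R + e1) * ((1 + e1) * p n).
  apply: le_trans (ler_wpM2l _ h1); last by rewrite addr_ge0 // ltW.
  rewrite mulr_sumr big_nat_cond [leRHS]big_nat_cond; apply: ler_sum => j.
  move=> /andP[/andP[Aj _] _].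
  have hj : cpow p k j <= (k%:R + e1) * p j.
    by apply: HA1; apply: leq_trans (leq_maxr _ _) Aj.
  by have := p0 (n - j)%N; nra.
apply: le_trans (lerD (head_le k (ltW e10) (p0 n) h2) T) _.
rewrite -natr1 [_ * (_ * p n)]mulrA -mulrDl ler_wpM2r //.
nra.
Qed.

(** Kesten's bound, which is uniform in [k]. In the recursion on [k], the terms
   [j < A] add at most [2 * p n] and the others multiply the bound for [k] by
   [1 + e / 2]; a large constant absorbs the former into the remaining [e / 2]. *)
Lemma cpow_kesten e : subexp p -> 0 < e ->
  exists2 C : R, 0 < C & \forall n \near \oo, forall k,
    cpow p k n <= C * (1 + e) ^+ k * p n.
Proof.
move=> psub e0.
have e20 : 0 < e / 2 by rewrite divr_gt0.
have [A0 HA0] := psub _ e20; have [Np _ HNp] := p_lt.1.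
pose A := (maxn A0 Np).+1.
have [n1 _ Hn1] : \forall n \near \oo,
    \sum_(A <= j < n.+1) p j * p (n - j)%N <= (1 + e / 2) * p n /\
    (forall j, (j < A)%N -> p (n - j)%N <= (1 + 1) * p n).
  apply: filterS2 (HA0 A _) (near_shift A ltr01) => //.
  by rewrite ltnW // ltnS leq_maxl.
(* For the finitely many [n] below [n1] the trivial bound [1] is turned into a
   multiple of [p n]. *)
pose C' := 2 + \sum_(A <= i < n1 + A) (p i)^-1.
have ppos i : (A <= i)%N -> 0 < p i.
  by move=> Ai; apply: HNp => /=; apply: leq_trans Ai; rewrite ltnW // ltnS leq_maxr.
have S0 : 0 <= \sum_(A <= i < n1 + A) (p i)^-1.
  by apply: sumr_ge0 => i _; rewrite invr_ge0.
have C'2 : 2 <= C' by rewrite lerDl.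
have small n : (A <= n)%N -> (n < n1)%N -> 1 <= C' * p n.
  move=> An nn1; rewrite -ler_pdivrMr ?div1r; last exact: ppos.
  have nm : (n < n1 + A)%N by exact: ltn_addr.
  rewrite /C' (big_cat_nat An (ltnW nm)) /= (big_ltn nm).
  have : 0 <= \sum_(A <= i < n) (p i)^-1 by apply: sumr_ge0 => i _; rewrite invr_ge0.
  have : 0 <= \sum_(n.+1 <= i < n1 + A) (p i)^-1.
    by apply: sumr_ge0 => i _; rewrite invr_ge0.
  lra.
pose D := C' * (2 / e) + C'.
have C'0 : 0 < C' by lra.
have ie0 : 0 < C' * (2 / e) by rewrite mulr_gt0 // divr_gt0.
have D0 : 0 < D by rewrite addr_gt0.
have D'D : C' <= D by rewrite lerDr ltW.
exists D => //.
have L : \forall n \near \oo, (A <= n)%N by exact: nbhs_infty_ge.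
apply: filterS L => n An k; elim: k n An => [|k IH] n An.
  by rewrite /= (gtn_eqF (leq_trans _ An)) // !mulr_ge0 ?exprn_ge0 // ltW // addr_gt0.
have X1 : 1 <= (1 + e) ^+ k by rewrite exprn_ege1 // lerDl ltW.
have pn := ppos n An.
have [nn1|n1n] := ltnP n n1.
  apply: le_trans (cpow_le_mass _ _ p0 p1) _; apply: le_trans (small n An nn1) _.
  rewrite ler_wpM2r // (le_trans D'D) // ler_peMr ?(ltW D0) //.
  by rewrite exprn_ege1 // lerDl ltW.
have [h1 h2] := Hn1 n n1n.
rewrite (cpow_split k (leqW An)).
have T : \sum_(A <= j < n.+1) p (n - j)%N * cpow p k j
    <= D * (1 + e) ^+ k * ((1 + e / 2) * p n).
  apply: le_trans (ler_wpM2l _ h1); last by rewrite mulr_ge0 ?exprn_ge0 ?ltW // addr_gt0.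
  rewrite mulr_sumr big_nat_cond [leRHS]big_nat_cond; apply: ler_sum => j.
  move=> /andP[/andP[Aj _] _]; rewrite mulrA [leRHS]mulrC ler_wpM2l //.
  exact: IH.
apply: le_trans (lerD (head_le k ler01 (p0 n) h2) T) _.
have De : C' * 2 <= D * e.
  have -> : D * e = C' * 2 * (e / e) + C' * e by rewrite /D; ring.
  by rewrite divff ?gt_eqF // mulr1 lerDl mulr_ge0 // ltW.
rewrite [_ * (_ * p n)]mulrA -mulrDl ler_wpM2r // exprS.
set x := (1 + e) ^+ k in X1 *.
have : 4 * 1 <= D * e * x by apply: ler_pM => //; nra.
nra.
Qed.

(** By the long tail, the terms [j < A] of the convolution square already
   contribute [p n] times the mass below [A], that is, almost [p n]. *)
Lemma subexp_of_conv2 :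
  (forall e, 0 < e -> exists A, 1 - e <= \sum_(i < A) p i) ->
  (forall e, 0 < e -> \forall n \near \oo,
     \sum_(i < n.+1) p i * p (n - i)%N <= (2 + e) * p n) ->
  subexp p.
Proof.
move=> mass c2 e e0.
pose e1 := Num.min (e / 4) 1.
have e10 : 0 < e1 by rewrite lt_min ltr01 divr_gt0.
have e11 : e1 <= 1 by rewrite ge_min lexx orbT.
have e1e : e1 <= e / 4 by rewrite ge_min lexx.
have [A0 HA0] := mass e1 e10; exists A0 => A AA0.
have L : \forall n \near \oo, (A <= n)%N by exact: nbhs_infty_ge.
have sh : \forall n \near \oo, forall j, (j < A)%N -> (1 - e1) * p n <= p (n - j)%N.
  apply: near_bounded_forall => j _.
  by apply: filterS (long_tailed_shift j p_lt e10) => n /andP[].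
apply: filterS3 (c2 e1 e10) sh L => n h1 h2 An.
have massA : 1 - e1 <= \sum_(i < A) p i.
  apply: le_trans HA0 _; rewrite -!(big_mkord xpredT p).
  by rewrite [leRHS](big_cat_nat (n := A0)) //= lerDl sumr_ge0.
move: h1; rewrite -(big_mkord xpredT (fun i => p i * p (n - i)%N)).
rewrite (big_cat_nat (n := A)) ?leqW //= big_mkord.
have : \sum_(i < A) p i * ((1 - e1) * p n) <= \sum_(i < A) p i * p (n - i)%N.
  by apply: ler_sum => i _; rewrite ler_wpM2l // h2.
rewrite -mulr_suml => h3 h4.
have := p0 n; set s := \sum_(i < A) p i in h3 massA *.
have : (1 - e1) * ((1 - e1) * p n) <= s * ((1 - e1) * p n).
  by rewrite ler_wpM2r // mulr_ge0 // subr_ge0.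
nra.
Qed.

(** One of [j] and [n - j] is at least [n / 2], where [p] is at most [C * p n].
   The other one ranges over [A, A + 1, ...], which has little mass, or it is
   [n - j < A], and then the long tail replaces [C] by [1 + e / 3]. *)
Lemma subexp_of_half_dom (C : R) : small_tails p -> 0 < C ->
  (\forall n \near \oo, forall x, (x <= n)%N -> (n <= x * 2)%N ->
    p x <= C * p n) ->
  subexp p.
Proof.
move=> tp C0 hd e e0.
have e30 : 0 < e / 3 by rewrite divr_gt0.
have e3C0 : 0 < e / 3 / C by rewrite divr_gt0.
have [A0 HA0] := tp _ e3C0.
exists A0 => A AA0.
have tA := @small_tails_ge p A0 _ p0 HA0 A _ AA0.
have L : \forall n \near \oo, (2 * A <= n)%N by exact: nbhs_infty_ge.
apply: filterS3 hd (near_shift A e30) L => n h1 h2 An.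
have pn := p0 n.
pose b i := if (i < A)%N then (1 + e / 3) * p n * p i else C * p n * p i.
have b0 i : 0 <= b i by rewrite /b; case: ifP => _; rewrite !mulr_ge0 // ?addr_ge0 // ltW.
have T j : (A <= j < n.+1)%N -> p j * p (n - j)%N <= C * p n * p j + b (n - j)%N.
  move=> /andP[Aj]; rewrite ltnS => jn.
  have [jn2|nj2] := leqP (2 * j) n.
    rewrite ler_wpDr // mulrC ler_wpM2r //; apply: h1; lia.
  rewrite ler_wpDl ?mulr_ge0 ?(ltW C0) // /b; case: ltnP => njA.
    rewrite ler_wpM2r // -[j in p j](subKn jn); exact: h2.
  rewrite ler_wpM2r //; apply: h1 => //; lia.
rewrite big_nat_cond; apply: le_trans (ler_sum _ _) _.
  by move=> j /andP[Hj _]; exact: T Hj.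
rewrite -big_nat_cond big_split /= -mulr_sumr.
have B : \sum_(A <= j < n.+1) b (n - j)%N <= \sum_(i < n.+1) b i.
  rewrite [leRHS](reindex_inj rev_ord_inj) /=.
  under [leRHS]eq_bigr do rewrite subSS.
  rewrite -(big_mkord xpredT (fun j => b (n - j)%N)).
  rewrite [leRHS](big_cat_nat (n := A)) //=; last by lia.
  by rewrite lerDr sumr_ge0.
apply: le_trans (lerD (lexx _) B) _.
rewrite -(big_mkord xpredT b) [X in _ + X <= _](big_cat_nat (n := A)) //=; last by lia.
have -> : \sum_(0 <= i < A) b i = (1 + e / 3) * p n * \sum_(i < A) p i.
  rewrite big_mkord mulr_sumr; apply: eq_bigr => i _.
  by rewrite /b ltn_ord.
have -> : \sum_(A <= i < n.+1) b i = C * p n * \sum_(A <= i < n.+1) p i.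
  rewrite mulr_sumr [LHS]big_nat_cond [RHS]big_nat_cond.
  by apply: eq_bigr => i /andP[/andP[Ai _] _]; rewrite /b ltnNge Ai.
have H3 : C * p n * \sum_(A <= i < n.+1) p i <= e / 3 * p n.
  apply: le_trans (ler_wpM2l _ (tA n.+1)) _; first by rewrite mulr_ge0 // ltW.
  have -> : C * p n * (e / 3 / C) = e / 3 * p n * (C / C) by ring.
  by rewrite divff ?mulr1 // gt_eqF.
have H4 : (1 + e / 3) * p n * \sum_(i < A) p i <= (1 + e / 3) * p n.
  by rewrite ler_piMr // mulr_ge0 // addr_ge0 // ltW.
lra.
Qed.

(** * Sums of a random number of terms *)

Variable q : nat -> R.
Hypothesis q0 : forall k, 0 <= q k.

(** What allows the limit [n --> \oo] to be taken term by term in the sum over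
   the number [k] of summands. *)
Definition tail_negligible := forall e : R, 0 < e ->
  exists K, \forall n \near \oo,
    forall M, \sum_(K <= k < M) q k * cpow p k n <= e * p n.

Lemma tail_negligible_dom (B : nat -> R) :
  (\forall n \near \oo, forall k, cpow p k n <= B k * p n) ->
  small_tails (fun k => q k * B k) -> tail_negligible.
Proof.
move=> HB tB e e0; have [K HK] := tB e e0; exists K.
apply: filterS HB => n Hn M.
apply: le_trans (ler_wpM2r (p0 n) (HK M)).
rewrite mulr_suml; apply: ler_sum => k _.
by rewrite -mulrA ler_wpM2l.
Qed.

Lemma random_sum_upper (D : R) : subexp p -> tail_negligible ->
  (forall M, \sum_(k < M) q k * k%:R <= D) ->
  forall e, 0 < e -> \forall n \near \oo, forall M,
    \sum_(k < M) q k * cpow p k n <= (D + e) * p n.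
Proof.
move=> psub qt qD e e0.
have e20 : 0 < e / 2 by rewrite divr_gt0.
have [K HK] := qt _ e20.
pose s := \sum_(k < K) q k; have s0 : 0 <= s by exact: sumr_ge0.
have s1 : 0 < s + 1 by rewrite ltr_wpDl.
have e10 : 0 < e / 2 / (s + 1) by rewrite divr_gt0.
have small : \forall n \near \oo, forall k, (k < K)%N ->
    cpow p k n <= (k%:R + e / 2 / (s + 1)) * p n.
  by apply: near_bounded_forall => k _; exact: cpow_le_asymp.
apply: filterS2 HK small => n h1 h2 M.
apply: (@le_trans _ _ (\sum_(k < maxn K M) q k * cpow p k n)).
  rewrite -!(big_mkord xpredT (fun k => q k * cpow p k n)).
  rewrite [leRHS](big_cat_nat (n := M)) ?leq_maxr //= lerDl sumr_ge0 // => k _.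
  by rewrite mulr_ge0 // cpow_ge0.
rewrite -(big_mkord xpredT (fun k => q k * cpow p k n)).
rewrite (big_cat_nat (n := K)) ?leq_maxl //= big_mkord.
have H : \sum_(k < K) q k * cpow p k n <= (D + e / 2) * p n.
  apply: (@le_trans _ _ (\sum_(k < K) q k * ((k%:R + e / 2 / (s + 1)) * p n))).
    by apply: ler_sum => k _; rewrite ler_wpM2l // h2.
  under eq_bigr do rewrite mulrA mulrDr.
  rewrite -mulr_suml ler_wpM2r // big_split /= lerD //.
    exact: qD.
  rewrite -mulr_suml -/s.
  rewrite mulrCA ler_piMr ?(ltW e20) // ler_pdivrMr // mul1r; lra.
by have := lerD H (h1 (maxn K M)); rewrite -mulrDl -addrA -splitr.
Qed.

End Law.
End Subexponential.

(** * Elementary inequalities *)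

Section RealInequalities.
Context {R : realType}.

Lemma powR_expln (x a : R) : 0 < x -> x `^ a = expR (a * ln x).
Proof. by move=> x0; rewrite /powR gt_eqF. Qed.

Lemma powR_exprn (x a : R) n : 0 <= x -> (x ^+ n) `^ a = (x `^ a) ^+ n.
Proof.
by move=> x0; rewrite -powR_mulrn // -powRrM mulrC powRrM powR_mulrn // powR_ge0.
Qed.

Lemma powRNV (x a : R) : 0 < x -> x `^ a * x `^ (- a) = 1.
Proof. by move=> x0; rewrite powRN divff // gt_eqF // powR_gt0. Qed.

Lemma ler_powR_base (x y a : R) : 0 <= a -> 0 <= x -> x <= y -> x `^ a <= y `^ a.
Proof.
move=> a0 x0 xy; apply: ge0_ler_powR => //; rewrite nnegrE //; exact: le_trans xy.
Qed.

Lemma ler_powRN_base (x y a : R) : a <= 0 -> 0 < x -> x <= y -> y `^ a <= x `^ a.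
Proof.
move=> a0 x0 xy; have y0 : 0 < y by exact: lt_le_trans xy.
rewrite -[a]opprK !(powRN _ (- a)) lef_pV2 ?posrE ?powR_gt0 //.
by apply: ler_powR_base => //; rewrite ?oppr_ge0 // ltW.
Qed.

Lemma powR_invr (x a : R) : 0 <= x -> x^-1 `^ a = (x `^ a)^-1.
Proof.
by move=> x0; rewrite -powR_inv1 // powRAC powR_inv1 ?powR_ge0.
Qed.

Lemma expRN_half (u : R) : 0 <= u <= 1 -> expR (- u) <= 1 - u / 2.
Proof.
move=> /andP[u0 u1]; have H := expR_ge1Dx u.
have Ep := expR_gt0 (- u); have := expRxMexpNx_1 u => E.
have : expR (- u) * (1 + u) <= expR (- u) * expR u by rewrite ler_wpM2l // ltW.
rewrite mulrC (mulrC _ (expR u)) E => H2; nra.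
Qed.

Lemma expR_le1D3x (u : R) : 0 <= u <= 1 -> expR u <= 1 + 3 * u.
Proof.
move=> /andP[u0 u1].
have H : expR (u / 2) <= 1 + u.
  have H2 := expR_ge1Dx (- (u / 2)).
  have Ep := expR_gt0 (u / 2); have := expRxMexpNx_1 (u / 2) => E.
  have : expR (u / 2) * (1 + - (u / 2)) <= 1 by rewrite -[leRHS]E ler_wpM2l // ltW.
  nra.
have -> : expR u = expR (u / 2) * expR (u / 2) by rewrite -expRD -splitr.
have Ep := expR_gt0 (u / 2); nra.
Qed.

(** The three sums below are compared with an antiderivative [G] of the summand. *)
Lemma sum_le_telescope (F G : nat -> R) n :
  (forall i, (0 < i)%N -> F i <= G i - G i.-1) ->
  \sum_(1 <= i < n.+1) F i <= G n - G 0%N.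
Proof.
move=> FG; elim: n => [|n IH]; first by rewrite big_geq // subrr.
rewrite big_nat_recr //=; apply: le_trans (lerD IH (FG n.+1 isT)) _.
by rewrite /= addrC subrKA.
Qed.

Lemma sum_powR_le (g : R) n : 0 < g <= 1 ->
  \sum_(1 <= i < n.+1) i%:R `^ (g - 1) <= 2 / g * n%:R `^ g.
Proof.
move=> /andP[g0 g1].
apply: le_trans (@sum_le_telescope _ (fun n => 2 / g * n%:R `^ g) n _) _; last first.
  by rewrite /= gerBl mulr_ge0 ?powR_ge0 // divr_ge0 // ltW.
move=> [//|[|i]] _ /=.
  rewrite !powR1 powR0 ?gt_eqF // mulr0 subr0 mulr1.
  by rewrite ler_pdivlMr // mul1r; lra.
have [x xE] : exists x : R, x = i.+2%:R by exists i.+2%:R.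
rewrite -xE; have x2 : 2 <= x by rewrite xE ler_nat.
have x0 : 0 < x by lra.
have -> : i.+1%:R = x * (1 - x^-1).
  by rewrite mulrBr mulr1 divff ?gt_eqF // xE -[in RHS]natr1 addrK.
have xi : 0 < x^-1 by rewrite invr_gt0.
have xi2 : x^-1 <= 1 / 2 by rewrite div1r lef_pV2 ?posrE.
have xi1 : 0 < 1 - x^-1 by lra.
rewrite powRM ?(ltW x0) ?(ltW xi1) //.
have H : (1 - x^-1) `^ g <= 1 - g / 2 * x^-1.
  rewrite powR_expln //; apply: (@le_trans _ _ (expR (- (g * x^-1)))).
    rewrite ler_expR -mulrN ler_wpM2l ?(ltW g0) //.
    by apply: le_ln1Dx; lra.
  apply: le_trans (expRN_half _) _; last by rewrite le_eqVlt; apply/orP; left; apply/eqP; ring.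
  by apply/andP; split; nra.
rewrite powRB ?(gt_eqF x0) ?implybT // powRr1 ?(ltW x0) //.
have P := powR_gt0 g x0.
have : x `^ g * (1 - x^-1) `^ g <= x `^ g * (1 - g / 2 * x^-1) by rewrite ler_wpM2l // ltW.
set A := x `^ g * _; set B := x `^ g in P A *.
move=> HA.
have -> : B / x = 2 / g * (B - B * (1 - g / 2 * x^-1)).
  by field; rewrite !gt_eqF.
rewrite -mulrBr ler_wpM2l ?divr_ge0 ?(ltW g0) //; lra.
Qed.

Lemma sum_powRN_le (t : R) n : 0 < t ->
  \sum_(1 <= i < n.+1) i%:R `^ (-1 - t) <= 1 + t^-1.
Proof.
move=> t0; have ti : 0 < t^-1 by rewrite invr_gt0.
pose G i : R := if i is 0%N then - (1 + t^-1) else - (t^-1 * i%:R `^ (- t)).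
apply: le_trans (@sum_le_telescope _ G n _) _; last first.
  rewrite /= opprK gerDr; case: n => [|n] /=; first lra.
  by rewrite oppr_le0 mulr_ge0 ?powR_ge0 // ltW.
move=> [//|[|i]] _ /=; first by rewrite !powR1; lra.
have [x xE] : exists x : R, x = i.+2%:R by exists i.+2%:R.
rewrite -xE; have x2 : 2 <= x by rewrite xE ler_nat.
have x0 : 0 < x by lra.
have -> : i.+1%:R = x * (1 - x^-1).
  by rewrite mulrBr mulr1 divff ?gt_eqF // xE -[in RHS]natr1 addrK.
have xi : 0 < x^-1 by rewrite invr_gt0.
have xi2 : x^-1 <= 1 / 2 by rewrite div1r lef_pV2 ?posrE.
have xi1 : 0 < 1 - x^-1 by lra.
rewrite powRM ?(ltW x0) ?(ltW xi1) //.
have H : 1 + t * x^-1 <= (1 - x^-1) `^ (- t).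
  rewrite powR_expln //; apply: le_trans (expR_ge1Dx _) _; rewrite ler_expR.
  rewrite mulNr -mulrN ler_wpM2l ?(ltW t0) // lerNr.
  by apply: le_ln1Dx; lra.
rewrite addrC powRD ?(gt_eqF x0) ?implybT // powR_inv1 ?(ltW x0) //.
have P := powR_gt0 (- t) x0.
have : x `^ (- t) * (1 + t * x^-1) <= x `^ (- t) * (1 - x^-1) `^ (- t).
  by rewrite ler_wpM2l // ltW.
set A := x `^ (- t) * (1 - _) `^ _; set B := x `^ (- t) in P A *.
move=> HA.
have -> : B / x = t^-1 * (B * (1 + t * x^-1) - B).
  by field; rewrite !gt_eqF.
have -> : - (t^-1 * B) - - (t^-1 * A) = t^-1 * (A - B) by ring.
by rewrite ler_wpM2l ?(ltW ti) // lerD2r.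
Qed.

Lemma sum_inv_le n : (0 < n)%N ->
  \sum_(1 <= i < n.+1) i%:R^-1 <= 1 + ln n%:R :> R.
Proof.
move=> n0.
pose G i : R := if i is 0%N then -1 else ln i%:R.
apply: le_trans (@sum_le_telescope _ G n _) _; last first.
  by rewrite /= opprK; case: n n0 => [//|n] _ /=; rewrite addrC.
move=> [//|[|i]] _ /=; first by rewrite ln1 invr1; lra.
have [x xE] : exists x : R, x = i.+2%:R by exists i.+2%:R.
rewrite -xE; have x2 : 2 <= x by rewrite xE ler_nat.
have x0 : 0 < x by lra.
have -> : i.+1%:R = x * (1 - x^-1).
  by rewrite mulrBr mulr1 divff ?gt_eqF // xE -[in RHS]natr1 addrK.
have xi : 0 < x^-1 by rewrite invr_gt0.
have xi2 : x^-1 <= 1 / 2 by rewrite div1r lef_pV2 ?posrE.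
have xi1 : 0 < 1 - x^-1 by lra.
rewrite lnM ?posrE // opprD addNKr.
by rewrite lerNr; apply: le_ln1Dx; lra.
Qed.

Lemma expr_unbounded (r B : R) : 1 < r -> exists m, B <= r ^+ m.
Proof.
move=> r1; have r0 : 0 < r by lra.
have l0 : 0 < ln r by exact: ln_gt0.
have [B1|B1] := lerP B 1; first by exists 0%N; rewrite expr0.
exists (Num.truncn (ln B / ln r)).+1.
rewrite -ler_ln ?posrE ?exprn_gt0 ?lnXn //; last by lra.
rewrite -mulr_natr mulrC -ler_pdivrMr //.
by apply/ltW/truncnS_gt.
Qed.

(** Bounds the total cost of peeling along dyadic levels: the loss grows
   geometrically with the level, while the gain is exponential in a geometric
   sequence. *)
Lemma sum_geom_exp_bounded (B c r : R) : 0 < B -> 0 < c -> 1 < r ->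
  exists2 C : R, 0 < C &
    (forall J, \sum_(j < J) B ^+ j * expR (- (c * r ^+ j)) <= C) /\
    (forall j, B ^+ j * expR (- (c * r ^+ j)) <= C).
Proof.
move=> B0 c0 r1; have r0 : 0 < r by lra.
have [m Hm] := expr_unbounded (2 * B) r1.
pose D : R := (m.+1)`!%:R / c ^+ m.+1.
have D0 : 0 < D by rewrite divr_gt0 ?exprn_gt0 // ltr0n fact_gt0.
have term j : B ^+ j * expR (- (c * r ^+ j)) <= D * (2^-1) ^+ j.
  have y0 : 0 <= c * r ^+ j by rewrite mulr_ge0 ?exprn_ge0 // ltW.
  have H := expR_ge1Dxn m y0.
  rewrite expRN ler_pdivrMr ?expR_gt0 //.
  have H2 : (c * r ^+ j) ^+ m.+1 / (m.+1)`!%:R <= expR (c * r ^+ j).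
    by apply: le_trans H; rewrite lerDr.
  apply: le_trans (ler_wpM2l _ H2); last first.
    by rewrite mulr_ge0 ?exprn_ge0 ?invr_ge0 // ltW.
  rewrite exprMn /D.
  have F0 : 0 < (m.+1)`!%:R :> R by rewrite ltr0n fact_gt0.
  have -> : (m.+1)`!%:R / c ^+ m.+1 * 2^-1 ^+ j * (c ^+ m.+1 * (r ^+ j) ^+ m.+1 / (m.+1)`!%:R)
     = ((m.+1)`!%:R / (m.+1)`!%:R) * (c ^+ m.+1 / c ^+ m.+1) * (2^-1 ^+ j * (r ^+ j) ^+ m.+1) by ring.
  rewrite !divff ?mul1r ?gt_eqF ?exprn_gt0 //.
  rewrite exprAC -exprMn; apply: lerXn2r; rewrite ?nnegrE ?mulr_ge0 ?exprn_ge0 ?(ltW B0) ?(ltW r0) //.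
  rewrite exprS; have : r ^+ m <= r * r ^+ m by rewrite ler_peMl ?exprn_ge0 ?ltW.
  lra.
have half j : (2^-1 : R) ^+ j <= 1 by rewrite exprn_ile1 ?invr_ge0 // invf_le1 // ler1n.
exists (D * 2); first by rewrite mulr_gt0.
split=> J; last first.
  by apply: le_trans (term J) _; rewrite ler_wpM2l ?(ltW D0) //; have := half J; lra.
apply: (@le_trans _ _ (\sum_(j < J) D * 2^-1 ^+ j)).
  by apply: ler_sum => j _; exact: term.
rewrite -mulr_sumr ler_wpM2l ?(ltW D0) //.
suff -> : \sum_(i < J) (2^-1 : R) ^+ i = 2 - 2 * 2^-1 ^+ J.
  by rewrite gerBl mulr_ge0 // exprn_ge0.
elim: J => [|J IH]; first by rewrite big_ord0 expr0; lra.
by rewrite big_ord_recr /= IH exprS; lra.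
Qed.

Lemma sum_truncated_le (g : nat -> R) N M : (forall i, 0 <= g i) ->
  \sum_(i < M) (if (i < N)%N then g i else 0) <= \sum_(i < N) g i.
Proof.
move=> g0; rewrite -big_mkcond /=.
rewrite -(big_mkord (fun i => (i < N)%N) g) -(big_mkord xpredT g).
have [MN|NM] := leqP M N.
  rewrite [leRHS](big_cat_nat (n := M)) //= -[leLHS]addr0 lerD ?sumr_ge0 //.
  by rewrite big_mkcond; apply: ler_sum => i _; case: ifP.
rewrite (big_cat_nat (n := N) _ (ltnW NM)) //= [X in _ + X]big_nat_cond.
rewrite [X in _ + X]big_pred0 ?addr0 => [|i]; last first.
  by case: (ltnP i N) => [iN|]; rewrite ?andbF // leqNgt iN.
by rewrite big_mkcond; apply: ler_sum => i _; case: ifP.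
Qed.

End RealInequalities.

(** * Dominated variation and the single big jump *)

Section DominatedVariation.
Context {R : realType}.
Variable p : nat -> R.
Hypothesis p0 : forall i, 0 <= p i.
Hypothesis p1 : forall M, \sum_(i < M) p i <= 1.

(** Domination of [p x] by [p n] for all [x] beyond a fraction of [n], polynomial
   in the inverse of this fraction. The real [r] stands for [n / k] or
   [n / 2 ^ j]. *)
Definition dom_var (s : R) := exists C n0, [/\ 0 < C, (0 < n0)%N,
  forall n, (n0 <= n)%N -> 0 < p n
  & forall (n x : nat) (r : R), n0%:R <= r -> r <= n%:R -> r <= x%:R ->
      p x <= C * (n%:R / r) `^ s * p n].

Definition trunc_mean n := \sum_(i < n.+1) i%:R * p i.

(* On the support of [f] the exponent [lam * i] is at most [1], so the
   exponential is linear up to the constant [3]. *)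
Let exp_moment_le (f : nat -> R) (lam : R) n :
  (forall i, 0 <= f i) -> (forall i, f i <= p i) ->
  (forall i, f i != 0 -> (i <= n)%N && (lam * i%:R <= 1)) -> 0 <= lam ->
  forall M, \sum_(i < M) f i * expR (lam * i%:R) <= expR (3 * lam * trunc_mean n).
Proof.
move=> f0 fp fn lam0 M; apply: le_trans (expR_ge1Dx _).
apply: (@le_trans _ _ (\sum_(i < M) p i +
   \sum_(i < M) 3 * lam * (if (i < n.+1)%N then i%:R * p i else 0))); last first.
  rewrite lerD // -mulr_sumr ler_wpM2l ?mulr_ge0 //.
  by apply: (@sum_truncated_le _ (fun i => i%:R * p i)) => i; rewrite mulr_ge0.
rewrite -big_split /=; apply: ler_sum => i _.
have [->|/fn/andP[in_ li]] := eqVneq (f i) 0.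
  by rewrite mul0r addr_ge0 // !mulr_ge0 //; case: ifP => _ //; rewrite mulr_ge0.
have li0 : 0 <= lam * i%:R by rewrite mulr_ge0.
have E : expR (lam * i%:R) <= 1 + 3 * (lam * i%:R).
  by apply: expR_le1D3x; rewrite li0.
rewrite ltnS in_; apply: (@le_trans _ _ (p i * (1 + 3 * (lam * i%:R)))).
  by apply: ler_pM => //; rewrite expR_ge0.
by rewrite le_eqVlt; apply/orP; left; apply/eqP; ring.
Qed.

Lemma dyadic_level (z n0 : R) : 0 < n0 -> n0 <= z ->
  exists J, z < n0 * 2 ^+ J.+1 /\ forall j, (j <= J)%N -> n0 * 2 ^+ j <= z.
Proof.
move=> n00 n0z.
have [m Hm] := @expr_unbounded R 2 (z / n0) ltac:(lra).
have ex : exists j, z < n0 * 2 ^+ j.+1.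
  exists m; rewrite -ltr_pdivrMl // mulrC; apply: le_lt_trans Hm _.
  by rewrite ltr_eXn2l ?ltr1n.
exists (ex_minn ex); case: ex_minnP => J HJ Jmin; split => // j jJ.
case: j jJ => [|j] jJ; first by rewrite expr0 mulr1.
rewrite leNgt; apply/negP => /Jmin; lia.
Qed.

(** When [k] terms have total truncated mean at most [n / 12], a sum equal to [n]
   comes from one jump. The values are peeled off dyadically: if the largest term
   is about [n / 2 ^ j], the others have to make up for the rest, which has
   probability exponentially small in [2 ^ j], while [p (n / 2 ^ j)] exceeds [p n]
   by a factor that is only geometric in [j]. *)
Lemma big_jump s : 0 <= s -> dom_var s ->
  exists2 C : R, 0 < C & \forall n \near \oo, forall k,
    k%:R * 12 * trunc_mean n <= n%:R -> cpow p k n <= C * k%:R * p n.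
Proof.
move=> s0 [C [n0 [C0 n00 ppos pC]]].
pose B : R := 2 `^ s; have B0 : 0 < B by rewrite powR_gt0.
have [D D0 [DS D1]] := @sum_geom_exp_bounded R B (3 / 4) 2 B0 ltac:(lra) ltac:(lra).
pose e : R := expR 1; have e0 : 0 < e by exact: expR_gt0.
pose C1 := C * B * e * D + D * C * B / p n0.
have pn00 : 0 < p n0 by exact: ppos.
have C10 : 0 < C1 by rewrite addr_gt0 ?divr_gt0 ?mulr_gt0.
exists C1 => //.
have L : \forall n \near \oo, (n0 <= n)%N by exact: nbhs_infty_ge.
apply: filterS L => n n0n k km.
have n_gt0 : 0 < n%:R :> R by rewrite ltr0n (leq_trans n00).
have pn : 0 < p n by exact: ppos.
case: (posnP k) => [->|k0].
  by rewrite /= (gtn_eqF (leq_trans n00 n0n)) // mulr0 mul0r.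
have k1 : 1 <= k%:R :> R by rewrite ler1n.
have n0R : 0 < n0%:R :> R by rewrite ltr0n.
have n0nR : n0%:R <= n%:R :> R by rewrite ler_nat.
have [J [nJ Jn]] := dyadic_level n0R n0nR.
pose f j i := if (i * 2 ^ j <= n)%N then p i else 0.
have half_level i j : (i * 2 ^ j.+1 <= n)%N -> (i * 2 ^ j <= n)%N.
  by apply: leq_trans; rewrite expnS leq_mul2l leq_pmull ?orbT.
have f0 j i : 0 <= f j i by rewrite /f; case: ifP.
have ff j i : f j.+1 i <= f j i.
  rewrite /f; case: (leqP (i * 2 ^ j.+1) n) => [/half_level -> //|_].
  by case: ifP.
have fp j i : f j i <= p i by rewrite /f; case: ifP.
(* The largest tilt for which [lam * i <= 1] on the support of [f j]. *)
pose lam j : R := 2 ^+ j / n%:R.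
have lam0 j : 0 <= lam j by rewrite divr_ge0 // exprn_ge0.
have Mom j M : \sum_(i < M) f j i * expR (lam j * i%:R) <= expR (2 ^+ j / (4 * k%:R)).
  apply: le_trans (@exp_moment_le (f j) (lam j) n _ _ _ (lam0 j) M) _ => //.
    move=> i; rewrite /f; case: (leqP (i * 2 ^ j) n); rewrite ?eqxx // => H _.
    apply/andP; split; first by apply: leq_trans H; rewrite leq_pmulr // expn_gt0.
    by rewrite mulrAC ler_pdivrMr // mul1r -natrX -natrM ler_nat mulnC.
  rewrite ler_expR /lam ler_pdivlMr ?mulr_gt0 //; last by lra.
  have -> : 3 * (2 ^+ j / n%:R) * trunc_mean n * (4 * k%:R) =
     2 ^+ j * (k%:R * 12 * trunc_mean n / n%:R) by ring.
  by rewrite ler_piMr ?exprn_ge0 // ler_pdivrMr // mul1r.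
have lev j : (j <= J)%N -> cpow p k n <=
   cpow (f j) k n + \sum_(i < j) k%:R * (C * B ^+ i.+1 * p n) *
       (e * expR (- (3 / 4 * 2 ^+ i))).
  elim: j => [_|j IH jJ].
    rewrite big_ord0 addr0 (@eq_cpow _ p (f 0%N)) // => i in_.
    by rewrite /f expn0 muln1 in_.
  apply: le_trans (IH (ltnW jJ)) _; rewrite big_ord_recr /= addrA [leRHS]addrAC lerD2r.
  pose Phi : R := expR (2 ^+ j / (4 * k%:R)).
  have sp : 0 <= C * B ^+ j.+1 * p n by rewrite !mulr_ge0 ?exprn_ge0 // ltW.
  apply: le_trans (@cpow_peel R (f j) (f j.+1) (C * B ^+ j.+1 * p n)
    (n%:R / 2 ^+ j) (lam j) Phi k n _ _ _ _ _ _ (Mom j)) _ => //.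
  - move=> i; rewrite /f; case: (leqP (i * 2 ^ j) n) => [H1|H1]; last first.
      case: (leqP (i * 2 ^ j.+1) n) => [/half_level|_]; last by rewrite subrr.
      by rewrite leqNgt H1.
    case: (leqP (i * 2 ^ j.+1) n) => H2; first by rewrite subrr.
    rewrite subr0.
    have := pC n i (n%:R / 2 ^+ j.+1).
    rewrite invfM invrK mulrA divff ?gt_eqF // mul1r powR_exprn // -/B.
    apply; rewrite ?ler_pdivlMr ?ler_pdivrMr ?exprn_gt0 ?Jn //.
      by rewrite ler_peMr ?(ltW n_gt0) // exprn_ege1 // ler1n.
    by rewrite -natrX -natrM ler_nat ltnW.
  - move=> i; rewrite ltr_pdivrMr ?exprn_gt0 // -natrX -natrM ltr_nat => H.
    by rewrite /f leqNgt H /=; case: ifP => // /half_level; rewrite leqNgt H.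
  have sp' : 0 <= k%:R * (C * B ^+ j.+1 * p n) by rewrite mulr_ge0.
  rewrite lerD2l -mulrA ler_wpM2l //.
  rewrite /Phi /e -expRM_natr -!expRD ler_expR /lam.
  rewrite mulrBr divfK ?gt_eqF //.
  have -> : 2 ^+ j / n%:R * (n%:R / 2 ^+ j) = 1 :> R.
    by field; rewrite gt_eqF //= gt_eqF ?exprn_gt0.
  have : 2 ^+ j / (4 * k%:R) * k.-1%:R <= 2 ^+ j / 4 :> R.
    rewrite invfM mulrA -[leLHS]mulrA ler_piMr ?divr_ge0 ?exprn_ge0 //.
    by rewrite mulrC ler_pdivrMr ?mul1r ?ler_nat ?leq_pred //; lra.
  lra.
have Jend : cpow (f J) k n <= D * C * B / p n0 * p n.
  have := cpow_chernoff k n (f0 J) (Mom J); rewrite -expRM_natr -expRD.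
  have -> : - (lam J * n%:R) + 2 ^+ J / (4 * k%:R) * k%:R = - (3 / 4 * 2 ^+ J) :> R.
    rewrite /lam divfK ?gt_eqF // invfM mulrA divfK ?gt_eqF //; last by lra.
    lra.
  move=> H; apply: le_trans H _.
  have H1 : p n0 <= C * (B ^+ J.+1) * p n.
    have := pC n n0 n0%:R (lexx _) n0nR (lexx _) => H; apply: le_trans H _.
    rewrite ler_wpM2r ?(ltW pn) // ler_wpM2l ?(ltW C0) // /B -powR_exprn //.
    apply: ler_powR_base => //.
    by rewrite ler_pdivrMr // mulrC ltW.
  have H2 := D1 J; have E0 := expR_ge0 (- (3 / 4 * 2 ^+ J) : R).
  set E := expR _ in H2 E0 *.
  rewrite mulrAC ler_pdivlMr //; apply: le_trans (ler_wpM2l E0 H1) _.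
  have -> : E * (C * B ^+ J.+1 * p n) = (B ^+ J * E) * (C * B * p n).
    by rewrite exprS; ring.
  have -> : D * C * B * p n = D * (C * B * p n) by ring.
  by rewrite ler_wpM2r // !mulr_ge0 // ltW.
apply: le_trans (lev J (leqnn J)) _.
have S : \sum_(i < J) k%:R * (C * B ^+ i.+1 * p n) * (e * expR (- (3 / 4 * 2 ^+ i)))
    <= k%:R * (C * B * e * D) * p n.
  have -> : k%:R * (C * B * e * D) * p n = k%:R * (C * B * e) * p n * D by ring.
  apply: le_trans (ler_wpM2l _ (DS J)); last by rewrite !mulr_ge0 // ltW.
  rewrite mulr_sumr; apply: ler_sum => i _.
  by rewrite exprS le_eqVlt; apply/orP; left; apply/eqP; ring.
apply: le_trans (lerD Jend S) _.
have : D * C * B / p n0 * p n <= k%:R * (D * C * B / p n0 * p n).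
  by rewrite ler_peMl // !mulr_ge0 ?invr_ge0 // ltW.
rewrite /C1; lra.
Qed.

(** One of the [k] terms is at least [n / k], and dominated variation compares its
   weight with [p n]. If [n / k] is below [n0] then the bound exceeds [1]. *)
Lemma cpow_le_max_term s : 0 <= s -> dom_var s ->
  exists2 C : R, 0 < C & \forall n \near \oo, forall k,
    cpow p k n <= C * (k%:R * k%:R `^ s) * p n.
Proof.
move=> s0 [C [n0 [C0 n00 ppos pC]]].
have pn00 : 0 < p n0 by exact: ppos.
exists (C + C / p n0); first by rewrite addr_gt0 // divr_gt0.
have L : \forall n \near \oo, (n0 <= n)%N by exact: nbhs_infty_ge.
apply: filterS L => n n0n k.
have ngt0 : (0 < n)%N by exact: leq_trans n0n.
have n_gt0 : 0 < n%:R :> R by rewrite ltr0n.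
have n0R : 0 < n0%:R :> R by rewrite ltr0n.
have pn : 0 < p n by exact: ppos.
case: (posnP k) => [->|k0]; first by rewrite /= (gtn_eqF ngt0) mul0r mulr0 mul0r.
have kR : 0 < k%:R :> R by rewrite ltr0n.
have ks : 0 < k%:R `^ s :> R by rewrite powR_gt0.
have Cp : 0 < C / p n0 by rewrite divr_gt0.
have -> : (C + C / p n0) * (k%:R * k%:R `^ s) * p n =
  k%:R * ((C + C / p n0) * k%:R `^ s * p n) by ring.
apply: cpow_max_bound => //; last by rewrite !mulr_ge0 // ?ltW // addr_gt0.
move=> i in_ nik.
have [nk|nk] := leqP (k * n0) n.
  have := pC n i (n%:R / k%:R).
  rewrite invfM invrK mulrA divff ?gt_eqF // mul1r => /(_ _ _ _)/le_trans-> //.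
  - by rewrite ler_pdivlMr // mulrC -natrM ler_nat.
  - by rewrite ler_pdivrMr // ler_peMr ?(ltW n_gt0) // ler1n.
  - by rewrite ler_pdivrMr // -natrM ler_nat.
  by rewrite ler_wpM2r ?(ltW pn) // ler_wpM2r ?(ltW ks) // lerDl ltW.
apply: (@le_trans _ _ 1).
  by apply: le_trans (p1 i.+1); rewrite big_ord_recr /= lerDr sumr_ge0.
have H1 : p n0 <= C * k%:R `^ s * p n.
  have := pC n n0 n0%:R (lexx _) _ (lexx _); rewrite ler_nat => /(_ n0n) /le_trans-> //.
  rewrite ler_wpM2r ?(ltW pn) // ler_wpM2l ?(ltW C0) //.
  apply: ler_powR_base => //.
  by rewrite ler_pdivrMr // -natrM ler_nat ltnW.
apply: (@le_trans _ _ (C / p n0 * k%:R `^ s * p n)); last first.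
  by rewrite ler_wpM2r ?(ltW pn) // ler_wpM2r ?(ltW ks) // lerDr ltW.
have -> : C / p n0 * k%:R `^ s * p n = C * k%:R `^ s * p n / p n0 by ring.
by rewrite ler_pdivlMr // mul1r.
Qed.

End DominatedVariation.

(** * Local concentration *)

Section Concentration.
Context {R : realType}.
Variable p : nat -> R.
Hypothesis p0 : forall i, 0 <= p i.
Hypothesis p1 : forall M, \sum_(i < M) p i <= 1.

(** The two exponents differ by twice the Potter exponent; they agree when
   [p n * n `^ a] has a positive limit. *)
Definition power_bounds (a1 a2 : R) := exists c C n0, [/\ 0 < c, 0 < C &
  forall i, (n0 <= i)%N -> c * i%:R `^ (- a2) <= p i <= C * i%:R `^ (- a1)].

(* The values between [y] and [2 * y] carry a mass at least of the order
   [y `^ (1 - a2)]. *)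
Let truncated_mass a2 (c : R) n0 (y : R) : 0 < a2 -> 0 < c -> (1 <= n0)%N ->
  (forall i, (n0 <= i)%N -> c * i%:R `^ (- a2) <= p i) -> n0%:R <= y ->
  forall M, \sum_(i < M) (if i%:R <= y then p i else 0) <=
    expR (- (c * 3 `^ (- a2) * y `^ (- (a2 - 1)))).
Proof.
move=> a20 c0 n01 cp n0y M; apply: le_trans (expR_ge1Dx _).
have y1 : 1 <= y by apply: le_trans n0y; rewrite ler1n.
have y0 : 0 < y by lra.
pose t := Num.truncn y.
have /andP[ty yt] : t%:R <= y < t.+1%:R by apply: truncn_itv; exact: ltW.
have t1 : (1 <= t)%N by rewrite -ltnS -(ltr_nat R); exact: le_lt_trans yt.
have it i : (i%:R <= y) = (i < t.+1)%N.
  have [it|ti] := ltnP i t.+1; first by rewrite (le_trans _ ty) // ler_nat -ltnS.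
  by apply/negbTE; rewrite -ltNge (lt_le_trans yt) // ler_nat.
under eq_bigr do rewrite it.
apply: le_trans (sum_truncated_le _ _ p0) _.
have H1 := p1 (t.+1 + t.+1).
rewrite -(big_mkord xpredT p) (big_cat_nat (n := t.+1)) ?leq_addr //= in H1.
rewrite big_mkord in H1.
have H2 : c * 3 `^ (- a2) * y `^ (- (a2 - 1)) <= \sum_(t.+1 <= i < t.+1 + t.+1) p i.
  apply: (@le_trans _ _ (\sum_(t.+1 <= i < t.+1 + t.+1) c * (3 * y) `^ (- a2))).
    rewrite sumr_const_nat addnK -[leRHS]mulr_natr powRM ?(ltW y0) //.
    have -> : y `^ (- (a2 - 1)) = y `^ (- a2) * y.
      rewrite -{3}(powRr1 (ltW y0)) -powRD ?(gt_eqF y0) ?implybT //.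
      by congr (_ `^ _); ring.
    by rewrite !mulrA ler_wpM2l ?ltW // !mulr_gt0 ?powR_gt0.
  rewrite big_nat_cond [leRHS]big_nat_cond; apply: ler_sum => i /andP[/andP[ti it2] _].
  have iR : 0 < i%:R :> R by rewrite ltr0n; lia.
  apply: le_trans (cp i _); last first.
    rewrite -(ler_nat R); apply: le_trans n0y _; apply: le_trans (ltW yt) _.
    by rewrite ler_nat.
  rewrite ler_wpM2l ?(ltW c0) //; apply: ler_powRN_base => //.
    by rewrite oppr_le0 ltW.
  have : i%:R <= 3 * t%:R :> R by rewrite -natrM ler_nat; lia.
  move: ty; lra.
lra.
Qed.

(** Given the other terms, a sum of [k] terms equals [n] only if its largest term
   takes one prescribed value [i], of weight at most [C * i `^ (- a1)]. The largest
   term is rarely smaller than [z = k `^ (1 / (a2 - 1))]: it is below [z / 2 ^ j]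
   with a probability exponentially small in [2 `^ (j * (a2 - 1))]. *)
Lemma cpow_concentration a1 a2 : 0 < a1 -> 1 < a2 -> power_bounds a1 a2 ->
  exists2 C' : R, 0 < C' & forall k n, (0 < k)%N ->
    cpow p k n <= C' * (k%:R * (k%:R `^ (a2 - 1)^-1) `^ (- a1)).
Proof.
move=> a10 a21 [c [C [n1 [c0 C0 pbd]]]].
(* With [2 <= n0], the case [k = 1] falls into the trivial range [z < n0]. *)
pose n0 := maxn n1 2.
have n02 : (2 <= n0)%N by rewrite leq_maxr.
have pC i : (n0 <= i)%N -> p i <= C * i%:R `^ (- a1).
  by move=> ni; have /andP[] := pbd i (leq_trans (leq_maxl _ _) ni).
have pc i : (n0 <= i)%N -> c * i%:R `^ (- a2) <= p i.
  by move=> ni; have /andP[] := pbd i (leq_trans (leq_maxl _ _) ni).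
have a20 : 0 < a2 by lra.
have al0 : 0 < a2 - 1 by lra.
pose c' := c * 3 `^ (- a2); have c'0 : 0 < c' by rewrite mulr_gt0 // powR_gt0.
pose B : R := 2 `^ a1; have B0 : 0 < B by rewrite powR_gt0.
pose r : R := 2 `^ (a2 - 1).
have r1 : 1 < r.
  by rewrite /r powR_expln // expR_gt1 mulr_gt0 // ln_gt0 // ltr1n.
have r0 : 0 < r by lra.
have [D D0 [DS D1]] := @sum_geom_exp_bounded R B (c' / 2) r B0 ltac:(lra) r1.
have n0R : 0 < n0%:R :> R by rewrite ltr0n; lia.
pose N := n0%:R `^ a1 : R; have N0 : 0 < N by rewrite powR_gt0.
pose C' := N + C + C * B * D + N * B * D.
have C'0 : 0 < C'.
  by rewrite addr_gt0 ?addr_gt0 ?mulr_gt0 //.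
exists C' => // k n k0.
have kR : 0 < k%:R :> R by rewrite ltr0n.
have k1 : 1 <= k%:R :> R by rewrite ler1n.
pose z : R := k%:R `^ (a2 - 1)^-1; rewrite -/z.
have z0 : 0 < z by rewrite powR_gt0.
have zk : z `^ (a2 - 1) = k%:R.
  by rewrite /z -powRrM mulVf ?gt_eqF // powRr1 // ltW.
have za0 : 0 < z `^ (- a1) by rewrite powR_gt0.
have zN y : 0 < y -> z <= y -> 1 <= y `^ a1 * z `^ (- a1).
  move=> y0 zy; rewrite -(powRNV a1 z0) ler_wpM2r ?(ltW za0) //.
  by apply: ler_powR_base => //; exact: ltW.
have [zn0|n0z] := ltP z n0%:R.
  apply: le_trans (cpow_le_mass _ _ p0 p1) _.
  apply: le_trans (zN _ n0R (ltW zn0)) _; rewrite -/N.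
  apply: (@le_trans _ _ (C' * z `^ (- a1))).
    rewrite ler_wpM2r ?(ltW za0) // /C' -!addrA lerDl.
    by rewrite !addr_ge0 ?mulr_ge0 // ltW.
  by rewrite ler_wpM2l ?(ltW C'0) // ler_peMl // ltW.
have k2 : (2 <= k)%N.
  move: k0 n0z; rewrite /z; case: (k) => [//|[_|//]]; rewrite powR1 lern1.
  by rewrite leqNgt n02.
have [J [zJ Jz]] := dyadic_level n0R n0z.
pose f j i : R := if (i <= n)%N && (i%:R * 2 ^+ j <= z) then p i else 0.
have half_level i j : i%:R * 2 ^+ j.+1 <= z -> i%:R * 2 ^+ j <= z.
  apply: le_trans; rewrite ler_wpM2l // exprS ler_peMl ?exprn_ge0 //; lra.
have f0 j i : 0 <= f j i by rewrite /f; case: ifP.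
have ff j i : f j.+1 i <= f j i.
  rewrite /f; case: (leqP i n) => //= _.
  by case: (leP (i%:R * 2 ^+ j.+1) z) => [/half_level -> //|_]; case: ifP.
pose Phi j : R := expR (- (c' * r ^+ j / k%:R)).
have Mass j : (j <= J)%N -> forall M, \sum_(i < M) f j i * expR (0 * i%:R) <= Phi j.
  move=> jJ M.
  have y0 : n0%:R <= z / 2 ^+ j by rewrite ler_pdivlMr ?exprn_gt0 // Jz.
  have := truncated_mass a20 c0 (ltnW n02) pc y0 M; rewrite -/c'.
  have -> : (z / 2 ^+ j) `^ (- (a2 - 1)) = r ^+ j / k%:R.
    rewrite powRM ?(ltW z0) ?invr_ge0 ?exprn_ge0 // !powRN zk mulrC; congr (_ * _).
    by rewrite powR_invr ?exprn_ge0 // invrK powR_exprn.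
  rewrite mulrA; apply: le_trans; apply: ler_sum => i _.
  rewrite mul0r expR0 mulr1 /f ler_pdivlMr ?exprn_gt0 //.
  by case: (leqP i n) => //= _; case: ifP.
have Phik j : Phi j ^+ k.-1 <= expR (- (c' / 2 * r ^+ j)).
  rewrite -expRM_natr ler_expR.
  have P : 0 <= c' * r ^+ j by rewrite mulr_ge0 ?exprn_ge0 // ltW.
  have : 1 / 2 <= k.-1%:R / k%:R :> R.
    rewrite ler_pdivlMr //; have : k%:R = k.-1%:R + 1 :> R by rewrite natr1 prednK.
    have : 1 <= k.-1%:R :> R by rewrite ler1n -ltnS prednK.
    lra.
  have -> : - (c' * r ^+ j / k%:R) * k.-1%:R = - (c' * r ^+ j * (k.-1%:R / k%:R)) by ring.
  nra.
have start : cpow p k n <= cpow (f 0%N) k n + k%:R * (C * z `^ (- a1)).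
  pose g i := if (i <= n)%N then p i else 0.
  have g0 i : 0 <= g i by rewrite /g; case: ifP.
  rewrite (@eq_cpow _ p g) => [|i in_]; last by rewrite /g in_.
  have gM M : \sum_(i < M) g i * expR (0 * i%:R) <= 1.
    apply: le_trans (p1 M); apply: ler_sum => i _.
    by rewrite mul0r expR0 mulr1 /g; case: ifP.
  have s0 : 0 <= C * z `^ (- a1) by rewrite mulr_ge0 // ltW.
  apply: le_trans (@cpow_peel R g (f 0%N) (C * z `^ (- a1)) n%:R 0 1 k n
     (f0 0%N) _ _ _ s0 (lexx 0) gM) _.
  - by move=> i; rewrite /f /g; case: (leqP i n) => //= _; case: ifP.
  - move=> i; rewrite /f /g expr0 mulr1; case: (leqP i n) => //= _; last by rewrite subrr.
    case: (leP i%:R z) => zi; first by rewrite subrr.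
    rewrite subr0; apply: le_trans (pC i _) _.
      by rewrite -(ler_nat R); exact: le_trans n0z (ltW zi).
    rewrite ler_wpM2l ?(ltW C0) //; apply: ler_powRN_base (ltW zi) => //.
    by rewrite oppr_le0 ltW.
  - by move=> i; rewrite ltr_nat /f /g => /ltn_geF ->.
  by rewrite mul0r oppr0 expR0 expr1n !mulr1.
have lev j : (j <= J)%N -> cpow (f 0%N) k n <= cpow (f j) k n +
   \sum_(i < j) k%:R * (C * z `^ (- a1) * B ^+ i.+1) * expR (- (c' / 2 * r ^+ i)).
  elim: j => [_|j IH jJ]; first by rewrite big_ord0 addr0.
  apply: le_trans (IH (ltnW jJ)) _; rewrite big_ord_recr /= addrA [leRHS]addrAC lerD2r.
  have s0 : 0 <= C * z `^ (- a1) * B ^+ j.+1 by rewrite !mulr_ge0 ?exprn_ge0 // ltW.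
  apply: le_trans (@cpow_peel R (f j) (f j.+1) (C * z `^ (- a1) * B ^+ j.+1) n%:R
     0 (Phi j) k n (f0 j.+1) (ff j) _ _ s0 (lexx 0) (Mass j (ltnW jJ))) _.
  - move=> i; rewrite /f; case: (leqP i n) => //= _; last by rewrite subrr.
    case: (leP (i%:R * 2 ^+ j.+1) z) => [/half_level ->|zi]; first by rewrite subrr.
    case: (leP (i%:R * 2 ^+ j) z) => _; last by rewrite subrr.
    have zi' : z / 2 ^+ j.+1 <= i%:R by rewrite ler_pdivrMr ?exprn_gt0 // ltW.
    have z2 : 0 < z / 2 ^+ j.+1 by rewrite divr_gt0 ?exprn_gt0.
    rewrite subr0; apply: le_trans (pC i _) _.
      rewrite -(ler_nat R); apply: le_trans zi'; rewrite ler_pdivlMr ?exprn_gt0 //.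
      exact: Jz.
    rewrite -mulrA ler_wpM2l ?(ltW C0) //.
    apply: le_trans (ler_powRN_base _ z2 zi') _; first by rewrite oppr_le0 ltW.
    rewrite powRM ?(ltW z0) ?invr_ge0 ?exprn_ge0 // ler_wpM2l ?powR_ge0 //.
    by rewrite powR_invr ?exprn_ge0 // -powRN opprK powR_exprn.
  - by move=> i; rewrite ltr_nat /f => /ltn_geF ->.
  rewrite mul0r oppr0 expR0 mulr1 lerD2l; apply: ler_wpM2l (Phik j).
  by rewrite mulr_ge0.
have Jend : cpow (f J) k n <= N * B * D * z `^ (- a1).
  have := cpow_chernoff k n (f0 J) (Mass J (leqnn J)); rewrite mul0r oppr0 expR0 mul1r.
  move/le_trans; apply.
  have PJ : Phi J ^+ k <= expR (- (c' / 2 * r ^+ J)).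
    apply: le_trans (Phik J); rewrite -[in leLHS](prednK k0) exprS.
    rewrite ler_piMl ?exprn_ge0 ?expR_ge0 // expR_le1 oppr_le0.
    by rewrite divr_ge0 ?mulr_ge0 ?exprn_ge0 // ltW.
  apply: le_trans PJ _; have E0 := expR_ge0 (- (c' / 2 * r ^+ J)).
  have nJ0 : 0 < n0%:R * 2 ^+ J.+1 :> R by rewrite mulr_gt0 ?exprn_gt0.
  apply: le_trans (ler_peMr E0 (zN _ nJ0 (ltW zJ))) _.
  rewrite powRM ?exprn_ge0 ?(ltW n0R) // powR_exprn // -/N -/B [leLHS]mulrA ler_wpM2r ?(ltW za0) //.
  have -> : expR (- (c' / 2 * r ^+ J)) * (N * B ^+ J.+1) =
     N * B * (B ^+ J * expR (- (c' / 2 * r ^+ J))) by rewrite exprS; ring.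
  by rewrite ler_wpM2l // mulr_ge0 // ltW.
apply: le_trans start _.
apply: le_trans (lerD (le_trans (lev J (leqnn J)) (lerD Jend (lexx _))) (lexx _)) _.
have S : \sum_(i < J) k%:R * (C * z `^ (- a1) * B ^+ i.+1) * expR (- (c' / 2 * r ^+ i))
   <= k%:R * (C * B * D) * z `^ (- a1).
  have -> : k%:R * (C * B * D) * z `^ (- a1) = k%:R * (C * z `^ (- a1) * B) * D by ring.
  apply: le_trans (ler_wpM2l _ (DS J)); last by rewrite !mulr_ge0 // ltW.
  rewrite mulr_sumr; apply: ler_sum => i _.
  by rewrite exprS le_eqVlt; apply/orP; left; apply/eqP; ring.
have : N * B * D * z `^ (- a1) <= k%:R * (N * B * D * z `^ (- a1)).
  by rewrite ler_peMl // !mulr_ge0 // ltW.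
have : 0 <= k%:R * N * z `^ (- a1) by rewrite !mulr_ge0 // ltW.
rewrite /C'; lra.
Qed.

End Concentration.

(** * Sums of many terms *)

Section Tails.
Context {R : realType}.
Variables p q : nat -> R.
Hypothesis p0 : forall i, 0 <= p i.
Hypothesis p1 : forall M, \sum_(i < M) p i <= 1.
Hypothesis q0 : forall i, 0 <= q i.

Lemma trunc_mean_power_le (a1 a2 : R) : 1 < a1 < 2 -> power_bounds p a1 a2 ->
  exists2 C : R, 0 < C & forall n, (0 < n)%N ->
    trunc_mean p n <= C * n%:R `^ (2 - a1).
Proof.
move=> /andP[a11 a12] [c [C [n1 [c0 C0 pb]]]].
have g0 : 0 < 2 - a1 by lra.
pose D := n1%:R + C * (2 / (2 - a1)).
have Cg0 : 0 < C * (2 / (2 - a1)) by rewrite mulr_gt0 ?divr_gt0.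
have D0 : 0 < D by rewrite ltr_wpDl.
exists D => // n n0.
have ng1 : 1 <= n%:R `^ (2 - a1) :> R.
  by rewrite -[leLHS](powRr0 n%:R) ler_powR ?ler1n // ltW.
apply: (@le_trans _ _ (\sum_(i < n.+1) n1%:R * p i +
   \sum_(1 <= i < n.+1) C * i%:R `^ (2 - a1 - 1))).
  rewrite /trunc_mean big_ord_recl mul0r add0r big_ord_recl.
  rewrite -addrA ler_wpDl ?mulr_ge0 //.
  rewrite big_add1 /= big_mkord -big_split /=; apply: ler_sum => i _.
  rewrite -[bump 0 i]/i.+1; have [ni|ni] := leqP n1 i.+1.
    rewrite ler_wpDl ?mulr_ge0 //.
    have /andP[_ pi] := pb _ ni; apply: le_trans (ler_wpM2l _ pi) _ => //.
    rewrite mulrCA ler_wpM2l ?(ltW C0) // -{1}(@powRr1 _ i.+1%:R) //.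
    by rewrite -powRD ?pnatr_eq0 ?implybT // le_eqVlt; apply/orP; left; apply/eqP; congr (_ `^ _); ring.
  rewrite ler_wpDr ?mulr_ge0 ?powR_ge0 ?(ltW C0) // ler_wpM2r // ler_nat ltnW //.
rewrite -mulr_sumr -mulr_sumr /D mulrDl lerD //.
  apply: (@le_trans _ _ n1%:R); first by rewrite ler_piMr.
  by rewrite ler_peMr.
rewrite -mulrA ler_wpM2l ?(ltW C0) //; apply: sum_powR_le.
by apply/andP; split; lra.
Qed.

(** The truncated mean is at most of the order [n `^ (2 - a1)], so [big_jump]
   covers all [k] up to the order of [n `^ (a1 - 1)]. For larger [k],
   concentration gives
   [k `^ s * k `^ (- b)] with [b = a1 / (a2 - 1) - 1 + s], and the inequality
   assumed between the exponents says that [k `^ (- b)] is then at most of the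
   order [n `^ (- a2)], hence of [p n]. *)
Lemma tail_negligible_concentration (s0 s a1 a2 : R) :
  0 <= s0 -> dom_var p s0 ->
  1 < a1 < 2 -> 1 < a2 -> power_bounds p a1 a2 -> 1 <= s ->
  a2 <= (a1 / (a2 - 1) - 1 + s) * (a1 - 1) ->
  small_tails (fun k => q k * k%:R `^ s) -> tail_negligible p q.
Proof.
move=> s00 pdom a112 a21 pb s1 hs qs.
have [C C0 BJ] := big_jump p0 p1 s00 pdom.
have a10 : 0 < a1 by case/andP: a112 => ? _; lra.
have a11 : 0 < a1 - 1 by case/andP: a112 => ? _; lra.
have [C' C'0 LC] := cpow_concentration p0 p1 a10 a21 pb.
have [C3 C30 MB] := trunc_mean_power_le a112 pb.
have [c [Cu [n1 [c0 _ pc]]]] := pb.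
pose b := a1 / (a2 - 1) - 1 + s.
have b0 : 0 < b.
  rewrite ltNge; apply/negP => b0; have : b * (a1 - 1) <= 0 by rewrite mulr_le0_ge0 // ltW.
  by move: hs; rewrite -/b; lra.
pose A := 12 * C3; have A0 : 0 < A by rewrite mulr_gt0.
pose D := C + C' * A `^ b / c.
have Ab0 : 0 < C' * A `^ b / c by rewrite divr_gt0 ?mulr_gt0 ?powR_gt0.
apply: (@tail_negligible_dom _ p p0 q q0 (fun k => D * k%:R `^ s)); last first.
  apply: small_tails_le (small_tailsZ (c := D) _ qs).
  - by exists 0%N => // i _; rewrite mulrCA.
  - by move=> i; rewrite !mulr_ge0 ?powR_ge0 // ltW // addr_gt0.
  - by rewrite ltW // addr_gt0.
have L : \forall n \near \oo, (maxn n1 1 <= n)%N by exact: nbhs_infty_ge.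
apply: filterS2 BJ L => n HBJ; rewrite geq_max => /andP[n1n n0] k.
case: (posnP k) => [->|k0].
  by rewrite /= (gtn_eqF n0) // !mulr_ge0 ?powR_ge0 // ltW // addr_gt0.
have kR : 0 < k%:R :> R by rewrite ltr0n.
have k1 : 1 <= k%:R :> R by rewrite ler1n.
have nR : 0 < n%:R :> R by rewrite ltr0n.
have ks0 : 0 < k%:R `^ s :> R by rewrite powR_gt0.
have [km|km] := leP (k%:R * 12 * trunc_mean p n) n%:R.
  apply: le_trans (HBJ k km) _; rewrite ler_wpM2r //.
  apply: (@le_trans _ _ (C * k%:R `^ s)).
    by rewrite ler_wpM2l ?(ltW C0) // le1r_powR.
  by rewrite ler_wpM2r ?(ltW ks0) // lerDl ltW.
apply: le_trans (LC k n k0) _.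
have nk : n%:R `^ (a1 - 1) <= A * k%:R.
  rewrite -(ler_pM2r (powR_gt0 (2 - a1) nR)) -powRD ?(gt_eqF nR) ?implybT //.
  rewrite (_ : a1 - 1 + (2 - a1) = 1); last by ring.
  rewrite powRr1 ?(ltW nR) //; apply: le_trans (ltW km) _.
  apply: le_trans (ler_wpM2l _ (MB n n0)) _; first by rewrite mulr_ge0 // ltW.
  by rewrite /A le_eqVlt; apply/orP; left; apply/eqP; ring.
have H1 : k%:R * (k%:R `^ (a2 - 1)^-1) `^ (- a1) = k%:R `^ s * k%:R `^ (- b) :> R.
  rewrite -powRrM -{1}(powRr1 (ltW kR)) -!powRD ?(gt_eqF kR) ?implybT //.
  by congr (_ `^ _); rewrite /b; ring.
have H2 : k%:R `^ (- b) <= A `^ b * n%:R `^ (- a2).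
  have H3 : (A * k%:R) `^ (- b) <= n%:R `^ (- a2).
    apply: le_trans (ler_powRN_base _ _ nk) _; rewrite ?powR_gt0 ?oppr_le0 ?(ltW b0) //.
    rewrite -powRrM ler_powR ?ler1n // mulrN lerN2 mulrC //.
  move: H3; rewrite powRM ?(ltW A0) ?(ltW kR) // => H3.
  by apply: le_trans (ler_wpM2l (powR_ge0 A b) H3); rewrite mulrA powRNV // mul1r.
have /andP[pn _] := pc n n1n.
rewrite H1; apply: (@le_trans _ _ (C' * A `^ b / c * k%:R `^ s * p n)); last first.
  by rewrite ler_wpM2r // ler_wpM2r ?(ltW ks0) // lerDr ltW.
have -> : C' * A `^ b / c * k%:R `^ s * p n = C' * (k%:R `^ s * (A `^ b * (p n / c))).
  by ring.
rewrite ler_wpM2l ?(ltW C'0) // ler_wpM2l ?(ltW ks0) //; apply: le_trans H2 _.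
by rewrite ler_wpM2l ?powR_ge0 // ler_pdivlMr // mulrC.
Qed.

Lemma trunc_mean_log_le (a2 : R) : power_bounds p 2 a2 ->
  exists2 C : R, 0 < C & forall n, (0 < n)%N ->
    trunc_mean p n <= C * (1 + ln n%:R).
Proof.
move=> [c [C [n1 [c0 C0 pb]]]].
exists (n1%:R + C); first by rewrite ltr_wpDl.
move=> n n0; have ln0 : 0 <= ln n%:R :> R by rewrite ln_ge0 // ler1n.
apply: (@le_trans _ _ (\sum_(i < n.+1) n1%:R * p i +
   \sum_(1 <= i < n.+1) C * i%:R^-1)).
  rewrite /trunc_mean big_ord_recl mul0r add0r big_ord_recl.
  rewrite -addrA ler_wpDl ?mulr_ge0 //.
  rewrite big_add1 /= big_mkord -big_split /=; apply: ler_sum => i _.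
  rewrite -[bump 0 i]/i.+1; have [ni|ni] := leqP n1 i.+1.
    rewrite ler_wpDl ?mulr_ge0 //.
    have /andP[_ pi] := pb _ ni; apply: le_trans (ler_wpM2l _ pi) _ => //.
    rewrite mulrCA ler_wpM2l ?(ltW C0) // powR_invn //.
    by rewrite expr2 invfM mulrA divff ?pnatr_eq0 // mul1r.
  by rewrite ler_wpDr ?mulr_ge0 ?invr_ge0 ?(ltW C0) // ler_wpM2r // ler_nat ltnW.
rewrite -mulr_sumr -mulr_sumr mulrDl lerD //.
  apply: (@le_trans _ _ n1%:R); first by rewrite ler_piMr.
  by rewrite ler_peMr // lerDl.
by rewrite ler_wpM2l ?(ltW C0) //; apply: sum_inv_le.
Qed.

(** Because [y <= (1 + y / 4) ^ 2 <= expR (y / 4) ^ 2]. *)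
Lemma ln_le_half (y : R) : 0 < y -> ln y <= y / 2.
Proof.
move=> y0; rewrite -ler_expR lnK ?posrE //.
have H := expR_ge1Dx (y / 4).
have -> : expR (y / 2) = expR (y / 4) ^+ 2 by rewrite -expRM_natr; congr expR; lra.
have : (1 + y / 4) ^+ 2 <= expR (y / 4) ^+ 2.
  by rewrite ler_sqr ?nnegrE ?expR_ge0 //; lra.
by have := sqr_ge0 (y / 4 - 1); lra.
Qed.

(** The logarithms are comparable because [ln (1 + ln y)] is at most half of
   [1 + ln y]. *)
Lemma log_inverse (A x y : R) : 1 <= A -> 1 <= x -> 1 <= y ->
  y <= A * (x * (1 + ln y)) -> 1 + ln y <= (2 + 2 * ln A) * (1 + ln x).
Proof.
move=> A1 x1 y1 H.
have lA := ln_ge0 A1; have lx := ln_ge0 x1; have ly := ln_ge0 y1.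
have l0 : 0 < 1 + ln y by lra.
have : ln y <= ln (A * (x * (1 + ln y))).
  by rewrite ler_ln ?posrE ?mulr_gt0 //; lra.
rewrite lnM ?posrE ?mulr_gt0 //; try lra.
rewrite lnM ?posrE //; try lra.
have := ln_le_half l0; nra.
Qed.

(** The boundary case of [tail_negligible_concentration]: the truncated mean grows
   at most like [ln n], so [big_jump] covers all [k] up to the order of
   [n / ln n], and beyond it concentration gives [1 / k], which exceeds [k / n ^ 2] by at most
   two factors of the order [ln k]. *)
Lemma tail_negligible_log (s0 : R) :
  0 <= s0 -> dom_var p s0 -> power_bounds p 2 2 ->
  small_tails (fun k => q k * (k%:R * (1 + ln k%:R) ^+ 2)) -> tail_negligible p q.
Proof.
move=> s00 pdom pb qs.
have [C C0 BJ] := big_jump p0 p1 s00 pdom.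
have [C' C'0 LC] := @cpow_concentration _ _ p0 p1 2 2 ltac:(lra) ltac:(lra) pb.
have [C3 C30 MB] := trunc_mean_log_le pb.
have [c [Cu [n1 [c0 _ pc]]]] := pb.
pose A := 12 * C3 + 1; have A1 : 1 <= A by rewrite /A; lra.
have A0 : 0 < A by lra.
have lA := ln_ge0 A1.
pose E := A * (2 + 2 * ln A); have E0 : 0 < E by rewrite mulr_gt0 //; lra.
pose D := C + C' * E ^+ 2 / c.
have CE0 : 0 < C' * E ^+ 2 / c by rewrite divr_gt0 // mulr_gt0 // exprn_gt0.
have D0 : 0 < D by rewrite addr_gt0.
have lk k : 0 <= (1 + ln k%:R : R) ^+ 2 by exact: sqr_ge0.
apply: (@tail_negligible_dom _ p p0 q q0 (fun k => D * (k%:R * (1 + ln k%:R) ^+ 2))); last first.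
  apply: small_tails_le (small_tailsZ (ltW D0) qs).
  - by exists 0%N => // i _; rewrite mulrCA.
  - by move=> i; apply: mulr_ge0; [exact: ltW|rewrite mulr_ge0 // mulr_ge0].
have L : \forall n \near \oo, (maxn n1 1 <= n)%N by exact: nbhs_infty_ge.
apply: filterS2 BJ L => n HBJ; rewrite geq_max => /andP[n1n n0] k.
case: (posnP k) => [->|k0].
  by rewrite /= (gtn_eqF n0) mul0r mulr0 mul0r.
have kR : 0 < k%:R :> R by rewrite ltr0n.
have k1 : 1 <= k%:R :> R by rewrite ler1n.
have nR : 0 < n%:R :> R by rewrite ltr0n.
have nR1 : 1 <= n%:R :> R by rewrite ler1n.
have lk0 := ln_ge0 k1; have ln0 := ln_ge0 nR1.
have lk1 : 1 <= (1 + ln k%:R : R) ^+ 2 by rewrite exprn_ege1 // lerDl.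
have [km|km] := leP (k%:R * 12 * trunc_mean p n) n%:R.
  apply: le_trans (HBJ k km) _; rewrite ler_wpM2r //.
  apply: ler_pM; rewrite ?(ltW C0) //; first by rewrite lerDl ltW.
  by rewrite ler_peMr // ltW.
apply: le_trans (LC k n k0) _.
have nk : n%:R <= A * (k%:R * (1 + ln n%:R)).
  apply: le_trans (ltW km) _.
  apply: le_trans (ler_wpM2l _ (MB n n0)) _; first by rewrite mulr_ge0 // ltW.
  have : 0 <= k%:R * (1 + ln n%:R) :> R by rewrite mulr_ge0 ?(ltW kR) // addr_ge0.
  rewrite /A; lra.
have lnk := log_inverse A1 k1 nR1 nk.
have nE : n%:R <= E * (k%:R * (1 + ln k%:R)).
  apply: le_trans nk _; rewrite /E -mulrA ler_wpM2l ?(ltW A0) //.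
  by rewrite mulrCA ler_wpM2l // ltW.
have H1 : k%:R * (k%:R `^ (2 - 1)^-1) `^ (- 2) = k%:R^-1 :> R.
  rewrite (_ : 2 - 1 = 1); last by ring.
  rewrite invr1 powRr1 ?(ltW kR) // powR_invn ?(ltW kR) // expr2 invfM mulrA.
  by rewrite divff ?gt_eqF // mul1r.
have /andP[pn _] := pc n n1n; rewrite powR_invn ?(ltW nR) // in pn.
rewrite H1.
apply: (@le_trans _ _ (C' * E ^+ 2 / c * (k%:R * (1 + ln k%:R) ^+ 2) * p n)); last first.
  have kl0 : 0 <= k%:R * (1 + ln k%:R) ^+ 2 :> R by exact: mulr_ge0.
  by rewrite ler_wpM2r // ler_wpM2r // lerDr ltW.
have H3 : n%:R ^+ 2 <= (E * (k%:R * (1 + ln k%:R))) ^+ 2.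
  by rewrite ler_sqr ?nnegrE ?(ltW nR) // (le_trans _ nE) // ltW.
have H4 : (k%:R : R)^-1 <= E ^+ 2 * (k%:R * (1 + ln k%:R) ^+ 2) * n%:R ^- 2.
  rewrite ler_pdivlMr ?exprn_gt0 // ler_pdivrMl //; apply: le_trans H3 _.
  by rewrite le_eqVlt; apply/orP; left; apply/eqP; ring.
have -> : C' * E ^+ 2 / c * (k%:R * (1 + ln k%:R) ^+ 2) * p n
   = C' * (E ^+ 2 * (k%:R * (1 + ln k%:R) ^+ 2) * (p n / c)) by ring.
rewrite ler_wpM2l ?(ltW C'0) //; apply: le_trans H4 _.
apply: ler_wpM2l; first by apply: mulr_ge0; [exact: sqr_ge0|exact: mulr_ge0].
by rewrite ler_pdivlMr // mulrC.
Qed.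

(** With a bounded truncated mean, [big_jump] covers all [k] up to [n / A]. For
   larger [k], the weight [q k] is small compared with [p k], hence with [p n],
   and [renewal_bound] sums the remaining factors [cpow p k n] over [k]. *)
Lemma tail_negligible_renewal (s mu : R) :
  0 <= s -> dom_var p s -> (forall n, trunc_mean p n <= mu) ->
  (forall e : R, 0 < e -> \forall k \near \oo, q k <= e * p k) ->
  small_tails (fun k => q k * k%:R) -> tail_negligible p q.
Proof.
move=> s0 pdom mb qp qs e e0.
have [C C0 BJ] := big_jump p0 p1 s0 pdom.
have [C' [n0 [C'0 n00 ppos pC]]] := pdom.
have p01 : p 0%N < 1.
  have := p1 n0.+1; have := ppos n0 (leqnn _).
  rewrite -(big_mkord xpredT p) big_nat_recr //= big_ltn //.
  have : 0 <= \sum_(1 <= i < n0) p i by apply: sumr_ge0.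
  lra.
pose A := 12 * (`|mu| + 1); have A1 : 1 <= A by rewrite /A; have := normr_ge0 mu; lra.
have A0 : 0 < A by lra.
have As : 0 < A `^ s by rewrite powR_gt0.
have u0 : 0 < (1 - p 0%N)^-1 by rewrite invr_gt0 subr_gt0.
pose F := C' * A `^ s * (1 - p 0%N)^-1.
have F0 : 0 < F by rewrite !mulr_gt0.
have e10 : 0 < e / 2 / C by rewrite !divr_gt0.
have e20 : 0 < e / 2 / F by rewrite divr_gt0 // divr_gt0.
have [K HK] := qs _ e10; exists K.
have [k1 _ Hk1] := qp _ e20.
have [m mA] : exists m : nat, A <= m%:R.
  by exists (Num.truncn A).+1; apply/ltW/truncnS_gt.
have L : \forall n \near \oo, (m * (n0 + k1) <= n)%N by exact: nbhs_infty_ge.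
apply: filterS2 BJ L => n HBJ Ln M.
have mgt0 : (0 < m)%N by rewrite -(ltr_nat R); lra.
have Ln' : A * (n0 + k1)%:R <= n%:R.
  apply: (@le_trans _ _ (m%:R * (n0 + k1)%:R)); first by rewrite ler_wpM2r.
  by rewrite -natrM ler_nat.
have nn0 : (n0 + k1 <= n)%N by apply: leq_trans Ln; rewrite leq_pmull.
have nR : 0 < n%:R :> R by rewrite ltr0n (leq_trans n00) // (leq_trans _ nn0) // leq_addr.
have pn0 : 0 < p n by apply: ppos; apply: leq_trans nn0; rewrite leq_addr.
have term k : q k * cpow p k n <= C * p n * (q k * k%:R) +
    e / 2 / F * (C' * A `^ s * p n) * cpow p k n.
  have c0 : 0 <= cpow p k n by exact: cpow_ge0.
  have W0 : 0 <= e / 2 / F * (C' * A `^ s * p n).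
    by apply: mulr_ge0; [exact: ltW|rewrite !mulr_ge0 // ltW].
  have [kn|kn] := leP (k%:R * A) n%:R.
    rewrite ler_wpDr //; first exact: mulr_ge0.
    have km : k%:R * 12 * trunc_mean p n <= n%:R.
      apply: le_trans kn; rewrite -mulrA ler_wpM2l // ler_wpM2l //.
      by rewrite (le_trans (mb n)) // (le_trans (ler_norm mu)) // lerDl.
    apply: le_trans (ler_wpM2l (q0 k) (HBJ k km)) _.
    by rewrite le_eqVlt; apply/orP; left; apply/eqP; ring.
  rewrite ler_wpDl ?mulr_ge0 ?(ltW C0) // ler_wpM2r //.
  have nAk : n%:R / A <= k%:R by rewrite ler_pdivrMr // ltW.
  have kk1 : (k1 <= k)%N.
    rewrite -(ler_nat R); apply: le_trans nAk; rewrite ler_pdivlMr //.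
    by apply: le_trans Ln'; rewrite mulrC ler_wpM2l ?(ltW A0) // ler_nat leq_addl.
  apply: le_trans (Hk1 k kk1) _; rewrite ler_wpM2l ?(ltW e20) //.
  have := pC n k (n%:R / A).
  rewrite (_ : n%:R / (n%:R / A) = A); last by field; rewrite !gt_eqF.
  apply => //.
    rewrite ler_pdivlMr //.
    by apply: le_trans Ln'; rewrite mulrC ler_wpM2l ?(ltW A0) // ler_nat leq_addr.
  by rewrite ler_pdivrMr // ler_peMr // ltW.
apply: le_trans (ler_sum _ (fun k _ => term k)) _.
rewrite big_split /= -!mulr_sumr.
have H1 : C * p n * \sum_(K <= k < M) q k * k%:R <= e / 2 * p n.
  apply: le_trans (ler_wpM2l _ (HK M)) _; first by rewrite mulr_ge0 // ltW.
  have -> : C * p n * (e / 2 / C) = e / 2 * p n * (C / C) by ring.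
  by rewrite divff ?mulr1 // gt_eqF.
have H2 : \sum_(K <= k < M) cpow p k n <= (1 - p 0%N)^-1.
  apply: le_trans (renewal_bound M n p0 p1 p01).
  rewrite -(big_mkord xpredT (fun k => cpow p k n)).
  have [KM|MK] := leqP K M; last first.
    by rewrite [leLHS]big_geq ?(ltnW MK) // sumr_ge0 // => k _; exact: cpow_ge0.
  by rewrite [leRHS](big_cat_nat (n := K)) //= lerDr sumr_ge0 // => k _; exact: cpow_ge0.
have H3 : e / 2 / F * (C' * A `^ s * p n) * \sum_(K <= k < M) cpow p k n <= e / 2 * p n.
  apply: le_trans (ler_wpM2l _ H2) _.
    by rewrite !mulr_ge0 // ?(ltW C'0) // ?(ltW As) // ?invr_ge0 ltW.
  have -> : e / 2 / F * (C' * A `^ s * p n) * (1 - p 0%N)^-1 = e / 2 * p n * (F / F).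
    by rewrite /F; ring.
  by rewrite divff ?mulr1 // gt_eqF.
lra.
Qed.

End Tails.

(** * Uniform convergence in slow variation *)

Section UniformConvergence.
Context {R : realType}.

Lemma lebesgue_measure_shift (t : R) (A : set (measurableTypeR R)) : measurable A ->
  lebesgue_measure ((fun x : R => x + t) @^-1` A) = lebesgue_measure A.
Proof.
move=> mA; have ms : measurable_fun [set: measurableTypeR R]
    ((fun x => x + t) : measurableTypeR R -> measurableTypeR R).
  by apply: measurable_funD => //; exact: measurable_cst.
pose m := measure_function_pushforward__canonical__measure_function_Measure
  (@lebesgue_measure R) ms.
symmetry; apply: (@lebesgue_measure_unique R m) => // _ [[a b] _ <-] /=.
rewrite /m /= /pushforward.
have -> : (fun x : R => x + t) @^-1` [set` `]a, b]] = [set` `]a - t, b - t]].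
  by apply/seteqP; split => x /=; rewrite !in_itv /= ltrBlDr lerBrDr.
rewrite !lebesgue_measure_itv /= !lte_fin ltrD2r.
by case: ifP => // _; rewrite -!EFinB; congr EFin; ring.
Qed.

Let mu := @lebesgue_measure R.

Let good_set (h : R -> R) (x : R ^nat) (e : R) n : set R :=
  `[0, 2]%classic `&` \bigcap_(m in [set m | (n <= m)%N]) [set l | `|h (x m + l) - h (x m)| <= e].

Let good_set_measurable (h : R -> R) (x : R ^nat) (e : R) n : measurable_fun [set: R] h ->
  measurable (good_set h x e n).
Proof.
move=> mh; apply: measurableI => //; apply: bigcap_measurable => //.
  by exists n => /=.
move=> m _.
have mf : measurable_fun [set: R] (fun l => `|h (x m + l) - h (x m)|).
  apply: measurableT_comp => //; apply: measurable_funB; last exact: measurable_cst.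
  by apply: measurableT_comp => //; apply: measurable_funD => //; exact: measurable_cst.
have := mf measurableT _ (@measurable_itv R `]-oo, e]).
by rewrite setTI; congr measurable; apply/seteqP; split => l /=; rewrite in_itv.
Qed.

(* The good sets increase to the interval [0, 2], by slow variation, and measures
   are continuous along increasing sequences. *)
Let good_set_large (h : R -> R) (x : R ^nat) (e : R) : measurable_fun [set: R] h ->
  (forall t, h (y + t) - h y @[y --> +oo] --> 0) ->
  (forall m, m%:R <= x m) -> 0 < e ->
  exists n0, forall n, (n0 <= n)%N -> ((3 / 2)%:E < mu (good_set h x e n))%E.
Proof.
move=> mh hh xm e0.
have nd : {homo good_set h x e : n m / (n <= m)%N >-> (n <= m)%O}.
  move=> n m nm; apply/subsetPset => l [l02 Hl]; split => // i /= mi.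
  by apply: Hl => /=; exact: leq_trans mi.
have UE : \bigcup_n good_set h x e n = `[0, 2]%classic.
  apply/seteqP; split => [l [n _ []] //|l l02].
  have := hh l => /cvgrPdist_le /(_ e e0) [M [Mr HM]].
  exists (Num.truncn M).+1 => //; split => // m /= nm.
  have := HM (x m); rewrite sub0r normrN; apply.
  apply: lt_le_trans (xm m); apply: lt_le_trans (truncnS_gt M) _.
  by rewrite ler_nat.
have := @nondecreasing_cvg_mu _ _ _ mu (good_set h x e)
  (fun n => good_set_measurable x e n mh) _ nd.
rewrite UE => /(_ (measurable_itv _)).
have m2 : lebesgue_measure (`[0, 2]%classic : set R) = 2%:E.
  by rewrite lebesgue_measure_itv /= lte_fin ltr0n /= sube0.
rewrite [X in _ --> X -> _]m2 => H.
have : \forall n \near \oo, ((3 / 2)%:E < (mu \o good_set h x e) n)%E.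
  apply: (H [set z | ((3 / 2)%:E < z)%E]); apply: open_nbhs_nbhs; split; first exact: open_ereal_gt_ereal.
  by rewrite /= lte_fin; lra.
by case=> n0 _ Hn0; exists n0 => n /Hn0.
Qed.

(** Karamata's uniform convergence theorem in additive form. If there were bad
   pairs [(x_n, t_n)] for all [n], then for large [n] the shifts [l] in [0, 2] that
   move [h] little from [x_n] would have measure above [3 / 2], and likewise from
   [x_n + t_n]. Translated by [t_n], the latter set lies with the former in
   [0, 3], so the two meet, which puts [h (x_n)] and [h (x_n + t_n)] close to one
   common value. *)
Lemma slow_variation_uniform (h : R -> R) : measurable_fun [set: R] h ->
  (forall t, h (y + t) - h y @[y --> +oo] --> 0) ->
  forall e, 0 < e -> exists X, forall x t, X <= x -> 0 <= t <= 1 ->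
    `|h (x + t) - h x| <= e.
Proof.
move=> mh hh e e0; apply: contrapT => bad.
have {}bad (n : nat) : exists xt : R * R,
    [/\ n%:R <= xt.1, 0 <= xt.2 <= 1 & e < `|h (xt.1 + xt.2) - h xt.1|].
  apply: contrapT => nx; apply: bad; exists n%:R => x t nx' t01.
  by rewrite leNgt; apply/negP => lt; apply: nx; exists (x, t).
have /choice[xt Hxt] := bad.
pose x n := (xt n).1; pose t n := (xt n).2; pose y n := x n + t n.
have xn n : n%:R <= x n by have [] := Hxt n.
have t01 n : 0 <= t n <= 1 by have [] := Hxt n.
have yn n : n%:R <= y n.
  by have /andP[t0 _] := t01 n; rewrite (le_trans (xn n)) // lerDl.
have e20 : 0 < e / 2 by rewrite divr_gt0.
have [n1 Hn1] := good_set_large mh hh xn e20.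
have [n2 Hn2] := good_set_large mh hh yn e20.
pose n := maxn n1 n2.
have V := Hn1 n (leq_maxl _ _); have W := Hn2 n (leq_maxr _ _).
have mV := @good_set_measurable h x (e / 2) n mh.
have mW := @good_set_measurable h y (e / 2) n mh.
pose W' := (fun l : R => l + - t n) @^-1` good_set h y (e / 2) n.
have W'E : mu W' = mu (good_set h y (e / 2) n) by exact: lebesgue_measure_shift.
have mW' : measurable W'.
  have mf : measurable_fun [set: R] (fun l : R => l + - t n).
    by apply: measurable_funD => //; exact: measurable_cst.
  by rewrite -[W']setTI; exact: mf.
have VW0 : good_set h x (e / 2) n `&` W' = set0.
  apply/seteqP; split => [l|//] [[_ Vl] [_ Wl]].
  have H1 := Vl n (leqnn n); have H2 := Wl n (leqnn n).
  have [_ _] := Hxt n; rewrite -/(x n) -/(t n) -/(y n); apply/negP; rewrite -leNgt.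
  move: H1 H2; rewrite /= (_ : y n + (l - t n) = x n + l); last by rewrite /y; ring.
  rewrite -/(y n).
  have -> : h (y n) - h (x n) = (h (x n + l) - h (x n)) - (h (x n + l) - h (y n)) by ring.
  move=> H1 H2; apply: le_trans (ler_normB _ _) _; lra.
have sub : good_set h x (e / 2) n `|` W' `<=` `[0, 3]%classic.
  move=> l [[]|[]] /=; rewrite !in_itv /= => /andP[l0 l2] _; apply/andP; split; try lra.
    by have /andP[] := t01 n; lra.
  by have /andP[] := t01 n; lra.
have : (mu (good_set h x (e / 2) n `|` W') <= mu `[0%R, 3%R]%classic)%E.
  by apply: le_measure; rewrite ?inE //; exact: measurableU.
have m3 : lebesgue_measure (`[0, 3]%classic : set R) = 3%:E.
  by rewrite lebesgue_measure_itv /= lte_fin ltr0n /= sube0.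
have mU : (mu (good_set h x (e / 2) n `|` W') =
    mu (good_set h x (e / 2) n) + mu W')%E.
  exact: (@measureU _ _ _ (@lebesgue_measure R) _ _ mV mW' VW0).
rewrite mU W'E [X in (_ <= X)%E]m3.
apply/negP; rewrite -ltNge.
have -> : 3%:E = ((3 / 2)%:E + (3 / 2)%:E)%E :> \bar R by rewrite -EFinD; congr EFin; lra.
exact: lteD V W.
Qed.

End UniformConvergence.

(** * Regularly varying sequences *)

Section RegularVariation.
Context {R : realType}.

Lemma abs_ln_le (r d : R) : 0 < d -> d <= 1 / 2 -> `|1 - r| <= d -> `|ln r| <= 2 * d.
Proof.
move=> d0 d1; rewrite ler_distl => /andP[r1 r2].
have r0 : 0 < r by lra.
have H1 : ln r <= r - 1 by rewrite -{1}(subrK 1 r) addrC; apply: le_ln1Dx; lra.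
have ri0 : 0 < r^-1 by rewrite invr_gt0.
have H2 : ln r^-1 <= r^-1 - 1 by rewrite -{1}(subrK 1 r^-1) addrC; apply: le_ln1Dx; lra.
rewrite lnV ?posrE // in H2.
have rr : r * r^-1 = 1 by rewrite divff // gt_eqF.
have H3 : r^-1 - 1 <= 2 * d.
  have : r^-1 <= 2 by nra.
  nra.
rewrite ler_norml; apply/andP; split; lra.
Qed.

Section Karamata.
Variable L : R -> R.
Hypothesis Lsv : slowly_varying L.

(* In this additive form, slow variation reads [h (y + t) - h y --> 0]. *)
Let h (x : R) := ln (L (expR x)).

Let L_gt0 x : 0 < x -> 0 < L x. Proof. by case: Lsv => H _ _; exact: H. Qed.

Let h_measurable : measurable_fun [set: R] h.
Proof.
case: Lsv => _ mL _; apply: measurableT_comp; first exact: measurable_ln.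
apply: (measurable_comp (F := [set x : R | 0 < x])) => //.
- have := @measurable_itv R `]0, +oo[.
  by congr measurable; apply/seteqP; split => x /=; rewrite in_itv /= andbT.
- by move=> _ [x _ <-] /=; exact: expR_gt0.
Qed.

Let h_slow t : h (y + t) - h y @[y --> +oo] --> 0.
Proof.
case: Lsv => _ _ sv; apply/cvgrPdist_le => e e0.
pose d := Num.min (e / 2) (1 / 2).
have d0 : 0 < d by rewrite lt_min !divr_gt0.
have d1 : d <= 1 / 2 by rewrite ge_min lexx orbT.
have d2 : d <= e / 2 by rewrite ge_min lexx.
have /cvgrPdist_le /(_ d d0) [M [Mr HM]] := sv (expR t) (expR_gt0 t).
exists M; split => // x Mx; rewrite sub0r normrN /h.
have x0 := expR_gt0 x; have t0 := expR_gt0 t.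
rewrite -ln_div ?posrE ?L_gt0 ?expR_gt0 // (addrC x t) expRD.
apply: le_trans (abs_ln_le d0 d1 (HM (expR x) _)) _; last by lra.
by apply: lt_trans Mx _; apply: lt_le_trans (expR_ge1Dx x); rewrite ltrDr.
Qed.

(* Chaining the uniform estimate over unit intervals. *)
Let h_potter (e : R) : 0 < e -> exists X, forall x u, X <= x -> 0 <= u ->
  `|h (x + u) - h x| <= e * (u + 1).
Proof.
move=> e0; have [X HX] := slow_variation_uniform h_measurable h_slow e0.
exists X => x u Xx u0.
have [k uk] : exists k : nat, u <= k%:R by exists (Num.truncn u).+1; apply/ltW/truncnS_gt.
elim: k x u Xx u0 uk => [|k IH] x u Xx u0 uk.
  have -> : u = 0 by apply/eqP; rewrite eq_le u0 uk.
  by rewrite addr0 subrr normr0 add0r mulr1 ltW.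
have [u1|u1] := leP u 1.
  apply: le_trans (HX x u Xx _) _; first by rewrite u0.
  by rewrite ler_peMr ?(ltW e0) // lerDr.
have H1 : `|h (x + 1) - h x| <= e by apply: HX => //; rewrite ler01 lexx.
have H2 : `|h (x + 1 + (u - 1)) - h (x + 1)| <= e * (u - 1 + 1).
  by apply: IH; rewrite -natr1 in uk; lra.
rewrite (_ : x + 1 + (u - 1) = x + u) in H2; last by ring.
have -> : h (x + u) - h x = (h (x + u) - h (x + 1)) + (h (x + 1) - h x) by ring.
by apply: le_trans (ler_normD _ _) _; lra.
Qed.

Lemma potter_bound (e : R) : 0 < e -> exists n0, (0 < n0)%N /\
  forall m n, (n0 <= m <= n)%N ->
    L m%:R <= expR e * (n%:R / m%:R) `^ e * L n%:R /\
    L n%:R <= expR e * (n%:R / m%:R) `^ e * L m%:R.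
Proof.
move=> e0; have [X HX] := h_potter e0.
exists (Num.truncn (expR X)).+1; split=> // m n /andP[m0 mn].
have mR : 0 < m%:R :> R by rewrite ltr0n (leq_trans _ m0).
have nR : 0 < n%:R :> R by rewrite (lt_le_trans mR) // ler_nat.
have mnR : m%:R <= n%:R :> R by rewrite ler_nat.
have Xm : X <= ln m%:R.
  rewrite -ler_expR lnK ?posrE //; apply: le_trans (ltW (truncnS_gt _)) _.
  by rewrite ler_nat.
have u0 : 0 <= ln n%:R - ln m%:R :> R by rewrite subr_ge0 ler_ln.
have := HX _ _ Xm u0; rewrite (addrC (ln m%:R)) subrK /h !lnK ?posrE //.
have nm : 0 < n%:R / m%:R :> R by rewrite divr_gt0.
have -> : expR e * (n%:R / m%:R) `^ e = expR (e * (ln n%:R - ln m%:R + 1)).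
  by rewrite powR_expln // -expRD ln_div ?posrE //; congr expR; ring.
have Lm := L_gt0 mR; have Ln := L_gt0 nR.
rewrite ler_norml => /andP[H1 H2].
have eLm : L m%:R = expR (ln (L m%:R)) by rewrite lnK.
have eLn : L n%:R = expR (ln (L n%:R)) by rewrite lnK.
rewrite eLm eLn -!expRD !ler_expR; split; lra.
Qed.

Lemma slowly_varying_step (e : R) : 0 < e ->
  \forall n \near \oo, (1 - e) * L n.+1%:R <= L n%:R <= (1 + e) * L n.+1%:R.
Proof.
move=> e0; pose d := Num.min (e / 3) 1.
have d0 : 0 < d by rewrite lt_min ltr01 divr_gt0.
have d1 : d <= 1 by rewrite ge_min lexx orbT.
have d3 : d <= e / 3 by rewrite ge_min lexx.
have [X HX] := slow_variation_uniform h_measurable h_slow d0.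
exists (Num.truncn (expR X)).+1 => // n /= n0.
have nR : 0 < n%:R :> R by rewrite ltr0n (leq_trans _ n0).
have nR1 : 1 <= n%:R :> R by rewrite ler1n (leq_trans _ n0).
have n1R : 0 < n.+1%:R :> R by rewrite ltr0n.
have Xn : X <= ln n%:R.
  rewrite -ler_expR lnK ?posrE //; apply: le_trans (ltW (truncnS_gt _)) _.
  by rewrite ler_nat.
have u : 0 <= (ln n.+1%:R - ln n%:R : R) <= 1.
  apply/andP; split; first by rewrite subr_ge0 ler_ln // ler_nat.
  rewrite -ln_div ?posrE // -natr1 mulrDl divff ?gt_eqF // div1r.
  apply: le_trans (le_ln1Dx _) _; last by rewrite invf_le1.
  by rewrite (lt_trans (ltrN10 _)) // invr_gt0.
have := HX _ _ Xn u; rewrite (addrC (ln n%:R)) subrK /h !lnK ?posrE // ler_norml => /andP[H1 H2].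
have Ln := L_gt0 nR; have Ln1 := L_gt0 n1R.
have eL : L n%:R = expR (ln (L n%:R)) by rewrite lnK.
have eL1 : L n.+1%:R = expR (ln (L n.+1%:R)) by rewrite lnK.
have E1 : L n%:R <= expR d * L n.+1%:R.
  by rewrite eL eL1 -expRD ler_expR; lra.
have E2 : expR (- d) * L n.+1%:R <= L n%:R.
  by rewrite eL eL1 -expRD ler_expR; lra.
apply/andP; split.
  apply: le_trans E2; rewrite ler_wpM2r ?(ltW Ln1) //.
  by apply: le_trans (expR_ge1Dx _); lra.
apply: le_trans E1 _; rewrite ler_wpM2r ?(ltW Ln1) //.
apply: le_trans (@expR_le1D3x _ d _) _; last by lra.
by rewrite d1 ltW.
Qed.

End Karamata.

(** Potter's bounds with exponent [eta]. A slowly varying function satisfies them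
   for every [eta > 0], a sequence with a positive limit also for [eta = 0]. *)
Definition slow_seq (l : nat -> R) (eta : R) := exists C n0, [/\ 0 < C, (0 < n0)%N,
  forall n, (n0 <= n)%N -> 0 < l n &
  forall m n, (n0 <= m <= n)%N ->
    l m <= C * (n%:R / m%:R) `^ eta * l n /\ l n <= C * (n%:R / m%:R) `^ eta * l m].

Definition slow_step (l : nat -> R) := forall e : R, 0 < e ->
  \forall n \near \oo, (1 - e) * l n.+1 <= l n <= (1 + e) * l n.+1.

Lemma slow_seq_slowly_varying (L : R -> R) (l : nat -> R) (c eta : R) :
  slowly_varying L -> 0 < c -> (forall n, (0 < n)%N -> l n = c * L n%:R) ->
  0 < eta -> slow_seq l eta.
Proof.
move=> Lsv c0 lE eta0; have [n0 [n00 H]] := potter_bound Lsv eta0.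
exists (expR eta), n0; split => // [|n nn0|m n /andP[n0m mn]]; first exact: expR_gt0.
  have n0' : (0 < n)%N by exact: leq_trans nn0.
  by rewrite lE // mulr_gt0 //; case: Lsv => + _ _; apply; rewrite ltr0n.
have m0 : (0 < m)%N by exact: leq_trans n0m.
have [H1 H2] := H m n ltac:(by rewrite n0m).
rewrite !lE // ?(leq_trans m0) // ![_ * (c * _)]mulrCA.
by split; rewrite ler_wpM2l // ltW.
Qed.

Lemma slow_step_slowly_varying (L : R -> R) (l : nat -> R) (c : R) :
  slowly_varying L -> 0 < c -> (forall n, (0 < n)%N -> l n = c * L n%:R) ->
  slow_step l.
Proof.
move=> Lsv c0 lE e e0.
have P : \forall n \near \oo, (1 <= n)%N by exact: nbhs_infty_ge.
apply: filterS2 (slowly_varying_step Lsv e0) P => n /andP[H1 H2] n0.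
rewrite !lE // ![_ * (c * _)]mulrCA; apply/andP.
by split; rewrite ler_wpM2l // ltW.
Qed.

Lemma slow_seq_cvg (l : nat -> R) (c : R) : 0 < c -> l n @[n --> \oo] --> c ->
  slow_seq l 0.
Proof.
move=> c0 lc; have c20 : 0 < c / 2 by rewrite divr_gt0.
have /cvgrPdist_le /(_ _ c20) [n0 _ H] := lc.
have B n : (n0.+1 <= n)%N -> c / 2 <= l n <= 3 / 2 * c.
  move=> nn0; have := H n (ltnW nn0); rewrite /= distrC ler_distl.
  by move=> /andP[H1 H2]; apply/andP; split; lra.
exists 3, n0.+1; split => // [n /B /andP[H1 _]|m n /andP[n0m mn]]; first by lra.
have /andP[? ?] := B m n0m; have /andP[? ?] := B n (leq_trans n0m mn).
by rewrite powRr0; split; lra.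
Qed.

Lemma slow_step_cvg (l : nat -> R) (c : R) : 0 < c -> l n @[n --> \oo] --> c ->
  slow_step l.
Proof.
move=> c0 lc e e0; pose d := Num.min (e / 4) (1 / 2).
have d0 : 0 < d by rewrite lt_min !divr_gt0.
have d1 : d <= 1 / 2 by rewrite ge_min lexx orbT.
have d4 : d <= e / 4 by rewrite ge_min lexx.
have cd0 : 0 < c * d by rewrite mulr_gt0.
have /cvgrPdist_le /(_ _ cd0) [n0 _ H] := lc.
exists n0 => // n /= nn0.
have := H n nn0; have := H n.+1 (leqW nn0); rewrite /= ![`|c - _|]distrC !ler_distl.
move=> /andP[H1 H2] /andP[H3 H4].
have P : c / 2 <= l n.+1 by nra.
have Q : c * d <= e / 4 * c by nra.
have P' : e * (c / 2) <= e * l n.+1 by rewrite ler_wpM2l // ltW.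
apply/andP; split; lra.
Qed.

Section RegularlyVarying.
Variable p : nat -> R.
Hypothesis p0 : forall i, 0 <= p i.
Variable a : R.
Hypothesis a0 : 0 < a.

Let l n := p n * n%:R `^ a.

Let pE n : (0 < n)%N -> p n = l n * n%:R `^ (- a).
Proof. by move=> n0; rewrite -mulrA powRNV ?mulr1 // ltr0n. Qed.

Lemma long_tailed_regular eta : slow_seq l eta -> slow_step l -> long_tailed p.
Proof.
move=> [C [n0 [_ n00 l0 _]]] st; split.
  exists n0 => // n /= nn0; have n0' := leq_trans n00 nn0.
  by rewrite pE // mulr_gt0 ?l0 // powR_gt0 // ltr0n.
move=> e e0; pose d := Num.min (e / 3) 1.
have d0 : 0 < d by rewrite lt_min ltr01 divr_gt0.
have d1 : d <= 1 by rewrite ge_min lexx orbT.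
have d3 : d <= e / 3 by rewrite ge_min lexx.
have [m mA] : exists m : nat, 3 * a / d <= m%:R.
  by exists (Num.truncn (3 * a / d)).+1; apply/ltW/truncnS_gt.
have P : \forall n \near \oo, (n0 + m <= n)%N by exact: nbhs_infty_ge.
apply: filterS2 (st d d0) P => n /andP[H1 H2] nm.
have n0' : (0 < n)%N by apply: leq_trans n00 (leq_trans (leq_addr _ _) nm).
have nR : 0 < n%:R :> R by rewrite ltr0n.
have n1R : 0 < n.+1%:R :> R by rewrite ltr0n.
have ln1 : 0 < l n.+1.
  by apply: l0; apply: leq_trans (leqW nm); exact: leq_addr.
rewrite !pE //.
pose r := (n.+1%:R / n%:R : R) `^ a.
have E : n%:R `^ (- a) = r * n.+1%:R `^ (- a) :> R.
  rewrite /r powRM ?invr_ge0 ?(ltW nR) ?(ltW n1R) // powR_invr ?(ltW nR) // -powRN.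
  by rewrite mulrAC powRNV // mul1r.
have rge1 : 1 <= r.
  have {1}<- : (1 : R) `^ a = 1 by rewrite powR1.
  apply: ler_powR_base; rewrite ?(ltW a0) //.
  by rewrite ler_pdivlMr // mul1r ler_nat.
have rle : r <= 1 + d.
  have an : 3 * a / n%:R <= d.
    rewrite ler_pdivrMr // (mulrC d) -ler_pdivrMr //; apply: le_trans mA _.
    by rewrite ler_nat (leq_trans _ nm) // leq_addl.
  have an0 : 0 < a / n%:R by rewrite divr_gt0.
  rewrite /r powR_expln ?divr_gt0 //; apply: (@le_trans _ _ (expR (a / n%:R))).
    rewrite ler_expR ler_wpM2l ?(ltW a0) // -natr1 mulrDl divff ?gt_eqF // div1r.
    by apply: le_ln1Dx; rewrite (lt_trans (ltrN10 _)) // invr_gt0.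
  by apply: le_trans (expR_le1D3x _) _; [apply/andP; split|]; lra.
have ln0 : 0 < l n by apply: l0; apply: leq_trans nm; exact: leq_addr.
have q0 : 0 < n.+1%:R `^ (- a) :> R by rewrite powR_gt0.
have X1 : l n <= l n * r by rewrite ler_peMr // ltW.
have X2 : l n * r <= l n * (1 + d) by rewrite ler_wpM2l // ltW.
have X3 : (1 + d) * (1 + d) * l n.+1 <= (1 + e) * l n.+1.
  by rewrite ler_wpM2r ?(ltW ln1) //; nra.
have X4 : l n * (1 + d) <= (1 + d) * l n.+1 * (1 + d).
  by rewrite ler_wpM2r //; lra.
have X5 : (1 - e) * l n.+1 <= (1 - d) * l n.+1.
  by rewrite ler_wpM2r ?(ltW ln1) //; lra.
rewrite E (mulrA (l n)) !(mulrA _ (l n.+1)).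
apply/andP; split; rewrite ler_wpM2r ?(ltW q0) //.
  exact: le_trans X5 (le_trans H1 X1).
by apply: le_trans X2 (le_trans X4 _); rewrite mulrAC.
Qed.

Lemma dom_var_regular eta : 0 <= eta <= a -> slow_seq l eta -> dom_var p (a + eta).
Proof.
move=> /andP[eta0 etaa] [C [n0 [C0 n00 l0 lC]]].
exists C, n0; split => // [n nn0|n x r n0r rn rx].
  have n0' := leq_trans n00 nn0.
  by rewrite pE // mulr_gt0 ?l0 // powR_gt0 // ltr0n.
have n0R : 0 < n0%:R :> R by rewrite ltr0n.
have r0 : 0 < r by lra.
have nR : 0 < n%:R :> R by lra.
have xR : 0 < x%:R :> R by lra.
have n0n : (n0 <= n)%N by rewrite -(ler_nat R); lra.
have n0x : (n0 <= x)%N by rewrite -(ler_nat R); lra.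
have ng0 : (0 < n)%N by exact: leq_trans n0n.
have xg0 : (0 < x)%N by exact: leq_trans n0x.
have ln0 := l0 n n0n.
have na : 0 < n%:R `^ (- a) :> R by rewrite powR_gt0.
have X : x%:R `^ (- a) = (n%:R / x%:R) `^ a * n%:R `^ (- a) :> R.
  rewrite powRM ?invr_ge0 ?(ltW nR) ?(ltW xR) // powR_invr ?(ltW xR) // -powRN.
  by rewrite mulrAC powRNV // mul1r.
have [xn|nx] := leqP x n.
  have [H _] := lC x n ltac:(by rewrite n0x).
  rewrite [p x]pE // [p n]pE // X.
  have nx0 : 0 < n%:R / x%:R :> R by rewrite divr_gt0.
  apply: (@le_trans _ _ (C * (n%:R / x%:R) `^ (a + eta) * (l n * n%:R `^ (- a)))).
    apply: le_trans (ler_wpM2r _ H) _; first by rewrite mulr_ge0 ?powR_ge0.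
    rewrite powRD ?(gt_eqF nx0) ?implybT // le_eqVlt; apply/orP; left; apply/eqP; ring.
  rewrite ler_wpM2r ?mulr_ge0 ?(ltW ln0) ?(ltW na) // ler_wpM2l ?(ltW C0) //.
  apply: ler_powR_base; rewrite ?addr_ge0 ?(ltW a0) ?(ltW nx0) //.
  by rewrite ler_wpM2l ?(ltW nR) // lef_pV2 ?posrE.
have [_ H] := lC n x ltac:(by rewrite n0n ltnW).
rewrite [p x]pE // [p n]pE // X.
have xn0 : 0 < x%:R / n%:R :> R by rewrite divr_gt0.
have xn1 : 1 <= x%:R / n%:R :> R by rewrite ler_pdivlMr // mul1r ler_nat ltnW.
apply: (@le_trans _ _ (C * 1 * (l n * n%:R `^ (- a)))).
  apply: le_trans (ler_wpM2r _ H) _; first by rewrite mulr_ge0 ?powR_ge0.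
  have -> : C * (x%:R / n%:R) `^ eta * l n * ((n%:R / x%:R) `^ a * n%:R `^ (- a)) =
    C * ((x%:R / n%:R) `^ eta * (n%:R / x%:R) `^ a) * (l n * n%:R `^ (- a)) by ring.
  rewrite ler_wpM2r ?mulr_ge0 ?(ltW ln0) ?(ltW na) // ler_wpM2l ?(ltW C0) //.
  rewrite -[n%:R / x%:R]invf_div powR_invr ?(ltW xn0) // -powRN.
  rewrite -powRD ?(gt_eqF xn0) ?implybT // -[leRHS](powRr0 (x%:R / n%:R)) ler_powR //.
  lra.
rewrite ler_wpM2r ?mulr_ge0 ?(ltW ln0) ?(ltW na) // ler_wpM2l ?(ltW C0) //.
have {1}<- : (1 : R) `^ (a + eta) = 1 by rewrite powR1.
apply: ler_powR_base => //.
  by rewrite addr_ge0 // ltW.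
by rewrite ler_pdivlMr // mul1r.
Qed.

Lemma power_bounds_regular eta : slow_seq l eta -> power_bounds p (a - eta) (a + eta).
Proof.
move=> [C [n0 [C0 n00 l0 lC]]].
have n0R : 0 < n0%:R :> R by rewrite ltr0n.
have L0 := l0 n0 (leqnn _).
have ne0 : 0 < n0%:R `^ eta :> R by rewrite powR_gt0.
exists (l n0 / C * n0%:R `^ eta), (C * l n0 / n0%:R `^ eta), n0; split.
- by rewrite mulr_gt0 // divr_gt0.
- by rewrite divr_gt0 // mulr_gt0.
move=> i n0i; have [H1 H2] := lC n0 i ltac:(by rewrite leqnn).
have i0 := leq_trans n00 n0i; have iR : 0 < i%:R :> R by rewrite ltr0n.
have ie0 : 0 < i%:R `^ eta :> R by rewrite powR_gt0.
have ia0 : 0 < i%:R `^ (- a) :> R by rewrite powR_gt0.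
have E : (i%:R / n0%:R) `^ eta = i%:R `^ eta / n0%:R `^ eta :> R.
  by rewrite powRM ?invr_ge0 ?(ltW iR) ?(ltW n0R) // powR_invr // ltW.
rewrite E in H1 H2; rewrite pE //; apply/andP; split.
  have -> : - (a + eta) = - a + - eta by ring.
  rewrite powRD ?(gt_eqF iR) ?implybT // mulrCA mulrC ler_wpM2r ?(ltW ia0) //.
  rewrite [X in _ * X]powRN ler_pdivrMr // mulrAC ler_pdivrMr //.
  rewrite -ler_pdivlMr //; apply: le_trans H1 _.
  by rewrite le_eqVlt; apply/orP; left; apply/eqP; ring.
have -> : - (a - eta) = - a + eta by ring.
rewrite powRD ?(gt_eqF iR) ?implybT // [leRHS]mulrCA [leRHS]mulrC.
rewrite ler_wpM2r ?(ltW ia0) //; apply: le_trans H2 _.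
by rewrite le_eqVlt; apply/orP; left; apply/eqP; ring.
Qed.

End RegularlyVarying.

Lemma dom_var_half (p : nat -> R) s : dom_var p s ->
  exists2 C : R, 0 < C &
  \forall n \near \oo, forall x, (x <= n)%N -> (n <= x * 2)%N -> p x <= C * p n.
Proof.
move=> [C [n0 [C0 n00 l0 lC]]].
exists (C * 2 `^ s); first by rewrite mulr_gt0 // powR_gt0.
have P : \forall n \near \oo, (n0 * 2 <= n)%N by exact: nbhs_infty_ge.
apply: filterS P => n nn0 x xn nx.
have nR : 0 < n%:R :> R by rewrite ltr0n (leq_trans _ nn0) // muln_gt0 n00.
have := lC n x (n%:R / 2); rewrite (_ : n%:R / (n%:R / 2) = 2); last first.
  by field; rewrite !gt_eqF.
apply.
- by rewrite ler_pdivlMr // -natrM ler_nat.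
- by rewrite ler_pdivrMr // ler_peMr ?(ltW nR) // ler1n.
- by rewrite ler_pdivrMr // -natrM ler_nat.
Qed.

End RegularVariation.

(** * Coefficients of generating functions *)

Section NonnegativeSeries.
Context {R : realType}.
Implicit Types u : nat -> R.

Lemma partial_sum_le_nneseries u M : (forall i, 0 <= u i) ->
  ((\sum_(i < M) u i)%:E <= \sum_(0 <= i <oo) (u i)%:E)%E.
Proof.
move=> u0; rewrite -sumEFin -(big_mkord xpredT (fun i => (u i)%:E)).
by apply: nneseries_lim_ge => n _ _; rewrite lee_fin.
Qed.

Lemma nneseries_le_bound u B : (forall i, 0 <= u i) ->
  (forall M, \sum_(i < M) u i <= B) -> (\sum_(0 <= i <oo) (u i)%:E <= B%:E)%E.
Proof.
move=> u0 uB; apply: lime_le.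
  by apply: is_cvg_nneseries => n _ _; rewrite lee_fin.
by apply: nearW => n; rewrite big_mkord sumEFin lee_fin.
Qed.

Lemma nneseries_partial_sums u (S : R) : (forall i, 0 <= u i) ->
  (\sum_(0 <= i <oo) (u i)%:E = S%:E)%E ->
  (forall M, \sum_(i < M) u i <= S) /\
  (forall e, 0 < e -> exists A, S - e <= \sum_(i < A) u i).
Proof.
move=> u0 uS; split => [M|e e0].
  by have := partial_sum_le_nneseries M u0; rewrite uS lee_fin.
apply: contrapT => H.
have : (\sum_(0 <= i <oo) (u i)%:E <= (S - e)%:E)%E.
  apply: nneseries_le_bound => // M; rewrite leNgt; apply/negP => lt.
  by apply: H; exists M; exact: ltW.
by rewrite uS lee_fin; lra.
Qed.

(** [G] is the generating function of [u] on the unit interval, with the error of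
   its Taylor polynomials controlled near [0]; this is enough to recover [u], by
   [taylor_enclosed_unique]. *)
Definition taylor_enclosed (u : nat -> R) (G : R -> R) := exists C : R,
  forall z, 0 <= z <= 1 -> forall M,
    \sum_(k < M) u k * z ^+ k <= G z <= \sum_(k < M) u k * z ^+ k + C * z ^+ M.

Lemma taylor_enclosed_unique u u' G : taylor_enclosed u G -> taylor_enclosed u' G ->
  forall k, u k = u' k.
Proof.
move=> [C HC] [C' HC'] k; elim/ltn_ind: k => k IH.
pose D := `|C| + `|C'| + `|u k - u' k|; have D0 : 0 <= D by rewrite !addr_ge0.
have H z : 0 < z <= 1 -> `|u k - u' k| <= (`|C| + `|C'|) * z.
  move=> /andP[z0 z1]; have z01 : 0 <= z <= 1 by rewrite ltW.
  have /andP[H1 H2] := HC z z01 k.+1; have /andP[H3 H4] := HC' z z01 k.+1.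
  rewrite !big_ord_recr /= in H1 H2 H3 H4.
  have E : \sum_(i < k) u i * z ^+ i = \sum_(i < k) u' i * z ^+ i.
    by apply: eq_bigr => i _; rewrite IH.
  rewrite E in H1 H2.
  have zk : 0 < z ^+ k by rewrite exprn_gt0.
  rewrite -(ler_pM2r zk) -[z ^+ k in leLHS](gtr0_norm zk) -normrM ler_norml.
  have CC : C * z ^+ k.+1 <= `|C| * z * z ^+ k.
    by rewrite exprS mulrA !ler_wpM2r ?(ltW zk) ?(ltW z0) // ler_norm.
  have CC' : C' * z ^+ k.+1 <= `|C'| * z * z ^+ k.
    by rewrite exprS mulrA !ler_wpM2r ?(ltW zk) ?(ltW z0) // ler_norm.
  have P1 : 0 <= `|C| * z * z ^+ k by rewrite !mulr_ge0 // ltW.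
  have P2 : 0 <= `|C'| * z * z ^+ k by rewrite !mulr_ge0 // ltW.
  by apply/andP; split; lra.
apply/eqP; rewrite -subr_eq0 -normr_le0 leNgt; apply/negP => d0.
pose z := Num.min 1 (`|u k - u' k| / (2 * (`|C| + `|C'| + 1))).
have q0 : 0 < 2 * (`|C| + `|C'| + 1) by rewrite mulr_gt0 // ltr_wpDl ?addr_ge0.
have z0 : 0 < z by rewrite lt_min ltr01 divr_gt0.
have z1 : z <= 1 by rewrite ge_min lexx.
have zd : z <= `|u k - u' k| / (2 * (`|C| + `|C'| + 1)) by rewrite ge_min lexx orbT.
have := H z; rewrite z0 z1 => /(_ isT).
move: zd; rewrite ler_pdivlMr // => zd.
have := normr_ge0 C; have := normr_ge0 C'; nra.
Qed.

Lemma pser_taylor_enclosed (f : nat -> R) (x : R) (S : R) : (forall i, 0 <= f i) ->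
  0 <= x -> pser f x = S%:E ->
  taylor_enclosed (fun k => f k * x ^+ k) (fun z => fine (pser f (x * z))).
Proof.
move=> f0 x0 fS; have u0 i : 0 <= f i * x ^+ i by rewrite mulr_ge0 // exprn_ge0.
have [HS _] := nneseries_partial_sums u0 fS.
exists S => z /andP[z0 z1] M.
have v0 i : 0 <= f i * (x * z) ^+ i by rewrite mulr_ge0 // exprn_ge0 // mulr_ge0.
have vE i : f i * (x * z) ^+ i = f i * x ^+ i * z ^+ i by rewrite exprMn mulrA.
have up : (pser f (x * z) <= (\sum_(k < M) f k * x ^+ k * z ^+ k + S * z ^+ M)%:E)%E.
  apply: nneseries_le_bound => // M'.
  apply: (@le_trans _ _ (\sum_(i < maxn M M') f i * (x * z) ^+ i)).
    rewrite -!(big_mkord xpredT (fun i => f i * (x * z) ^+ i)).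
    by rewrite [leRHS](big_cat_nat (n := M')) ?leq_maxr //= lerDl sumr_ge0.
  rewrite -(big_mkord xpredT (fun i => f i * (x * z) ^+ i)).
  rewrite (big_cat_nat (n := M)) ?leq_maxl //= big_mkord.
  rewrite (eq_bigr _ (fun (i : 'I_M) _ => vE i)).
  rewrite lerD2l; apply: (@le_trans _ _ (\sum_(M <= i < maxn M M') f i * x ^+ i * z ^+ M)).
    rewrite big_nat_cond [leRHS]big_nat_cond; apply: ler_sum => i /andP[/andP[Mi _] _].
    by rewrite vE ler_wpM2l // ler_wiXn2l.
  rewrite -mulr_suml ler_wpM2r ?exprn_ge0 //; apply: le_trans (HS (maxn M M')).
  rewrite -(big_mkord xpredT (fun i => f i * x ^+ i)).
  by rewrite [leRHS](big_cat_nat (n := M)) ?leq_maxl //= lerDr sumr_ge0.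
have lo := partial_sum_le_nneseries M v0.
have fin : pser f (x * z) \is a fin_num.
  rewrite ge0_fin_numE; first by apply: le_lt_trans up _; exact: ltry.
  by apply: le_trans lo; rewrite lee_fin sumr_ge0.
rewrite -!lee_fin fineK // up andbT; apply: le_trans lo.
by rewrite lee_fin; under eq_bigr do rewrite -vE.
Qed.

Lemma taylor_enclosedZ u G (c : R) : 0 <= c -> taylor_enclosed u G ->
  taylor_enclosed (fun k => c * u k) (fun z => c * G z).
Proof.
move=> c0 [C H]; exists (c * C) => z z01 M; have /andP[H1 H2] := H z z01 M.
have -> : \sum_(k < M) c * u k * z ^+ k = c * \sum_(k < M) u k * z ^+ k.
  by rewrite mulr_sumr; apply: eq_bigr => i _; rewrite mulrA.
by rewrite -mulrA -mulrDr !ler_wpM2l.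
Qed.

Lemma taylor_enclosed_shift u G : taylor_enclosed u G ->
  taylor_enclosed (fun k => if k is k'.+1 then u k' else 0) (fun z => z * G z).
Proof.
move=> [C H]; exists (`|C| + `|G 0| + `|u 0%N|) => z /[dup] z01 /andP[z0 z1] [|M].
  rewrite big_ord0 add0r expr0 mulr1.
  have /andP[H1 H2] := H z z01 0%N; rewrite big_ord0 add0r expr0 mulr1 in H1 H2.
  rewrite mulr_ge0 //=; apply: (@le_trans _ _ (1 * G z)); first by rewrite ler_wpM2r.
  have := ler_norm C; have := normr_ge0 (G 0); have := normr_ge0 (u 0%N); lra.
have /andP[H1 H2] := H z z01 M.
rewrite big_ord_recl mul0r add0r.
have -> : \sum_(i < M) u i * z ^+ (bump 0 i) = z * \sum_(k < M) u k * z ^+ k.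
  by rewrite mulr_sumr; apply: eq_bigr => i _; rewrite /bump /= exprS mulrCA.
rewrite ler_wpM2l //=; apply: le_trans (ler_wpM2l z0 H2) _.
rewrite mulrDr lerD2l mulrCA exprS ler_wpM2r ?mulr_ge0 ?exprn_ge0 //.
have := ler_norm C; have := normr_ge0 (G 0); have := normr_ge0 (u 0%N); lra.
Qed.

End NonnegativeSeries.

(** * Laws on the natural numbers *)

Section DiscreteLaws.
Context {R : realType} {d : measure_display} {T : measurableType d}.
Variable P : probability T R.
Implicit Types Y : {RV P >-> nat}.

Lemma measurable_preimage_nat Y (B : set nat) : measurable (Y @^-1` B).
Proof. exact: measurable_funPTI. Qed.

Definition nat_pmf Y k : R := fine (P (Y @^-1` [set k])).

Lemma nat_pmfE Y k : P (Y @^-1` [set k]) = (nat_pmf Y k)%:E.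
Proof.
by rewrite /nat_pmf fineK // fin_num_measure //; exact: measurable_preimage_nat.
Qed.

Lemma nat_pmf_ge0 Y k : 0 <= nat_pmf Y k.
Proof. by rewrite -lee_fin -nat_pmfE. Qed.

(* Truncating [g \o Y] at [Y < M] makes it a simple function, whose integral is a
   finite sum. *)
Let simple_part (g : nat -> R) M Y t : R :=
  \sum_(k < M) g k * \1_(Y @^-1` [set (k : nat)]) t.

Let simple_partE g M Y t :
  simple_part g M Y t = if (Y t < M)%N then g (Y t) else 0.
Proof.
rewrite /simple_part; have [YM|MY] := ltnP (Y t) M.
  rewrite (bigD1 (Ordinal YM)) //= indicE mem_set //= mulr1 big1 ?addr0 //.
  move=> i iY; rewrite indicE memNset ?mulr0 //= => Yi.
  by move/eqP: iY; apply; apply/val_inj; rewrite /= Yi.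
rewrite big1 // => i _; rewrite indicE memNset ?mulr0 //= => Yi.
by move: MY; rewrite Yi leqNgt ltn_ord.
Qed.

Let integral_simple_part (g : nat -> R) M Y : (forall k, 0 <= g k) ->
  (\int[P]_t (simple_part g M Y t)%:E = (\sum_(k < M) g k * nat_pmf Y k)%:E)%E.
Proof.
move=> g0; rewrite /simple_part.
under eq_integral do rewrite -sumEFin.
rewrite ge0_integral_sum //=.
- rewrite -sumEFin; apply: eq_bigr => k _.
  under eq_integral do rewrite EFinM.
  rewrite ge0_integralZl //=.
  + by rewrite integral_indic ?setIT //= ?nat_pmfE ?EFinM //; exact: measurable_preimage_nat.
  + by apply/measurable_EFinP/measurable_indic; exact: measurable_preimage_nat.
  + by rewrite lee_fin.
- move=> k; apply/measurable_EFinP/measurable_funM; first exact: measurable_cst.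
  by apply: measurable_indic; exact: measurable_preimage_nat.
- by move=> k t _; rewrite lee_fin mulr_ge0.
Qed.

Let measurable_nat_comp (g : nat -> R) Y : measurable_fun [set: T] (fun t => (g (Y t))%:E).
Proof.
move=> _ B mB; rewrite setTI.
by have := measurable_preimage_nat Y [set k | B (g k)%:E].
Qed.

Lemma partial_sum_le_expectation (g : nat -> R) M Y : (forall k, 0 <= g k) ->
  ((\sum_(k < M) g k * nat_pmf Y k)%:E <= 'E_P[fun t => g (Y t)])%E.
Proof.
move=> g0; rewrite expectation.unlock -integral_simple_part //; apply: ge0_le_integral => //=.
- by move=> t _; rewrite lee_fin simple_partE; case: ifP.
- apply/measurable_EFinP => _ B mB; rewrite setTI.
  have := measurable_preimage_nat Y [set k | B (if (k < M)%N then g k else 0)].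
  by congr measurable; apply/seteqP; split => t /=; rewrite simple_partE.
- by move=> t _; rewrite lee_fin simple_partE; case: ifP.
Qed.

Lemma small_tails_expectation (g : nat -> R) Y : (forall k, 0 <= g k) ->
  ('E_P[fun t => g (Y t)] < +oo)%E -> small_tails (fun k => g k * nat_pmf Y k).
Proof.
move=> g0 E; have [D HD] : exists D : R, forall M, \sum_(k < M) g k * nat_pmf Y k <= D.
  exists (fine 'E_P[fun t => g (Y t)]) => M.
  have H := partial_sum_le_expectation M Y g0.
  rewrite -lee_fin fineK //; rewrite ge0_fin_numE //.
  by apply: le_trans H; rewrite lee_fin sumr_ge0 // => i _; rewrite mulr_ge0 ?nat_pmf_ge0.
by apply: small_tails_bounded HD => k; rewrite mulr_ge0 ?nat_pmf_ge0.
Qed.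

Lemma pgf_taylor_enclosed Y (G : R -> R) : has_pgf P Y G ->
  taylor_enclosed (nat_pmf Y) G.
Proof.
move=> H; exists 1 => z /[dup] z01 /andP[z0 z1] M.
have zk k : 0 <= z ^+ k by rewrite exprn_ge0.
rewrite -!lee_fin -(H z z01); apply/andP; split.
  under eq_bigr do rewrite mulrC.
  exact: (partial_sum_le_expectation M Y zk).
rewrite expectation.unlock; under eq_bigr do rewrite mulrC.
rewrite EFinD -(integral_simple_part M Y zk) mul1r.
have -> : (z ^+ M)%:E = (\int[P]_t (cst (z ^+ M)%:E) t)%E.
  by rewrite integral_cst //= probability_setT mule1.
have mS : measurable_fun [set: T] (fun t => (simple_part (fun k => z ^+ k) M Y t)%:E).
  apply/measurable_EFinP => _ B mB; rewrite setTI.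
  have := measurable_preimage_nat Y [set k | B (if (k < M)%N then z ^+ k else 0)].
  by congr measurable; apply/seteqP; split => t /=; rewrite simple_partE.
rewrite -ge0_integralD //=.
- apply: ge0_le_integral => //=.
  + by move=> t _; rewrite lee_fin.
  + by apply: emeasurable_funD => //; exact: measurable_cst.
  + move=> t _; rewrite -EFinD lee_fin simple_partE; case: ltnP => YM.
      by rewrite lerDl.
    by rewrite add0r ler_wiXn2l.
- by move=> t _; rewrite lee_fin simple_partE; case: ifP.
- by move=> t _; rewrite lee_fin.
Qed.

End DiscreteLaws.

(** * Countable ranges *)

Section CountableValues.
Context {R : realType} {d d' : measure_display}.
Context {T : measurableType d} {T' : measurableType d'}.

Lemma measurable_countable_preimage (C : countType) (f : T -> C) :
  (forall c, measurable (f @^-1` [set c])) -> forall B, measurable (f @^-1` B).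
Proof.
move=> mf B.
have -> : f @^-1` B = \bigcup_(i in [set i | exists2 c, B c & pickle c = i])
    (if unpickle i is Some c then f @^-1` [set c] else set0).
  apply/seteqP; split => [t Bt|t [_ [c Bc <-]]]; last first.
    by rewrite pickleK /= => ->.
  by exists (pickle (f t)); [exists (f t)|rewrite pickleK].
by apply: bigcup_measurable => i _; case: (unpickle i).
Qed.

Lemma measure_bigcup_countable_le (C : countType) (mu : probability T R)
    (nu : probability T' R) (A : set C) (F : C -> set T) (H : C -> set T') (c : R) :
  0 <= c ->
  (forall s, measurable (F s)) -> (forall s, measurable (H s)) ->
  (forall s s' t, F s t -> F s' t -> s = s') ->
  (forall s s' t, H s t -> H s' t -> s = s') ->
  (forall s, A s -> (mu (F s) <= c%:E * nu (H s))%E) ->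
  (mu (\bigcup_(s in A) F s) <= c%:E * nu (\bigcup_(s in A) H s))%E.
Proof.
move=> c0 mF mH tF tH le; pose D := pickle @` A.
pose unp T0 (G : C -> set T0) i := if unpickle i is Some s then G s else set0.
have unpE T0 (G : C -> set T0) : \bigcup_(s in A) G s = \bigcup_(i in D) unp T0 G i.
  apply/seteqP; split => [t [s As Gs]|t [_ [s As <-]]].
    by exists (pickle s); [exists s|rewrite /unp pickleK].
  by rewrite /unp pickleK => Gs; exists s.
have mF' i : D i -> measurable (unp _ F i) by move=> _; rewrite /unp; case: (unpickle i).
have mH' i : D i -> measurable (unp _ H i) by move=> _; rewrite /unp; case: (unpickle i).
have tF' : trivIset D (unp _ F).
  move=> _ _ [s As <-] [s' As' <-] [t []]; rewrite /unp !pickleK => h h'.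
  by rewrite (tF _ _ _ h h').
have tH' : trivIset D (unp _ H).
  move=> _ _ [s As <-] [s' As' <-] [t []]; rewrite /unp !pickleK => h h'.
  by rewrite (tH _ _ _ h h').
rewrite !unpE !measure_bigcup //.
rewrite -nneseriesZl //; apply: lee_nneseries => // i; rewrite inE => -[s As <-].
by rewrite /unp pickleK; exact: le.
Qed.

End CountableValues.

(** * The data of the limit sequence *)

Section SizeBiased.
Context {R : realType} {d : measure_display} {T : measurableType d}.
Variables (P : probability T R) (Xs : nat -> {RV P >-> nat}).
Variables (Nhat J : {RV P >-> nat}).

(** All the randomness of the limit sequence, with values in a countable type, so
   that measurability and comparisons of laws reduce to points. *)
Definition limit_data (t : T) : nat * nat * seq nat :=
  (Nhat t, J t, mkseq (fun i => Xs i t) (Nhat t).-1).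

Definition insert_rest (n : nat) (z : nat * nat * seq nat) : seq int :=
  let xs := [seq x%:Z | x <- z.2] in
  take z.1.2.-1 xs ++ (n%:Z - \sum_(x <- xs) x) :: drop z.1.2.-1 xs.

Lemma Xi_insert_rest n t :
  Xi (fun i => Xs i : T -> nat) Nhat J n t = insert_rest n (limit_data t).
Proof. by rewrite /Xi /insert_rest /limit_data /= /mkseq -map_comp. Qed.

Lemma mkseq_event m (y : seq nat) : size y = m ->
  [set t | mkseq (fun i => Xs i t) m = y] =
  \bigcap_(i in [set` iota 0 m]) (Xs i : T -> nat) @^-1` [set nth 0%N y i].
Proof.
move=> ym; apply/seteqP; split => t /= H.
  by move=> i /=; rewrite mem_iota /= add0n => im; rewrite -H nth_mkseq.
apply: (@eq_from_nth _ 0%N); rewrite size_mkseq // => i im.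
by rewrite nth_mkseq //; apply: H => /=; rewrite mem_iota.
Qed.

Lemma mkseq_event_sigma m (y : seq nat) (S : set (T -> nat)) : size y = m ->
  (forall i, S (Xs i)) ->
  sigma_of S [set t | mkseq (fun i => Xs i t) m = y].
Proof.
move=> ym HS; rewrite mkseq_event //.
pose G := \bigcup_(Y in S) preimage_set_system [set: T] Y measurable.
have mX (i : nat) (k : nat) : (measurable : set (set (g_sigma_algebraType G)))
    ((Xs i : T -> nat) @^-1` [set k]).
  apply: sub_sigma_algebra; exists (Xs i : T -> nat); first exact: HS.
  by exists [set k] => //; rewrite setTI.
change ((measurable : set (set (g_sigma_algebraType G)))
  (\bigcap_(i in [set` iota 0 m]) (Xs i : T -> nat) @^-1` [set nth 0%N y i])).
exact: fin_bigcap_measurable.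
Qed.

Lemma measurable_mkseq_event m y :
  measurable [set t | mkseq (fun i => Xs i t) m = y].
Proof.
have [ym|ym] := eqVneq (size y) m; last first.
  rewrite (_ : [set t | _] = set0) //; apply/seteqP; split => t //= E.
  by move: ym; rewrite -E size_mkseq eqxx.
rewrite mkseq_event //; apply: fin_bigcap_measurable => //.
by move=> i _; exact: measurable_preimage_nat.
Qed.

Lemma limit_data_fiber k j y : limit_data @^-1` [set (k, j, y)] =
  (J : T -> nat) @^-1` [set j] `&` [set t | mkseq (fun i => Xs i t) k.-1 = y]
   `&` (Nhat : T -> nat) @^-1` [set k].
Proof.
apply/seteqP; split => t /=; first by case=> <- <- <-.
by move=> [[<- <-] <-].
Qed.

Lemma measurable_limit_data B : measurable (limit_data @^-1` B).
Proof.
apply: measurable_countable_preimage => -[[k j] y]; rewrite limit_data_fiber.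
apply: measurableI; last exact: measurable_preimage_nat.
by apply: measurableI; [exact: measurable_preimage_nat|exact: measurable_mkseq_event].
Qed.

Lemma int_event_limit_data n A :
  int_event (Xi (fun i => Xs i : T -> nat) Nhat J n) A =
  limit_data @^-1` [set z | exists2 s, A s & insert_rest n z = [seq x%:Z | x <- s]].
Proof.
by apply/seteqP; split => t [s As E]; exists s => //; rewrite -E Xi_insert_rest.
Qed.

Lemma measurable_int_event n A :
  measurable (int_event (Xi (fun i => Xs i : T -> nat) Nhat J n) A).
Proof. by rewrite int_event_limit_data; exact: measurable_limit_data. Qed.

Variable S : set (T -> nat).
Hypothesis S_Xs : forall i, S (Xs i : T -> nat).
Variable p : nat -> R.
Hypothesis Xs_law : forall i k, P ((Xs i : T -> nat) @^-1` [set k]) = (p k)%:E.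
Hypothesis Xs_indep : mutually_indep P (fun i => Xs i : T -> nat).
Hypothesis Nhat_gt0 : forall t, (0 < Nhat t)%N.
Hypothesis Nhat_indep : indep_classes P (sigma_of [set (Nhat : T -> nat)])
  (sigma_of (range (fun i => Xs i : T -> nat))).
Hypothesis J_unif : cond_uniform P J Nhat.
Hypothesis J_indep : cond_indep P J Nhat (sigma_of S).

Let prob_mkseq m y : size y = m ->
  P [set t | mkseq (fun i => Xs i t) m = y] = (\prod_(x <- y) p x)%:E.
Proof.
move=> ym; rewrite mkseq_event // (Xs_indep (fun i => [set nth 0%N y i])) ?iota_uniq //.
rewrite (eq_bigr (fun i => (p (nth 0%N y i))%:E)) => [|i _]; last exact: Xs_law.
rewrite prodEFin; congr EFin.
by rewrite [RHS](big_nth 0%N) ym /index_iota subn0.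
Qed.

(** The factor [1 / k] is the probability of the position [J]. *)
Lemma prob_limit_data k j y : (1 <= j <= k)%N -> size y = k.-1 ->
  P (limit_data @^-1` [set (k, j, y)]) =
    (nat_pmf Nhat k / k%:R * \prod_(x <- y) p x)%:E.
Proof.
move=> jk yk; rewrite limit_data_fiber.
set E := [set t | mkseq _ _ = y].
have mE : measurable E by exact: measurable_mkseq_event.
have mJ : measurable ((J : T -> nat) @^-1` [set j]) by exact: measurable_preimage_nat.
have mN : measurable ((Nhat : T -> nat) @^-1` [set k]) by exact: measurable_preimage_nat.
have := J_indep j k (mkseq_event_sigma yk S_Xs).
rewrite -/E (J_unif jk).
have -> : P (E `&` (Nhat : T -> nat) @^-1` [set k]) =
    (\prod_(x <- y) p x * nat_pmf Nhat k)%:E.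
  rewrite setIC Nhat_indep ?nat_pmfE ?(prob_mkseq yk) //.
  - by rewrite -EFinM mulrC.
  - apply: sub_sigma_algebra; exists (Nhat : T -> nat) => //.
    by exists [set k] => //; rewrite setTI.
  - by apply: mkseq_event_sigma => // i; exists i.
rewrite (nat_pmfE Nhat k).
have [N0|N0] := eqVneq (nat_pmf Nhat k) 0.
  move=> _; rewrite N0 !mul0r; apply/eqP; rewrite -measure_le0.
  apply: le_trans (_ : P ((Nhat : T -> nat) @^-1` [set k]) <= 0)%E; last first.
    by rewrite nat_pmfE N0.
  by apply: le_measure; rewrite ?inE //; apply: measurableI => //; exact: measurableI.
have fin : P ((J : T -> nat) @^-1` [set j] `&` E `&` (Nhat : T -> nat) @^-1` [set k]) \is a fin_num.
  by apply: fin_num_measure; apply: measurableI => //; exact: measurableI.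
rewrite -(fineK fin) -!EFinM => -[H]; congr EFin.
by apply: (mulIf N0); rewrite H; ring.
Qed.

(** A finite set of values, on which estimates that hold for each fixed value and
   large [n] become uniform. *)
Definition bounded_data (B : nat) : set (nat * nat * seq nat) :=
  [set z | [&& (1 <= z.1.2)%N, (z.1.2 <= z.1.1)%N, (z.1.1 <= B)%N & all (fun x => x <= B)%N z.2]].

Let J_range k : P ((Nhat : T -> nat) @^-1` [set k] `&` [set t | (1 <= J t <= k)%N]) =
  P ((Nhat : T -> nat) @^-1` [set k]).
Proof.
case: (posnP k) => [->|k0].
  have -> : (Nhat : T -> nat) @^-1` [set 0%N] = set0.
    by apply/seteqP; split => t //= Nt; have := Nhat_gt0 t; rewrite Nt.
  by rewrite set0I.
have main m : (m <= k)%N -> P ((Nhat : T -> nat) @^-1` [set k] `&` [set t | (1 <= J t <= m)%N])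
   = (m%:R / k%:R * nat_pmf Nhat k)%:E.
  elim: m => [_|m IH mk].
    rewrite (_ : _ `&` _ = set0) ?measure0 ?mul0r ?mul0r //.
    by apply/seteqP; split => t //= [_]; case: (J t).
  have -> : (Nhat : T -> nat) @^-1` [set k] `&` [set t | (1 <= J t <= m.+1)%N] =
     ((Nhat : T -> nat) @^-1` [set k] `&` [set t | (1 <= J t <= m)%N]) `|`
     ((J : T -> nat) @^-1` [set m.+1] `&` (Nhat : T -> nat) @^-1` [set k]).
    apply/seteqP; split => t /=.
      move=> [Nk /andP[J1]]; rewrite leq_eqVlt => /orP[/eqP Jm|Jm]; first by right.
      by left; rewrite J1.
    by move=> [[Nk /andP[J1 Jm]]|[-> Nk]]; split => //; rewrite ?leqnn // J1 ltnW.
  set A1 := _ `&` [set t | (1 <= J t <= m)%N]; set A2 := _ `&` _ @^-1` _.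
  have -> : P (A1 `|` A2) = (P A1 + P A2)%E.
    apply: measureU.
    - apply: measurableI; first exact: measurable_preimage_nat.
      exact: (measurable_preimage_nat J [set j | (1 <= j <= m)%N]).
    - by apply: measurableI; exact: measurable_preimage_nat.
    - apply/seteqP; split => t //= [[_ /andP[_ Jm]] [Jm' _]].
      by move: Jm; rewrite Jm' ltnn.
  rewrite /A1 /A2 IH ?(ltnW mk) // (J_unif (j := m.+1)) ?mk // (nat_pmfE Nhat k).
  by rewrite -EFinM -EFinD; congr EFin; rewrite -natr1; ring.
by rewrite main // divff ?mul1r ?pnatr_eq0 -?lt0n // nat_pmfE.
Qed.

Let J_range_ae : P [set t | (1 <= J t <= Nhat t)%N] = 1%E.
Proof.
have mA k : measurable ((Nhat : T -> nat) @^-1` [set k] `&` [set t | (1 <= J t <= k)%N]).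
  apply: measurableI; first exact: measurable_preimage_nat.
  exact: (measurable_preimage_nat J [set j | (1 <= j <= k)%N]).
have -> : [set t | (1 <= J t <= Nhat t)%N] = \bigcup_k
    ((Nhat : T -> nat) @^-1` [set k] `&` [set t | (1 <= J t <= k)%N]).
  apply/seteqP; split => t /=; first by move=> Jt; exists (Nhat t).
  by move=> [k _ [/= <-]].
rewrite measure_bigcup //; last by move=> i j _ _ [t [[/= <- _] [/= <- _]]].
have <- : P (\bigcup_k (Nhat : T -> nat) @^-1` [set k]) = 1%E.
  rewrite (_ : \bigcup_k _ = [set: T]) ?probability_setT //.
  by apply/seteqP; split => t // _; exists (Nhat t).
rewrite measure_bigcup.
- by apply: eq_eseriesr => k _; exact: J_range.
- by move=> i _; exact: measurable_preimage_nat.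
- by move=> i j _ _ [t [/= <- /= <-]].
Qed.

(** The sets [bounded_data B] exhaust the event [1 <= J <= Nhat], which has
   probability one by conditional uniformity. *)
Lemma bounded_data_likely (e : R) : 0 < e ->
  exists B, ((1 - e)%:E <= P (limit_data @^-1` bounded_data B))%E.
Proof.
move=> e0.
have nd : {homo (fun B => limit_data @^-1` bounded_data B) :
    n m / (n <= m)%N >-> (n <= m)%O}.
  move=> n m nm; apply/subsetPset => t /and4P[a b h1 h2]; apply/and4P; split => //.
    exact: leq_trans nm.
  by apply: sub_all h2 => x h; exact: leq_trans nm.
have := @nondecreasing_cvg_mu _ _ _ P _ (fun B => measurable_limit_data (bounded_data B))
  (bigcupT_measurable _ (fun B => measurable_limit_data (bounded_data B))) nd.
have -> : \bigcup_B (limit_data @^-1` bounded_data B) = [set t | (1 <= J t <= Nhat t)%N].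
  apply/seteqP; split => t; first by move=> [B _ /and4P[a b _ _]]; apply/andP.
  move=> /andP[J1 JN]; pose xs := mkseq (fun i => Xs i t) (Nhat t).-1.
  exists (maxn (Nhat t) (\max_(x <- xs) x)) => //; apply/and4P; split => //.
    exact: leq_maxl.
  apply/allP => x xin; apply: leq_trans (leq_maxr _ _).
  exact: (@leq_bigmax_seq _ xs xpredT (fun x => x) x xin).
rewrite [X in _ --> X -> _]J_range_ae => H.
have [B _ HB] : \forall B \near \oo, ((1 - e)%:E < (P \o (fun B => limit_data @^-1` bounded_data B)) B)%E.
  apply: (H [set z | ((1 - e)%:E < z)%E]); apply: open_nbhs_nbhs.
  split; first exact: open_ereal_gt_ereal.
  by rewrite /= lte_fin; lra.
by exists B; apply/ltW/HB => /=.
Qed.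

End SizeBiased.

(** * Total variation *)

Section Comparison.
Context {R : realType} {d : measure_display} {T : measurableType d}.
Variables (P : probability T R) (Xs : nat -> {RV P >-> nat}).
Variables (Nhat J : {RV P >-> nat}) (S : set (T -> nat)).
Hypothesis S_Xs : forall i, S (Xs i : T -> nat).
Variables (p q : nat -> R) (D : R).
Hypothesis p0 : forall i, 0 <= p i.
Hypothesis q0 : forall i, 0 <= q i.
Hypothesis D0 : 0 < D.
Hypothesis Xs_law : forall i k, P ((Xs i : T -> nat) @^-1` [set k]) = (p k)%:E.
Hypothesis Xs_indep : mutually_indep P (fun i => Xs i : T -> nat).
Hypothesis Nhat_gt0 : forall t, (0 < Nhat t)%N.
Hypothesis Nhat_law : forall k, nat_pmf Nhat k = k%:R * q k / D.
Hypothesis Nhat_indep : indep_classes P (sigma_of [set (Nhat : T -> nat)])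
  (sigma_of (range (fun i => Xs i : T -> nat))).
Hypothesis J_unif : cond_uniform P J Nhat.
Hypothesis J_indep : cond_indep P J Nhat (sigma_of S).

Variables (dK : measure_display) (TK : measurableType dK) (Q : probability TK R).
Variables (K : TK -> seq nat) (n : nat) (U : R).
Hypothesis U0 : 0 < U.
Hypothesis mK : forall s, measurable (K @^-1` [set s]).
Hypothesis K_law : forall s, s != [::] -> sumn s = n ->
  Q (K @^-1` [set s]) = (q (size s) * \prod_(x <- s) p x / U)%:E.

Variables (B : nat) (e : R).
Hypothesis e01 : 0 < e <= 1.
Hypothesis nB : (B * B + B < n)%N.
Hypothesis Ue : forall m, (m <= B * B)%N -> U <= (1 + e) * (D * p (n - m)%N).
Hypothesis likely : ((1 - e)%:E <= P (limit_data Xs Nhat J @^-1` bounded_data B))%E.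

Let Z := limit_data Xs Nhat J.
Let G := Z @^-1` bounded_data B.
Let xi_is s := [set t | insert_rest n (Z t) = [seq x%:Z | x <- s]].

Let sumn_bounded (y : seq nat) : all (fun x => x <= B)%N y -> (size y <= B)%N ->
  (sumn y <= B * B)%N.
Proof.
move=> yB sB; apply: (@leq_trans (size y * B)); last by rewrite leq_mul2r sB orbT.
elim: y yB {sB} => //= x y IH /andP[xB yB].
by rewrite mulSn leq_add // IH.
Qed.

Let sumz (y : seq nat) : \sum_(x <- [seq x%:Z | x <- y]) x = (sumn y)%:Z.
Proof.
rewrite big_map; elim: y => [|x y IH]; first by rewrite big_nil.
by rewrite big_cons IH /= PoszD.
Qed.

(* Since [B * B + B < n], the inserted entry is nonnegative, and it is the only one
   that exceeds [B]: hence the sequence determines the data it is built from. *)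
Let insert_rest_spec z : bounded_data B z -> size z.2 = z.1.1.-1 ->
  insert_rest n z =
   [seq x%:Z | x <- take z.1.2.-1 z.2 ++ (n - sumn z.2)%N :: drop z.1.2.-1 z.2] /\
  (sumn z.2 <= B * B)%N.
Proof.
case: z => [[k j] y] /= /and4P[/= j1 jk kB yB] yk.
have sB : (size y <= B)%N by rewrite yk (leq_trans (leq_pred k)).
have sy := sumn_bounded yB sB; split => //.
rewrite /insert_rest /= map_cat /= map_take map_drop sumz subzn //.
by apply: leq_trans sy _; apply: leq_trans (ltnW nB); exact: leq_addr.
Qed.

Let index_of s := find (fun x => B < x)%N s.

Let insert_rest_recover z s : bounded_data B z -> size z.2 = z.1.1.-1 ->
  insert_rest n z = [seq x%:Z | x <- s] ->
  z = (size s, (index_of s).+1, take (index_of s) s ++ drop (index_of s).+1 s).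
Proof.
move=> bz sz E; have [E' sy] := insert_rest_spec bz sz.
have {E E'} <- : take z.1.2.-1 z.2 ++ (n - sumn z.2)%N :: drop z.1.2.-1 z.2 = s.
  by apply: (inj_map (f := Posz)); [move=> a b []|rewrite -E'].
case: z bz sz sy => [[k j] y] /and4P[/= j1 jk kB yB] yk sy.
have k0 : (0 < k)%N by exact: leq_trans jk.
have jy : (j.-1 <= size y)%N by rewrite yk -ltnS !prednK.
have stj : size (take j.-1 y) = j.-1 by rewrite size_takel.
have ix : index_of (take j.-1 y ++ (n - sumn y)%N :: drop j.-1 y) = j.-1.
  rewrite /index_of find_cat.
  have -> : has (fun x => B < x)%N (take j.-1 y) = false.
    apply/negbTE/hasPn => x /mem_take /(allP yB).
    by rewrite -leqNgt.
  rewrite stj /=; have -> : (B < n - sumn y)%N.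
    rewrite ltn_subRL; apply: leq_ltn_trans nB; rewrite leq_add2r //.
  by rewrite addn0.
rewrite ix prednK // size_cat /= stj size_drop addnS subnKC // yk prednK //.
congr (_, _); rewrite take_cat stj ltnn subnn /= ?take0 cats0.
have j1E : (j - j.-1 = 1)%N by rewrite -{1}(prednK j1) subSnn.
by rewrite drop_cat stj ltnNge leq_pred /= j1E /= drop0 cat_take_drop.
Qed.

(* The size bias [k] in the law of [Nhat] cancels the probability [1 / k] of the
   position of the inserted entry, so that the two point masses have ratio
   [U / (D * p (n - m))], where [m] is the sum of the other entries. *)
Let compare_point s : s != [::] ->
  (P (xi_is s `&` G) <= (1 + e)%:E * Q (K @^-1` [set s]))%E.
Proof.
move=> sn; have e0 : 0 < e by case/andP: e01.
have [E|/set0P[t0 [X0 G0]]] := eqVneq (xi_is s `&` G) set0.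
  by rewrite E measure0 mule_ge0 // lee_fin; lra.
have sz t : size (Z t).2 = (Z t).1.1.-1 by rewrite /Z /= size_mkseq.
have sub : xi_is s `&` G `<=` Z @^-1` [set Z t0].
  move=> t [Xt Gt] /=.
  by rewrite (insert_rest_recover G0 (sz t0) X0) (insert_rest_recover Gt (sz t) Xt).
have [E sy] := insert_rest_spec G0 (sz t0).
have sE : s = take (Z t0).1.2.-1 (Z t0).2 ++ (n - sumn (Z t0).2)%N :: drop (Z t0).1.2.-1 (Z t0).2.
  by apply: (inj_map (f := Posz)); [move=> a b []|rewrite -E -X0].
have sk : size s = (Z t0).1.1.
  by rewrite (insert_rest_recover G0 (sz t0) X0).
have := sz t0; move: sub sE sy sk (G0 : bounded_data B (Z t0)).
case: (Z t0) => [[k j] y] /= sub sE sy sk /and4P[/= j1 jk kB yB] yk.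
have k0 : (0 < k)%N by exact: leq_trans jk.
have sn' : sumn s = n.
  rewrite sE sumn_cat /= addnCA -sumn_cat cat_take_drop subnK //.
  by apply: leq_trans sy _; apply: leq_trans (ltnW nB); exact: leq_addr.
apply: (@le_trans _ _ (P (Z @^-1` [set (k, j, y)]))).
  apply: le_measure => //; rewrite inE; last exact: measurable_limit_data.
  apply: measurableI; last exact: measurable_limit_data.
  exact: (measurable_limit_data Xs Nhat J
    [set z | insert_rest n z = [seq x%:Z | x <- s]]).
rewrite (prob_limit_data S_Xs Xs_law Xs_indep Nhat_indep J_unif J_indep) ?j1 //.
rewrite K_law // -EFinM lee_fin sk sE big_cat big_cons /=.
have -> : \prod_(x <- take j.-1 y) p x * (p (n - sumn y)%N * \prod_(x <- drop j.-1 y) p x)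
    = p (n - sumn y)%N * \prod_(x <- y) p x.
  by rewrite mulrCA -big_cat cat_take_drop.
have pr0 : 0 <= \prod_(x <- y) p x by apply: prodr_ge0.
have kR : 0 < k%:R :> R by rewrite ltr0n.
rewrite Nhat_law.
have -> : k%:R * q k / D / k%:R * \prod_(x <- y) p x = q k * \prod_(x <- y) p x / D.
  by field; rewrite !gt_eqF.
rewrite ler_pdivrMr //.
have -> : (1 + e) * (q k * (p (n - sumn y)%N * \prod_(x <- y) p x) / U) * D
   = q k * \prod_(x <- y) p x * ((1 + e) * (D * p (n - sumn y)%N) / U) by ring.
rewrite ler_peMr ?mulr_ge0 // ler_pdivlMr // mul1r.
exact: Ue.
Qed.

Let mxi (s : seq nat) : measurable (xi_is s).
Proof.
exact: (measurable_limit_data Xs Nhat J [set z | insert_rest n z = [seq x%:Z | x <- s]]).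
Qed.

Let mG : measurable G. Proof. exact: measurable_limit_data. Qed.

Let event A := int_event (Xi (fun i => Xs i : T -> nat) Nhat J n) A.

Let eventE A : event A = Z @^-1` [set z | exists2 s, A s & insert_rest n z = [seq x%:Z | x <- s]].
Proof. exact: int_event_limit_data. Qed.

Let mevent A : measurable (event A). Proof. exact: measurable_int_event. Qed.

Let mKA A : measurable (K @^-1` A).
Proof. exact: measurable_countable_preimage. Qed.

Let PfE A : measurable A -> P A = (fine (P A))%:E.
Proof. by move=> mA; rewrite fineK // fin_num_measure. Qed.

Let QfE A : measurable A -> Q A = (fine (Q A))%:E.
Proof. by move=> mA; rewrite fineK // fin_num_measure. Qed.

Let PG : 1 - e <= fine (P G).
Proof. by rewrite -lee_fin -PfE. Qed.

Let upper A : A `<=` Nplus -> fine (P (event A)) <= fine (Q (K @^-1` A)) + 2 * e.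
Proof.
move=> AN; have e0 : 0 < e by case/andP: e01.
have H1 : (P (event A `&` G) <= (1 + e)%:E * Q (K @^-1` A))%E.
  have := @measure_bigcup_countable_le R _ _ T TK _ P Q A (fun s => xi_is s `&` G)
    (fun s => K @^-1` [set s]) (1 + e).
  have -> : \bigcup_(s in A) (xi_is s `&` G) = event A `&` G.
    apply/seteqP; split => [t [s As [Xt Gt]]|t [Et Gt]].
      by split => //; rewrite eventE; exists s.
    by move: Et; rewrite eventE => -[s As Xt]; exists s.
  have -> : \bigcup_(s in A) K @^-1` [set s] = K @^-1` A.
    apply/seteqP; split => [t [s As /= Ks]|t At]; last by exists (K t).
    by rewrite /= Ks.
  apply.
  - by lra.
  - by move=> s; apply: measurableI.
  - by move=> s; exact: mK.
  - move=> s s' t [X1 _] [X2 _]; apply: (inj_map (f := Posz)); first by move=> a b [].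
    by rewrite -X1 -X2.
  - by move=> s s' t /= <- <-.
  - by move=> s /AN; exact: compare_point.
have H2 : (P (event A) <= P (event A `&` G) + P (~` G))%E.
  apply: le_trans (measureU2 _ _ _); [|exact: measurableI|exact: measurableC].
  apply: le_measure; rewrite ?inE //.
    by apply: measurableU; [exact: measurableI|exact: measurableC].
  by move=> t At; have [Gt|Gt] := pselect (G t); [left|right].
have PGc : fine (P (~` G)) <= e.
  have := probability_setC P mG; rewrite (PfE mG) -EFinB => ->.
  by rewrite /=; have := PG; lra.
have QA1 : fine (Q (K @^-1` A)) <= 1.
  by rewrite -lee_fin -QfE //; exact: probability_le1.
have Q0 : 0 <= fine (Q (K @^-1` A)) by rewrite fine_ge0.
move: H1 H2; rewrite (QfE (mKA A)) (PfE (mevent A)) (PfE (measurableI _ _ (mevent A) mG)).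
rewrite (PfE (measurableC mG)) -EFinM -EFinD !lee_fin => H1 H2; nra.
Qed.

Let event_G : 1 - e <= fine (P (event Nplus)).
Proof.
apply: le_trans PG _; rewrite -lee_fin -!PfE //; apply: le_measure; rewrite ?inE //.
move=> t Gt; rewrite eventE /=.
have [E _] := insert_rest_spec Gt ltac:(by rewrite /Z /= size_mkseq).
exists (take (Z t).1.2.-1 (Z t).2 ++ (n - sumn (Z t).2)%N :: drop (Z t).1.2.-1 (Z t).2).
  by rewrite /Nplus /=; case: (take _ _).
by rewrite -E.
Qed.

(** The one-sided bound [upper] for [A] and for its complement in [Nplus] gives both
   signs, because the limit sequence lies in [Nplus] with probability at least
   [1 - e]. *)
Lemma total_variation_bound A : A `<=` Nplus ->
  `|fine (Q (K @^-1` A)) - fine (P (event A))| <= 3 * e.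
Proof.
move=> AN; have e0 : 0 < e by case/andP: e01.
have A'N : Nplus `\` A `<=` Nplus by exact: subDsetl.
have h1 := upper AN; have h2 := upper A'N.
have h3 : fine (Q (K @^-1` A)) + fine (Q (K @^-1` (Nplus `\` A))) <= 1.
  rewrite -lee_fin EFinD -!QfE //.
  have <- : Q (K @^-1` A `|` K @^-1` (Nplus `\` A)) =
      (Q (K @^-1` A) + Q (K @^-1` (Nplus `\` A)))%E.
    apply: measureU => //.
    by rewrite -preimage_setI setDE setICA setICr setI0 preimage_set0.
  by apply: probability_le1; exact: measurableU.
have h4 : 1 - e <= fine (P (event A)) + fine (P (event (Nplus `\` A))).
  apply: le_trans event_G _; rewrite -lee_fin EFinD -!PfE //.
  apply: le_trans (measureU2 _ _ _) => //; apply: le_measure; rewrite ?inE //.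
    by apply: measurableU.
  move=> t [s Ns E]; have [As|As] := pselect (A s); [left|right]; by exists s.
rewrite ler_norml; apply/andP; split; lra.
Qed.

(** The number of components is the size of the sequence, so this is the total
   variation bound for a set of sequences given by their size. *)
Lemma size_law_bound (x : R) :
  `|fine (Q [set t | (size (K t))%:R <= x]) - fine (P [set t | (Nhat t)%:R <= x])|
     <= 8 * e.
Proof.
have e0 : 0 < e by case/andP: e01.
pose A := [set s : seq nat | s != [::] /\ (size s)%:R <= x].
have AN : A `<=` Nplus by move=> s [].
have h1 := total_variation_bound AN.
have h2 := total_variation_bound (@subset_refl _ Nplus).
have mS : measurable [set t | (size (K t))%:R <= x].
  exact: (mKA [set s | (size s)%:R <= x]).
have mN : measurable [set t | (Nhat t)%:R <= x].
  exact: (measurable_preimage_nat Nhat [set k | k%:R <= x]).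
have h3 : fine (Q (K @^-1` A)) <= fine (Q [set t | (size (K t))%:R <= x]).
  rewrite -lee_fin -!QfE //; apply: le_measure; rewrite ?inE //.
  by move=> t [].
have h4 : fine (Q [set t | (size (K t))%:R <= x]) <=
    fine (Q (K @^-1` A)) + fine (Q (~` (K @^-1` Nplus))).
  rewrite -lee_fin EFinD -!QfE //; last exact: measurableC.
  apply: le_trans (measureU2 _ _ _) => //; last exact: measurableC.
  apply: le_measure; rewrite ?inE //; first by apply: measurableU => //; exact: measurableC.
  move=> t st; have [kn|kn] := eqVneq (K t) [::]; last by left.
  by right; rewrite /= /Nplus /= kn eqxx.
have h5 : fine (Q (~` (K @^-1` Nplus))) = 1 - fine (Q (K @^-1` Nplus)).
  by have := probability_setC Q (mKA Nplus); rewrite (QfE (mKA Nplus)) -EFinB => ->.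
have h6 : fine (P (event A)) <= fine (P [set t | (Nhat t)%:R <= x]).
  rewrite -lee_fin -!PfE //; apply: le_measure; rewrite ?inE // eventE.
  move=> t [s [_ sx] E] /=; suff <- : size s = Nhat t by [].
  have := congr1 size E; rewrite size_map => <-.
  rewrite /insert_rest size_cat /= addnS -size_cat cat_take_drop size_map /= size_mkseq.
  by rewrite prednK.
have h7 : fine (P [set t | (Nhat t)%:R <= x]) <=
    fine (P (event A)) + fine (P (~` event Nplus)).
  rewrite -lee_fin EFinD -!PfE //; last exact: measurableC.
  apply: le_trans (measureU2 _ _ _) => //; last exact: measurableC.
  apply: le_measure; rewrite ?inE //; first by apply: measurableU => //; exact: measurableC.
  move=> t Nx; have [Et|] := pselect (event Nplus t); last by right.
  left; move: Et; rewrite !eventE => -[s sn E]; exists s => //; split => //.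
  suff -> : size s = Nhat t by [].
  have := congr1 size E; rewrite size_map => <-.
  rewrite /insert_rest size_cat /= addnS -size_cat cat_take_drop size_map /= size_mkseq.
  by rewrite prednK.
have h8 : fine (P (~` event Nplus)) = 1 - fine (P (event Nplus)).
  by have := probability_setC P (mevent Nplus); rewrite (PfE (mevent Nplus)) -EFinB => ->.
have h9 := event_G.
move: h1 h2; rewrite !ler_norml => /andP[a1 a2] /andP[b1 b2].
apply/andP; split; lra.
Qed.

End Comparison.

(** * Sufficient conditions for a single jump *)

Section SingleJump.
Context {R : realType}.

(** The properties of the weights from which the limit theorem follows: together
   they say that a large total [n] comes from one large summand among boundedly
   many. *)
Definition single_jump (p q : nat -> R) :=
  [/\ long_tailed p, subexp p & tail_negligible p q].

(** Regular variation of index [- a]. *)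
Definition regular (p : nat -> R) (a eta : R) :=
  slow_seq (fun n => p n * n%:R `^ a) eta /\ slow_step (fun n => p n * n%:R `^ a).

Variables p q : nat -> R.
Hypothesis p0 : forall i, 0 <= p i.
Hypothesis p1 : forall M, \sum_(i < M) p i <= 1.
Hypothesis q0 : forall k, 0 <= q k.
Variable D : R.
Hypothesis qD : forall M, \sum_(k < M) q k * k%:R <= D.

Lemma small_tails_mean : small_tails (fun k => q k * k%:R).
Proof. by apply: small_tails_bounded qD => k; rewrite mulr_ge0. Qed.

Lemma regular_subexp a eta : 0 < a -> 0 <= eta <= a -> regular p a eta ->
  long_tailed p /\ subexp p.
Proof.
move=> a0 /[dup] ea /andP[eta0 etaa] [ss st].
have lt := long_tailed_regular a0 ss st.
split => //; have dv := dom_var_regular p0 a0 ea ss.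
have [C C0 hC] := dom_var_half dv.
by apply: (subexp_of_half_dom p0 p1 lt _ C0 hC); apply: small_tails_bounded p1.
Qed.

Lemma single_jump_moment a eta : 0 < a -> 0 <= eta <= a -> regular p a eta ->
  small_tails (fun k => q k * (k%:R * k%:R `^ (a + eta))) -> single_jump p q.
Proof.
move=> a0 /[dup] ea /andP[eta0 etaa] reg mom.
have [lt sub] := regular_subexp a0 ea reg; split => //.
have dv := dom_var_regular p0 a0 ea reg.1.
have s0 : 0 <= a + eta by rewrite addr_ge0 // ltW.
have [C C0 hC] := cpow_le_max_term p0 p1 s0 dv.
apply: (tail_negligible_dom p0 q0 hC).
apply: small_tails_le (small_tailsZ (ltW C0) mom).
- by exists 0%N => // k _; rewrite mulrCA.
- by move=> k; rewrite !mulr_ge0 ?powR_ge0 // ltW.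
Qed.

Lemma single_jump_concentration a eta s : 0 <= eta -> 1 < a - eta < 2 ->
  regular p a eta -> 1 <= s ->
  a + eta <= ((a - eta) / (a + eta - 1) - 1 + s) * (a - eta - 1) ->
  small_tails (fun k => q k * k%:R `^ s) -> single_jump p q.
Proof.
move=> eta0 /[dup] ae /andP[ae1 ae2] reg s1 hs mom.
have a0 : 0 < a by lra.
have ea : 0 <= eta <= a by apply/andP; split; lra.
have [lt sub] := regular_subexp a0 ea reg; split => //.
have dv := dom_var_regular p0 a0 ea reg.1.
apply: (tail_negligible_concentration p0 p1 q0 _ dv ae _ (power_bounds_regular reg.1) s1 hs mom); lra.
Qed.

Lemma single_jump_log : regular p 2 0 ->
  small_tails (fun k => q k * (k%:R * (1 + ln k%:R) ^+ 2)) -> single_jump p q.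
Proof.
move=> reg mom.
have a0 : 0 < 2 :> R by [].
have ea : 0 <= (0 : R) <= 2 by rewrite lexx ltW.
have [lt sub] := regular_subexp a0 ea reg; split => //.
have dv := dom_var_regular p0 a0 ea reg.1.
have pb := power_bounds_regular reg.1; rewrite subr0 addr0 in pb.
by apply: (tail_negligible_log p0 p1 q0 _ dv pb mom); rewrite addr0.
Qed.

Lemma trunc_mean_bounded a1 a2 : 2 < a1 -> power_bounds p a1 a2 ->
  exists mu, forall n, trunc_mean p n <= mu.
Proof.
move=> a12 [c [C [n1 [c0 C0 pb]]]].
have t0 : 0 < a1 - 2 by lra.
exists (n1%:R + C * (1 + (a1 - 2)^-1)) => n.
apply: (@le_trans _ _ (\sum_(i < n.+1) n1%:R * p i +
   \sum_(1 <= i < n.+1) C * i%:R `^ (-1 - (a1 - 2)))).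
  rewrite /trunc_mean big_ord_recl mul0r add0r big_ord_recl.
  rewrite -addrA ler_wpDl ?mulr_ge0 //.
  rewrite big_add1 /= big_mkord -big_split /=; apply: ler_sum => i _.
  rewrite -[bump 0 i]/i.+1; have [ni|ni] := leqP n1 i.+1.
    rewrite ler_wpDl ?mulr_ge0 //.
    have /andP[_ pi] := pb _ ni; apply: le_trans (ler_wpM2l _ pi) _ => //.
    rewrite mulrCA ler_wpM2l ?(ltW C0) // -{1}(@powRr1 _ i.+1%:R) //.
    by rewrite -powRD ?pnatr_eq0 ?implybT // le_eqVlt; apply/orP; left; apply/eqP; congr (_ `^ _); ring.
  by rewrite ler_wpDr ?mulr_ge0 ?powR_ge0 ?(ltW C0) // ler_wpM2r // ler_nat ltnW.
rewrite -mulr_sumr -mulr_sumr lerD //; first by rewrite ler_piMr.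
by rewrite ler_wpM2l ?(ltW C0) //; apply: sum_powRN_le.
Qed.

Lemma single_jump_renewal a eta : 0 <= eta -> 2 < a - eta -> regular p a eta ->
  (forall e : R, 0 < e -> \forall k \near \oo, q k <= e * p k) -> single_jump p q.
Proof.
move=> eta0 ae reg qp.
have a0 : 0 < a by lra.
have ea : 0 <= eta <= a by apply/andP; split; lra.
have [lt sub] := regular_subexp a0 ea reg; split => //.
have dv := dom_var_regular p0 a0 ea reg.1.
have [mu hmu] := trunc_mean_bounded ae (power_bounds_regular reg.1).
apply: (tail_negligible_renewal p0 p1 q0 _ dv hmu qp small_tails_mean).
lra.
Qed.

Lemma power_bounds_littleo a1 a2 b1 b2 : a2 < b1 ->
  power_bounds p a1 a2 -> power_bounds q b1 b2 ->
  forall e : R, 0 < e -> \forall k \near \oo, q k <= e * p k.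
Proof.
move=> ab [c [C [n1 [c0 C0 pb]]]] [c' [C' [n2 [c'0 C'0 qb]]]] e e0.
have g0 : 0 < b1 - a2 by lra.
have ec : 0 < e * c by rewrite mulr_gt0.
pose y := (C' / (e * c)) `^ (b1 - a2)^-1.
have L : \forall k \near \oo, (n1 + n2 + (Num.truncn y).+1 <= k)%N by exact: nbhs_infty_ge.
apply: filterS L => k kL.
have k1 : (n1 <= k)%N by apply: leq_trans kL; rewrite -addnA leq_addr.
have k2 : (n2 <= k)%N by apply: leq_trans kL; rewrite addnAC leq_addl.
have k3 : (Num.truncn y < k)%N by apply: leq_trans kL; rewrite leq_addl.
have /andP[P1 _] := pb k k1; have /andP[_ Q2] := qb k k2.
have kR : 0 < k%:R :> R by rewrite ltr0n (leq_ltn_trans _ k3).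
have yk : y <= k%:R by apply: le_trans (ltW (truncnS_gt y)) _; rewrite ler_nat.
have H : C' / (e * c) <= k%:R `^ (b1 - a2).
  have := ler_powR_base (ltW g0) (powR_ge0 _ _) yk.
  by rewrite /y -powRrM mulVf ?gt_eqF // powRr1 // divr_ge0 // ltW.
apply: le_trans Q2 _; apply: le_trans (ler_wpM2l (ltW e0) P1).
rewrite ler_pdivrMr // in H; have ka : 0 < k%:R `^ (- b1) :> R by rewrite powR_gt0.
have -> : - a2 = (b1 - a2) + - b1 by ring.
rewrite powRD ?(gt_eqF kR) ?implybT // !mulrA ler_wpM2r ?(ltW ka) //.
by apply: le_trans H _; rewrite mulrC.
Qed.

Lemma power_bounds_moment b1 b2 s : s + 1 < b1 -> power_bounds q b1 b2 ->
  small_tails (fun k => q k * k%:R `^ s).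
Proof.
move=> sb [c [C [n1 [c0 C0 qb]]]].
have t0 : 0 < b1 - s - 1 by lra.
have st : small_tails (fun k : nat => k%:R `^ (-1 - (b1 - s - 1)) : R).
  apply: (@small_tails_bounded R (fun k : nat => k%:R `^ (-1 - (b1 - s - 1))) (1 + (b1 - s - 1)^-1)) => [k|M].
    exact: powR_ge0.
  case: M => [|M]; first by rewrite big_ord0 addr_ge0 // invr_ge0 ltW.
  rewrite big_ord_recl powR0 ?add0r; last by rewrite lt_eqF //; lra.
  apply: le_trans (sum_powRN_le M t0); rewrite big_add1 big_mkord.
  by apply: ler_sum => i _.
apply: small_tails_le (small_tailsZ (ltW C0) st).
- exists n1.+1 => // k k1; have /andP[_ Q2] := qb k (ltnW k1).
  have kR : 0 < k%:R :> R by rewrite ltr0n (leq_trans _ k1).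
  apply: le_trans (ler_wpM2r (powR_ge0 _ _) Q2) _.
  rewrite -mulrA -powRD ?(gt_eqF kR) ?implybT // le_eqVlt; apply/orP; left; apply/eqP.
  by congr (_ * (_ `^ _)); ring.
- by move=> k; rewrite mulr_ge0 ?powR_ge0 // ltW.
Qed.

(** The Potter exponent has to be small enough for the condition on the exponents
   in [tail_negligible_concentration] with [s = b / 2]; this value of [s] lies
   strictly between [1] and [b - 1]. *)
Lemma infinite_mean_exponents (a b : R) : 1 < a <= 2 -> 2 < b ->
  exists eta, [/\ 0 < eta, 1 < a - eta, 2 * eta < b - 2 &
    a + eta <= ((a - eta) / (a + eta - 1) - 1 + b / 2) * (a - eta - 1)].
Proof.
move=> /andP[a1 a2] b2.
have [al alE] : exists al : R, al = a - 1 by exists (a - 1).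
have [sg sgE] : exists sg : R, sg = b / 2 - 1 by exists (b / 2 - 1).
have al0 : 0 < al by lra.
have al1 : al <= 1 by lra.
have sg0 : 0 < sg by lra.
have d0 : 0 < 6 + sg by lra.
(* After multiplication by [al + eta], the last inequality has slack [sg * al ^ 2]
   at [eta = 0], and the terms in [eta] are at most [(6 + sg) * eta]. *)
have [eta etaE] : exists eta, eta * (6 + sg) = sg * al ^+ 2.
  by exists (sg * al ^+ 2 / (6 + sg)); rewrite divfK // gt_eqF.
have eta0 : 0 < eta by rewrite -(ltr_pM2r d0) mul0r etaE mulr_gt0 // exprn_gt0.
have al2 : sg * al ^+ 2 <= sg * al by rewrite ler_wpM2l ?(ltW sg0) // expr2 ler_piMr // ltW.
have etal : eta < al.
  rewrite -(ltr_pM2r d0) etaE; apply: le_lt_trans al2 _.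
  by rewrite mulrC ltr_pM2l //; lra.
have sga : sg * al <= sg by rewrite ler_piMr // ltW.
have es0 : 0 < eta * sg by rewrite mulr_gt0.
have etas : 2 * eta < b - 2 by lra.
exists eta; split => //; first by lra.
have ae0 : 0 < al + eta by lra.
have -> : (a - eta) / (a + eta - 1) - 1 + b / 2 = (al + 1 - eta) / (al + eta) + sg.
  have -> : a - eta = al + 1 - eta by rewrite alE; ring.
  have -> : a + eta - 1 = al + eta by rewrite alE; ring.
  by rewrite sgE; ring.
have -> : a - eta - 1 = al - eta by rewrite alE; ring.
have -> : a + eta = al + 1 + eta by rewrite alE; ring.
have -> : ((al + 1 - eta) / (al + eta) + sg) * (al - eta) =
    ((al + 1 - eta) * (al - eta) + sg * (al - eta) * (al + eta)) / (al + eta).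
  by field; rewrite gt_eqF.
rewrite ler_pdivlMr //.
have h1 : sg * eta ^+ 2 <= eta * sg.
  by rewrite mulrC ler_wpM2r ?(ltW sg0) // expr2 ler_piMr ?(ltW eta0) //; lra.
have h2 : eta * al <= eta by rewrite ler_piMr // ltW.
rewrite !expr2 in etaE h1; lra.
Qed.

Section GeometricTail.
Variable om r : R.
Hypothesis om0 : 0 < om.
Hypothesis omr : om < r.

(** Kesten's bound at a rate strictly between [1] and [r / om] is summable against
   the geometric decay of [q]. *)
Lemma single_jump_geometric (C : R) : long_tailed p -> subexp p ->
  (forall k, q k * (r / om) ^+ k <= C) -> single_jump p q.
Proof.
move=> lt sub qC; split => //.
have r0 : 0 < r by exact: lt_trans omr.
have [rm1 rm2] := midf_lt omr; set rm := (om + r) / 2 in rm1 rm2.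
have rm0 : 0 < rm by exact: lt_trans rm1.
have e0 : 0 < rm / om - 1 by rewrite subr_gt0 ltr_pdivlMr // mul1r.
have [C' C'0 hC'] := cpow_kesten p0 p1 lt sub e0.
rewrite subrKC in hC'.
apply: (tail_negligible_dom p0 q0 hC').
have C0 : 0 <= C by apply: le_trans (qC 0%N); rewrite mulr_ge0.
have z0 : 0 <= rm / r by rewrite divr_ge0 // ltW.
have z1 : rm / r < 1 by rewrite ltr_pdivrMr // mul1r.
have st : small_tails (fun k => (rm / r) ^+ k).
  apply: (@small_tails_bounded R (fun k => (rm / r) ^+ k) (1 - rm / r)^-1) => [k|M].
    by rewrite exprn_ge0.
  rewrite -[leRHS]mul1r ler_pdivlMr ?subr_gt0 // mulrC.
  have E := subrX1 (rm / r) M; have xM : 0 <= (rm / r) ^+ M by rewrite exprn_ge0.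
  by rewrite -opprB mulNr -E opprB gerBl.
apply: small_tails_le (small_tailsZ (c := C * C') _ st).
- exists 0%N => // k _.
  have E : (rm / om) ^+ k = (r / om) ^+ k * (rm / r) ^+ k.
    by rewrite -exprMn; congr (_ ^+ _); field; rewrite !gt_eqF.
  have zk : 0 <= C' * (rm / r) ^+ k by rewrite mulr_ge0 ?exprn_ge0 // ltW.
  have := ler_wpM2r zk (qC k); rewrite E.
  have -> : q k * (C' * ((r / om) ^+ k * (rm / r) ^+ k)) =
     q k * (r / om) ^+ k * (C' * (rm / r) ^+ k) by ring.
  by move/le_trans; apply; rewrite (mulrA C).
- by move=> k; rewrite !mulr_ge0 ?exprn_ge0 // ltW.
- by rewrite mulr_ge0 // ltW.
Qed.

End GeometricTail.

End SingleJump.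

(** * Gibbs weights *)

Section GibbsWeights.
Context {R : realType}.
Implicit Types v w p q : nat -> R.

Lemma coef_poly_exp w m k n : (n < m)%N ->
  ((\poly_(i < m) w i) ^+ k)`_n = cpow w k n.
Proof.
elim: k n => [|k IH] n nm; first by rewrite expr0 coef1.
rewrite exprS coefM cpowS; apply: eq_bigr => i _.
by rewrite coef_poly (leq_ltn_trans _ nm) -1?ltnS // IH // (leq_ltn_trans (leq_subr _ _) nm).
Qed.

(** Both sides are the coefficient of ['X^n] in the [k]-th power of the polynomial
   obtained by truncating [w], which is expanded by distributivity. *)
Lemma sum_compositions w k n :
  \sum_(x : {ffun 'I_k -> 'I_n.+1} | (\sum_(i < k) x i)%N == n) \prod_(i < k) w (x i)
  = cpow w k n.
Proof.
rewrite -(@coef_poly_exp w n.+1) // -[k in LHS]card_ord -[in RHS](card_ord k) -prodr_const.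
rewrite card_ord.
rewrite (eq_bigr (fun _ : 'I_k => \sum_(j < n.+1) w j *: 'X^j)) => [|i _]; last first.
  by rewrite poly_def.
rewrite bigA_distr_bigA coef_sum /= big_mkcond /=; apply: eq_bigr => x _.
rewrite scaler_prod prodrXr coefZ coefXn eq_sym.
by case: eqP; rewrite ?mulr1 ?mulr0.
Qed.

Lemma cpow_scale w (r c : R) k n :
  cpow (fun i => w i * r ^+ i * c) k n = cpow w k n * r ^+ n * c ^+ k.
Proof.
elim: k n => [|k IH] n.
  by rewrite /= expr0 mulr1; case: eqP => [->|_]; rewrite ?expr0 ?mulr1 ?mul0r.
rewrite !cpowS !mulr_suml; apply: eq_bigr => i _.
have -> : r ^+ n = r ^+ i * r ^+ (n - i) by rewrite -exprD subnKC // -ltnS.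
by rewrite IH exprS; ring.
Qed.

Section GibbsU.
Variables v w : nat -> R.
Hypothesis v_ge0 : forall i, 0 <= v i.
Hypothesis w_ge0 : forall i, 0 <= w i.

Let term_ge0 n k : 0 <= v k * cpow w k n.
Proof. by rewrite mulr_ge0 // cpow_ge0. Qed.

Let gibbs_uE n : gibbs_u v w n = (\sum_(1 <= k <oo) (v k * cpow w k n)%:E)%E.
Proof. by apply: eq_eseriesr => k _; rewrite sum_compositions. Qed.

Lemma gibbs_u_le (B : R) n : (forall M, \sum_(k < M) v k * cpow w k n <= B) ->
  (gibbs_u v w n <= B%:E)%E.
Proof.
move=> HB; rewrite gibbs_uE; apply: lime_le.
  by apply: is_cvg_nneseries => k _ _; rewrite lee_fin.
apply: nearW => M; rewrite sumEFin lee_fin; apply: le_trans (HB M.+1).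
rewrite -(big_mkord xpredT (fun k => v k * cpow w k n)) big_ltn // ler_wpDl //.
case: M => [|M]; first by rewrite !big_geq.
by rewrite [leRHS]big_nat_recr // lerDl; exact: term_ge0.
Qed.

Lemma gibbs_u_gt0 n k : (0 < k)%N -> 0 < v k -> 0 < cpow w k n ->
  (0 < gibbs_u v w n)%E.
Proof.
move=> k0 vk ck; apply: (@lt_le_trans _ _ (v k * cpow w k n)%:E).
  by rewrite lte_fin mulr_gt0.
rewrite gibbs_uE; apply: le_trans (nneseries_lim_ge k.+1 _); last first.
  by move=> i _ _; rewrite lee_fin.
by rewrite sumEFin lee_fin big_nat_recr //= lerDr sumr_ge0.
Qed.

End GibbsU.

Lemma cpow_gt0_near p k : (forall i, 0 <= p i) -> long_tailed p ->
  \forall n \near \oo, 0 < cpow p k.+1 n.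
Proof.
move=> p0 [[i0 _ ppos] _]; elim: k => [|k [N _ HN]].
  by exists i0 => // n n0; rewrite cpow1; exact: ppos.
exists (N + i0)%N => // n nN; rewrite cpowS; rewrite /= in nN.
have in0 : (i0 < n.+1)%N by rewrite ltnS (leq_trans _ nN) // leq_addl.
rewrite (bigD1 (Ordinal in0)) // ltr_wpDr //.
  by apply: sumr_ge0 => i _; apply: mulr_ge0 => //; exact: cpow_ge0.
by rewrite mulr_gt0 //; [exact: ppos (leqnn _)|apply: HN; rewrite /= leq_subRL // addnC].
Qed.

Section Conditions.
Variables v w : nat -> R.
Hypothesis v_ge0 : forall i, 0 <= v i.
Hypothesis w_ge0 : forall i, 0 <= w i.
Variables rho om : R.
Hypothesis rho0 : 0 < rho.
Hypothesis om0 : 0 < om.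

Let p i := w i * rho ^+ i * om^-1.
Let q k := v k * om ^+ k.

Hypothesis p1 : forall M, \sum_(i < M) p i <= 1.
Hypothesis p_mass : forall e : R, 0 < e -> exists A, 1 - e <= \sum_(i < A) p i.
Variable D : R.
Hypothesis qD : forall M, \sum_(k < M) q k * k%:R <= D.

Let p0 i : 0 <= p i.
Proof. by rewrite /p !mulr_ge0 ?exprn_ge0 ?invr_ge0 // ltW. Qed.

Let q0 k : 0 <= q k.
Proof. by rewrite /q mulr_ge0 ?exprn_ge0 // ltW. Qed.

Lemma regular_slowly_varying (L : R -> R) (a eta : R) : slowly_varying L ->
  (forall n, (0 < n)%N -> w n = L n%:R * n%:R `^ (- a) * rho ^- n) ->
  0 < eta -> regular p a eta.
Proof.
move=> Lsv wE eta0.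
have lE n : (0 < n)%N -> p n * n%:R `^ a = om^-1 * L n%:R.
  move=> n0; have nR : 0 < n%:R :> R by rewrite ltr0n.
  rewrite /p wE //.
  have -> : L n%:R * n%:R `^ (- a) * rho ^- n * rho ^+ n * om^-1 * n%:R `^ a =
    om^-1 * L n%:R * (n%:R `^ a * n%:R `^ (- a)) * (rho ^+ n / rho ^+ n) by ring.
  by rewrite powRNV // divff ?mulr1 // gt_eqF // exprn_gt0.
have iom0 : 0 < om^-1 by rewrite invr_gt0.
split; first exact: slow_seq_slowly_varying Lsv iom0 lE eta0.
exact: slow_step_slowly_varying Lsv iom0 lE.
Qed.

Lemma regular_asymp (a c : R) : 0 < c ->
  (w : nat -> R) ~_\oo (fun n : nat => c * n%:R `^ (- a) * rho ^- n) ->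
  regular p a 0.
Proof.
move=> c0 /eqaddoP wE.
have co : 0 < c / om by rewrite divr_gt0.
suff lc : p n * n%:R `^ a @[n --> \oo] --> c / om.
  by split; [exact: slow_seq_cvg lc|exact: slow_step_cvg lc].
apply/cvgrPdist_le => e e0.
have e10 : 0 < e / (c / om) by rewrite divr_gt0.
have L : \forall n \near \oo, (1 <= n)%N by exact: nbhs_infty_ge.
apply: filterS2 (wE _ e10) L => n.
rewrite -[(w - _) n]/(w n - c * n%:R `^ (- a) * rho ^- n) => H n0.
have nR : 0 < n%:R :> R by rewrite ltr0n.
have rn : 0 < rho ^+ n by rewrite exprn_gt0.
have na : 0 < n%:R `^ a :> R by rewrite powR_gt0.
have g0 : 0 < c * n%:R `^ (- a) * rho ^- n.
  by rewrite !mulr_gt0 ?powR_gt0 ?invr_gt0.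
pose h := rho ^+ n / om * n%:R `^ a.
have h0 : 0 < h by rewrite !mulr_gt0 ?invr_gt0.
have gh : c * n%:R `^ (- a) * rho ^- n * h = c / om.
  rewrite /h.
  have -> : c * n%:R `^ (- a) * rho ^- n * (rho ^+ n / om * n%:R `^ a) =
   c / om * (n%:R `^ a * n%:R `^ (- a)) * (rho ^+ n / rho ^+ n) by ring.
  by rewrite powRNV // divff ?mulr1 // gt_eqF.
have -> : p n * n%:R `^ a = w n * h by rewrite /p /h; ring.
rewrite -gh distrC -mulrBl normrM (gtr0_norm h0).
apply: le_trans (ler_wpM2r (ltW h0) H) _.
by rewrite (gtr0_norm g0) -(mulrA (e / (c / om))) gh divfK // gt_eqF.
Qed.

Lemma single_jump_beyond_radius : (om%:E < pser_radius v)%E ->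
  w n / w n.+1 @[n --> \oo] --> rho ->
  (w n)^-1 * (\sum_(i < n.+1) w i * w (n - i)%N) @[n --> \oo] --> 2 * om ->
  single_jump p q.
Proof.
move=> rad ratio conv2.
have pN : \forall n \near \oo, 0 < w n.+1.
  have /cvgrPdist_lt /(_ _ rho0) H := ratio.
  apply: filterS H => n H; rewrite lt_neqAle w_ge0 andbT eq_sym.
  by apply/negP => /eqP w0; move: H; rewrite w0 invr0 mulr0 subr0 gtr0_norm // ltxx.
have wpos : \forall n \near \oo, 0 < w n.
  case: pN => N _ HN; exists N.+1 => // -[//|n] /= Nn; exact: HN.
have pw n : 0 < w n -> 0 < p n.
  by move=> wn; rewrite /p !mulr_gt0 ?exprn_gt0 ?invr_gt0.
have lt : long_tailed p.
  split; first by apply: filterS wpos => n; exact: pw.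
  move=> e e0; have er0 : 0 < e * rho by rewrite mulr_gt0.
  have /cvgrPdist_le /(_ _ er0) H := ratio.
  apply: filterS2 H pN => n; rewrite distrC ler_distl => /andP[H1 H2] wn.
  have s0 : 0 < rho ^+ n / om by rewrite divr_gt0 // exprn_gt0.
  have -> : p n = w n * (rho ^+ n / om) by rewrite /p; ring.
  have -> : p n.+1 = rho * w n.+1 * (rho ^+ n / om) by rewrite /p exprS; ring.
  rewrite ler_pdivrMr // in H2; rewrite ler_pdivlMr // in H1.
  rewrite [(1 - e) * _]mulrA [(1 + e) * _]mulrA.
  by apply/andP; split; rewrite ler_pM2r //; lra.
have sub : subexp p.
  apply: (subexp_of_conv2 p0 lt p_mass) => e e0.
  have eo0 : 0 < e * om by rewrite mulr_gt0.
  have /cvgrPdist_le /(_ _ eo0) H := conv2.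
  apply: filterS2 H wpos => n; rewrite distrC ler_distl => /andP[_ H2] wn.
  have -> : \sum_(i < n.+1) p i * p (n - i)%N =
      (\sum_(i < n.+1) w i * w (n - i)%N) * (rho ^+ n / om ^+ 2).
    rewrite mulr_suml; apply: eq_bigr => i _.
    have -> : rho ^+ n = rho ^+ i * rho ^+ (n - i) by rewrite -exprD subnKC // -ltnS.
    by rewrite /p expr2 invfM; ring.
  have -> : (2 + e) * p n = w n * ((2 + e) * om) * (rho ^+ n / om ^+ 2).
    by rewrite /p; field; rewrite gt_eqF.
  have ro : 0 <= rho ^+ n / om ^+ 2.
    by rewrite divr_ge0 // exprn_ge0 // ltW.
  rewrite ler_wpM2r //.
  by rewrite -ler_pdivrMl //; apply: le_trans H2 _; lra.
(* At a point of convergence beyond [om], the terms of the series of [v] are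
   bounded. *)
have [_ [r cr <-] omr] := ereal_sup_gt rad; rewrite lte_fin in omr.
have [C HC] : exists C : R, forall k, v k * `|r| ^+ k <= C.
  have /cvg_series_cvg_0 c0 := cr.
  have /cvg_seq_bounded := cvgP _ c0.
  move=> [M [Mr HM]]; exists (M + 1) => k.
  have := HM (M + 1); rewrite ltrDl ltr01 => /(_ isT k I).
  by rewrite /= normrM normrX (ger0_norm (v_ge0 k)).
apply: (single_jump_geometric p0 p1 q0 om0 omr (C := C) lt sub) => k.
rewrite /q expr_div_n mulrA [_ * om ^+ k]mulrC.
have -> : om ^+ k * v k * `|r| ^+ k / om ^+ k = v k * `|r| ^+ k * (om ^+ k / om ^+ k) by ring.
by rewrite divff ?mulr1 // gt_eqF // exprn_gt0.
Qed.

Lemma single_jump_regular_weights (Lv Lw : R -> R) (a b : R) :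
  slowly_varying Lv -> slowly_varying Lw -> 2 < b -> 1 < a ->
  (a < b \/ a = b /\ (fun n : nat => Lv n%:R) =o_\oo (fun n : nat => Lw n%:R)) ->
  (forall n, (0 < n)%N -> v n = Lv n%:R * n%:R `^ (- b) * om ^- n) ->
  (forall n, (0 < n)%N -> w n = Lw n%:R * n%:R `^ (- a) * rho ^- n) ->
  single_jump p q.
Proof.
move=> Lvs Lws b2 a1 ab vE wE.
have qE n : (0 < n)%N -> q n * n%:R `^ b = 1 * Lv n%:R.
  move=> n0; have nR : 0 < n%:R :> R by rewrite ltr0n.
  rewrite /q vE //.
  have -> : Lv n%:R * n%:R `^ (- b) * om ^- n * om ^+ n * n%:R `^ b =
    1 * Lv n%:R * (n%:R `^ b * n%:R `^ (- b)) * (om ^+ n / om ^+ n) by ring.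
  by rewrite powRNV // divff ?mulr1 // gt_eqF // exprn_gt0.
have qpb eta : 0 < eta -> power_bounds q (b - eta) (b + eta).
  move=> eta0; apply: power_bounds_regular.
  exact: slow_seq_slowly_varying Lvs ltr01 qE eta0.
(* For [a <= 2] the mean may be infinite, but [q] has a moment of order
   [b / 2 > 1]. For [a > 2] the mean is finite and [q] is negligible against [p];
   then [eta] keeps [a - eta] above [2] and, if [a < b], [a + eta] below
   [b - eta]. *)
have [a2|a2] := leP a 2.
  have a12 : 1 < a <= 2 by rewrite a1.
  have [eta [eta0 ae eb hs]] := infinite_mean_exponents a12 b2.
  apply: (single_jump_concentration p0 p1 q0 (a := a) (eta := eta) (s := b / 2)) => //.
  - exact: ltW.
  - by apply/andP; split; lra.
  - exact: regular_slowly_varying Lws wE eta0.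
  - by lra.
  - by apply: power_bounds_moment (qpb eta eta0); lra.
pose eta := if a < b then Num.min ((a - 2) / 2) ((b - a) / 4) else (a - 2) / 2.
have eta0 : 0 < eta.
  rewrite /eta; case: ifP => ab'; last by rewrite divr_gt0 // subr_gt0.
  by rewrite lt_min !divr_gt0 // subr_gt0.
have etaa : eta <= (a - 2) / 2.
  by rewrite /eta; case: ifP => // _; rewrite ge_min lexx.
have reg := regular_slowly_varying Lws wE eta0.
apply: (single_jump_renewal p0 p1 q0 qD (ltW eta0) _ reg); first by lra.
case: ab => [ab|[ab Lo]].
  have etab : eta <= (b - a) / 4 by rewrite /eta ab ge_min lexx orbT.
  apply: (power_bounds_littleo (a1 := a - eta) (a2 := a + eta) (b1 := b - eta) (b2 := b + eta)).
  - by lra.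
  - exact: power_bounds_regular reg.1.
  - exact: qpb.
move=> e e0; move/eqoP: Lo => Lo.
have eo0 : 0 < e / om by rewrite divr_gt0.
have L : \forall n \near \oo, (1 <= n)%N by exact: nbhs_infty_ge.
apply: filterS2 (Lo _ eo0) L => n H n0.
have nR : 0 < n%:R :> R by rewrite ltr0n.
have Lwn : 0 < Lw n%:R by case: Lws => + _ _; apply.
have Lvn : 0 < Lv n%:R by case: Lvs => + _ _; apply.
rewrite !gtr0_norm // in H.
have nb : 0 < n%:R `^ b :> R by rewrite powR_gt0.
rewrite -(ler_pM2r nb) qE // mul1r; apply: le_trans H _.
have -> : e * p n * n%:R `^ b = e / om * Lw n%:R *
   (n%:R `^ b * n%:R `^ (- b)) * (rho ^+ n / rho ^+ n).
  by rewrite /p wE // ab; ring.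
by rewrite powRNV // divff ?mulr1 // gt_eqF // exprn_gt0.
Qed.

Section RandomNumber.
Context {d : measure_display} {T : measurableType d}.
Variables (P : probability T R) (N X : {RV P >-> nat}) (V : R).
Hypothesis V0 : 0 <= V.
Hypothesis qN : forall k, q k = V * nat_pmf N k.
Hypothesis pX : forall k, p k = nat_pmf X k.

Let moment_tails (g h : nat -> R) (c : R) n0 : (forall k, 0 <= g k) -> 0 <= c ->
  ('E_P[fun t => g (N t)] < +oo)%E ->
  (forall k, (n0 <= k)%N -> h k <= c * g k) -> small_tails (fun k => q k * h k).
Proof.
move=> g0 c0 Eg hg; have st := small_tails_expectation g0 Eg.
have Vc : 0 <= V * c by rewrite mulr_ge0.
apply: small_tails_le (small_tailsZ Vc st).
  exists n0 => // k /hg Hk; rewrite qN.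
  apply: le_trans (ler_wpM2l _ Hk) _; first by rewrite mulr_ge0 // nat_pmf_ge0.
  by rewrite le_eqVlt; apply/orP; left; apply/eqP; ring.
by move=> k; rewrite !mulr_ge0 // nat_pmf_ge0.
Qed.

Lemma single_jump_moment_with_room (Lw : R -> R) (a delta : R) : slowly_varying Lw ->
  1 < a -> 0 < delta ->
  ('E_P[fun t => ((N t)%:R `^ (1 + a + delta))%R] < +oo)%E ->
  (forall n, (0 < n)%N -> w n = Lw n%:R * n%:R `^ (- a) * rho ^- n) ->
  single_jump p q.
Proof.
move=> Lws a1 d0 EN wE; pose eta := Num.min delta a.
have a0 : 0 < a by lra.
have eta0 : 0 < eta by rewrite lt_min d0.
have etaa : eta <= a by rewrite ge_min lexx orbT.
have etad : eta <= delta by rewrite ge_min lexx.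
have ea : 0 <= eta <= a by rewrite ltW.
apply: (single_jump_moment p0 p1 q0 a0 ea (regular_slowly_varying Lws wE eta0)).
apply: (@moment_tails (fun k => k%:R `^ (1 + a + delta)) _ 1 1 _ ler01 EN) => [k|k k1].
  exact: powR_ge0.
have kR : 0 < k%:R :> R by rewrite ltr0n.
rewrite mul1r -{1}(powRr1 (ltW kR)) -powRD ?(gt_eqF kR) ?implybT //.
by rewrite ler_powR ?ler1n //; lra.
Qed.

Lemma single_jump_power_law (a cw : R) : 1 < a -> 0 < cw ->
  (w : nat -> R) ~_\oo (fun n : nat => cw * n%:R `^ (- a) * rho ^- n) ->
  [\/ ('E_P[fun t => ((N t)%:R `^ (1 + a))%R] < +oo)%E,
      1 < a < 2,
      a = 2 /\ (exists2 delta : R, 0 < delta &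
        ('E_P[fun t => ((N t)%:R * ln (N t)%:R `^ (2 + delta))%R] < +oo)%E)
    | (2 < a < 3 /\
       (fun n : nat => fine (P (N @^-1` [set n]))) =o_\oo
       (fun n : nat => fine (P (X @^-1` [set n])))) \/
      (a = 3 /\
       (fun n : nat => fine (P (N @^-1` [set n]))) =o_\oo
       (fun n : nat => (n%:R ^+ 3 * ln (ln n%:R) : R)^-1))] ->
  single_jump p q.
Proof.
move=> a1 c0 wE; have a0 : 0 < a by lra.
have reg : regular p a 0 by exact: (regular_asymp c0 wE).
have ea : 0 <= (0 : R) <= a by rewrite lexx ltW.
case=> [EN|/andP[_ a2]|[a2 [delta d0 EN]]|[[/andP[a2 _] No]|[a3 No]]].
- apply: (single_jump_moment p0 p1 q0 a0 ea reg); rewrite addr0.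
  apply: (@moment_tails (fun k => k%:R `^ (1 + a)) _ 1 1 _ ler01 EN) => [k|k k1].
    exact: powR_ge0.
  have kR : 0 < k%:R :> R by rewrite ltr0n.
  by rewrite mul1r -{1}(powRr1 (ltW kR)) -powRD ?(gt_eqF kR) ?implybT.
- apply: (single_jump_concentration p0 p1 q0 (lexx 0) _ reg (lexx 1)).
  + by rewrite subr0 a1.
  + rewrite addr0 subr0 subrK divfK // gt_eqF //; lra.
  + apply: small_tails_le (small_tails_mean q0 qD).
      by exists 0%N => // k _; rewrite powRr1.
    by move=> k; rewrite mulr_ge0.
- rewrite a2 in reg; apply: (single_jump_log p0 p1 q0 reg).
  apply: (@moment_tails (fun k => k%:R * ln k%:R `^ (2 + delta)) _ 4
    (Num.truncn (expR 1 : R)).+1 _ _ EN) => [k||k k1].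
  + by rewrite mulr_ge0 // powR_ge0.
  + by [].
  + have ek : expR 1 <= k%:R :> R.
      by apply: le_trans (ltW (truncnS_gt _)) _; rewrite ler_nat.
    have k0 : 0 < k%:R :> R by apply: lt_le_trans ek; exact: expR_gt0.
    have lk : 1 <= ln k%:R :> R by rewrite -[leLHS](expRK 1) ler_ln ?posrE ?expR_gt0.
    rewrite [leRHS]mulrCA ler_wpM2l ?(ltW k0) //.
    apply: (@le_trans _ _ (4 * ln k%:R `^ 2)).
      by rewrite powR_mulrn; [nra|lra].
    by rewrite ler_wpM2l // ler_powR //; lra.
- apply: (single_jump_renewal p0 p1 q0 qD (lexx 0) _ reg); first by lra.
  move=> e e0; move/eqoP: No => No.
  have eV : 0 < e / (V + 1) by rewrite divr_gt0 // ltr_wpDl.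
  apply: filterS (No _ eV) => k.
  rewrite -/(nat_pmf N k) -/(nat_pmf X k) -pX !ger0_norm ?nat_pmf_ge0 ?p0 // => H.
  rewrite qN; apply: le_trans (ler_wpM2l V0 H) _.
  rewrite (mulrA V) ler_wpM2r // mulrA ler_pdivrMr ?ltr_wpDl // (mulrC V).
  by rewrite ler_wpM2l ?(ltW e0) // lerDl.
- apply: (single_jump_renewal p0 p1 q0 qD (lexx 0) _ reg); first by lra.
  move=> e e0; move/eqoP: No => No.
  have [c [C [n1 [c1 _ pb]]]] := power_bounds_regular reg.1.
  rewrite addr0 a3 in pb.
  have eV : 0 < e * c / (V + 1) by rewrite divr_gt0 ?mulr_gt0 // ltr_wpDl.
  have L : \forall n \near \oo, (n1 + (Num.truncn (expR (expR 1) : R)).+1 <= n)%N.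
    exact: nbhs_infty_ge.
  apply: filterS2 (No _ eV) L => k H kL.
  have k1 : (n1 <= k)%N by apply: leq_trans kL; exact: leq_addr.
  have ek : expR (expR 1) <= k%:R :> R.
    apply: le_trans (ltW (truncnS_gt _)) _; rewrite ler_nat.
    by apply: leq_trans kL; exact: leq_addl.
  have k0 : 0 < k%:R :> R by apply: lt_le_trans ek; exact: expR_gt0.
  have lk : expR 1 <= ln k%:R :> R by rewrite -[leLHS](expRK (expR 1)) ler_ln ?posrE ?expR_gt0.
  have lk0 : 0 < ln k%:R :> R by apply: lt_le_trans lk; exact: expR_gt0.
  have llk : 1 <= ln (ln k%:R) :> R by rewrite -[leLHS](expRK 1) ler_ln ?posrE ?expR_gt0.
  have k3 : 0 < k%:R ^+ 3 :> R by rewrite exprn_gt0.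
  have /andP[pk _] := pb k k1; rewrite powR_invn ?(ltW k0) // in pk.
  have H2 : `|(k%:R ^+ 3 * ln (ln k%:R))^-1| <= k%:R ^- 3 :> R.
    have kl : 0 < k%:R ^+ 3 * ln (ln k%:R) :> R by rewrite mulr_gt0 //; lra.
    rewrite ger0_norm ?invr_ge0 ?(ltW kl) // lef_pV2 ?posrE //.
    by rewrite ler_peMr // ltW.
  rewrite -/(nat_pmf N k) ger0_norm ?nat_pmf_ge0 // in H.
  rewrite qN; apply: le_trans (ler_wpM2l V0 H) _.
  apply: (@le_trans _ _ (V * (e * c / (V + 1) * k%:R ^- 3))).
    by rewrite ler_wpM2l // ler_wpM2l // ltW.
  apply: le_trans (ler_wpM2l (ltW e0) pk).
  have -> : V * (e * c / (V + 1) * k%:R ^- 3) = V / (V + 1) * (e * (c * k%:R ^- 3)) by ring.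
  rewrite ler_piMl ?mulr_ge0 ?invr_ge0 ?(ltW e0) ?(ltW c1) ?(ltW k3) //.
  by rewrite ler_pdivrMr ?mul1r ?lerDl // ltr_wpDl.
Qed.

End RandomNumber.
End Conditions.
End GibbsWeights.

(** * The partition function *)

Section PartitionFunction.
Context {R : realType}.
Variables v w : nat -> R.
Hypothesis v_ge0 : forall i, 0 <= v i.
Hypothesis w_ge0 : forall i, 0 <= w i.
Variables rho om : R.
Hypothesis rho0 : 0 < rho.
Hypothesis om0 : 0 < om.

Let p i := w i * rho ^+ i * om^-1.
Let q k := v k * om ^+ k.

Hypothesis p1 : forall M, \sum_(i < M) p i <= 1.
Variable D : R.
Hypothesis D0 : 0 < D.
Hypothesis qD : forall M, \sum_(k < M) q k * k%:R <= D.
Hypothesis sj : single_jump p q.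
Variable k0 : nat.
Hypothesis vk0 : 0 < v k0.+1.

Let p0 i : 0 <= p i.
Proof. by rewrite /p !mulr_ge0 ?exprn_ge0 ?invr_ge0 // ltW. Qed.

Let q0 k : 0 <= q k.
Proof. by rewrite /q mulr_ge0 ?exprn_ge0 // ltW. Qed.

(** The upper half of the asymptotics [u_n * rho ^ n ~ D * p n], uniformly under
   shifts of [n] by at most [m]. It suffices because the two laws are compared
   from one side and both have total mass one. *)
Lemma partition_function_upper (e : R) (m : nat) : 0 < e <= 1 ->
  \forall n \near \oo, [/\ (0 < gibbs_u v w n)%E,
    0 < fine (gibbs_u v w n) * rho ^+ n &
    forall j, (j <= m)%N ->
      fine (gibbs_u v w n) * rho ^+ n <= (1 + e) * (D * p (n - j)%N)].
Proof.
move=> /andP[e0 e1]; case: sj => lt sub qt.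
have De0 : 0 < D * (e / 4) by rewrite mulr_gt0 // divr_gt0.
have H1 := random_sum_upper p0 p1 lt q0 sub qt qD De0.
have H2 := cpow_gt0_near k0 p0 lt.
have H3 : \forall n \near \oo, forall j, (j < m.+1)%N -> (1 - e / 4) * p n <= p (n - j)%N.
  apply: near_bounded_forall => j _.
  have e40 : 0 < e / 4 by rewrite divr_gt0.
  by apply: filterS (long_tailed_shift j lt e40) => n /andP[].
apply: filterS3 H1 H2 H3 => n H1 H2 H3.
have rn : 0 < rho ^+ n by rewrite exprn_gt0.
have pw k : cpow p k n = cpow w k n * rho ^+ n * om^-1 ^+ k by exact: cpow_scale.
have omk k : om^-1 ^+ k * om ^+ k = 1 by rewrite -exprMn mulVf ?expr1n // gt_eqF.
have cw k : v k * cpow w k n = q k * cpow p k n / rho ^+ n.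
  rewrite pw /q.
  have -> : v k * om ^+ k * (cpow w k n * rho ^+ n * om^-1 ^+ k) / rho ^+ n =
    v k * cpow w k n * (om^-1 ^+ k * om ^+ k) * (rho ^+ n / rho ^+ n) by ring.
  by rewrite omk divff ?mulr1 // gt_eqF.
have up : (gibbs_u v w n <= ((D + D * (e / 4)) * p n / rho ^+ n)%:E)%E.
  apply: gibbs_u_le => // M.
  rewrite (eq_bigr _ (fun (k : 'I_M) _ => cw k)) -mulr_suml.
  by apply: ler_wpM2r (H1 M); rewrite invr_ge0 ltW.
have pos : (0 < gibbs_u v w n)%E.
  apply: (gibbs_u_gt0 v_ge0 w_ge0 (k := k0.+1)) => //.
  rewrite lt_neqAle cpow_ge0 // andbT; apply: contraTneq H2 => E.
  by rewrite pw -E !mul0r ltxx.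
have fin : gibbs_u v w n \is a fin_num.
  by rewrite ge0_fin_numE ?(ltW pos) //; apply: le_lt_trans up _; exact: ltry.
rewrite -(fineK fin) lte_fin lee_fin in pos up *.
split => //; first by rewrite mulr_gt0.
rewrite ler_pdivlMr // in up.
move=> j jm; apply: le_trans up _.
have pn := H3 j jm.
have pn0 := p0 n.
have -> : (D + D * (e / 4)) * p n = D * ((1 + e / 4) * p n) by ring.
have -> : (1 + e) * (D * p (n - j)%N) = D * ((1 + e) * p (n - j)%N) by ring.
apply: ler_wpM2l; first exact: ltW.
apply: (@le_trans _ _ ((1 + e) * ((1 - e / 4) * p n))); last first.
  by apply: ler_wpM2l pn; lra.
rewrite [leRHS]mulrA ler_wpM2r //; nra.
Qed.

End PartitionFunction.

Lemma cvg_ereal0 (R : realType) (f : nat -> \bar R) : (forall n, 0 <= f n)%E ->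
  (forall e : R, 0 < e -> \forall n \near \oo, (f n <= e%:E)%E) ->
  f n @[n --> \oo] --> 0%E.
Proof.
move=> f0 fe; apply/fine_cvgP; split.
  apply: filterS (fe 1 ltr01) => n fn.
  by rewrite ge0_fin_numE //; apply: le_lt_trans fn _; exact: ltry.
apply/cvgrPdist_le => e e0; apply: filterS (fe e e0) => n fn.
have fin : f n \is a fin_num.
  by rewrite ge0_fin_numE //; apply: le_lt_trans fn _; exact: ltry.
rewrite sub0r normrN /= ger0_norm ?fine_ge0 //.
by rewrite -lee_fin fineK.
Qed.

(** * The limit theorem *)

Theorem theorem3p11 (R : realType)
  (* the sequences (v_i)_{i >= 1}, extended by v_0 = 0, and (w_i)_{i >= 0} *)
  (v w : nat -> R) (v_ge0 : forall i, 0 <= v i) (v0 : v 0%N = 0)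
  (w_ge0 : forall i, 0 <= w i)
  (* rho is the radius rho_w and om = W(rho_w) *)
  (rho om : R) (rho_gt0 : 0 < rho) (rhoE : pser_radius w = rho%:E)
  (om_gt0 : 0 < om) (omE : pser w rho = om%:E)
  (dV_gt0 : (0 < pser (pseries_diffs v) om)%E)
  (dV_lty : (pser (pseries_diffs v) om < +oo)%E)
  (* the random variables X, X_1, X_2, ..., N, Nhat, J *)
  (d : measure_display) (T : measurableType d) (P : probability T R)
  (X : {RV P >-> nat}) (Xs : nat -> {RV P >-> nat}) (N Nhat J : {RV P >-> nat})
  (X_pgf : has_pgf P X (fun z => fine (pser w (rho * z)) / om))
  (Xs_law : forall i, distribution P (Xs i) =1 distribution P X)
  (Xs_indep : mutually_indep P (fun i => Xs i : T -> nat))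
  (N_gt0 : forall t, (0 < N t)%N)
  (N_pgf : has_pgf P N (fun z => fine (pser v (om * z)) / fine (pser v om)))
  (N_indep : indep_classes P (sigma_of [set (N : T -> nat)])
               (sigma_of (range (fun i => Xs i : T -> nat))))
  (Nhat_gt0 : forall t, (0 < Nhat t)%N)
  (Nhat_pgf : has_pgf P Nhat
     (fun z => z * fine (pser (pseries_diffs v) (om * z)) /
               fine (pser (pseries_diffs v) om)))
  (Nhat_indep : indep_classes P (sigma_of [set (Nhat : T -> nat)])
                  (sigma_of (range (fun i => Xs i : T -> nat))))
  (J_unif : cond_uniform P J Nhat)
  (J_indep : cond_indep P J Nhat
     (sigma_of ([set (X : T -> nat)] `|` [set (N : T -> nat)] `|`
                range (fun i => Xs i : T -> nat))))
  (* the component sizes of the Gibbs partition P_n *)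
  (dK : nat -> measure_display) (TK : forall n, measurableType (dK n))
  (Q : forall n, probability (TK n) R) (K : forall n, TK n -> seq nat)
  (K_law : forall n, (0 < n)%N -> (0 < gibbs_u v w n)%E ->
             gibbs_sizes v w n (Q n) (K n))
  (conditions :
    (* (i) *)
    (exists Lv Lw : R -> R, exists a b : R,
      [/\ slowly_varying Lv, slowly_varying Lw, 2 < b,
          (1 < a < b) \/
          (a = b /\ (fun n : nat => Lv n%:R) =o_\oo (fun n : nat => Lw n%:R))
        & [/\ pser_radius v = om%:E,
              forall n, (0 < n)%N -> v n = Lv n%:R * n%:R `^ (- b) * om ^- n
            & forall n, (0 < n)%N -> w n = Lw n%:R * n%:R `^ (- a) * rho ^- n]])
    \/
    (* (ii) *)
    [/\ (om%:E < pser_radius v)%E,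
        w n / w n.+1 @[n --> \oo] --> rho
      & (w n)^-1 * (\sum_(i < n.+1) w i * w (n - i)%N) @[n --> \oo]
          --> 2 * om]
    \/
    (* (iii) *)
    (exists (Lw : R -> R) (a delta : R),
      [/\ slowly_varying Lw, 1 < a, 0 < delta,
          ('E_P[fun t => ((N t)%:R `^ (1 + a + delta))%R] < +oo)%E
        & forall n, (0 < n)%N -> w n = Lw n%:R * n%:R `^ (- a) * rho ^- n])
    \/
    (* (iv) *)
    (exists a cw : R,
      [/\ 1 < a, 0 < cw,
          (w : nat -> R) ~_\oo
            (fun n : nat => cw * n%:R `^ (- a) * rho ^- n)
        & [\/ (* (a) *)
              ('E_P[fun t => ((N t)%:R `^ (1 + a))%R] < +oo)%E,
              (* (b) *)
              1 < a < 2,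
              (* (c) *)
              a = 2 /\ (exists2 delta : R, 0 < delta &
                ('E_P[fun t => ((N t)%:R * ln (N t)%:R `^ (2 + delta))%R]
                   < +oo)%E)
            | (* (d) *)
              (2 < a < 3 /\
               (fun n : nat => fine (P (N @^-1` [set n]))) =o_\oo
               (fun n : nat => fine (P (X @^-1` [set n])))) \/
              (* (e) *)
              (a = 3 /\
               (fun n : nat => fine (P (N @^-1` [set n]))) =o_\oo
               (fun n : nat => (n%:R ^+ 3 * ln (ln n%:R) : R)^-1))]])) :
  cvg_in_distribution Q (fun n t => (size (K n t))%:R)
    P (fun t => (Nhat t)%:R) /\
  (ereal_sup
     [set `|Q n (K n @^-1` A)
            - P (int_event (Xi (fun i => Xs i : T -> nat) Nhat J n) A)|%E
     | A in [set A | A `<=` Nplus]] @[n --> \oo] --> 0%E).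
Proof.
(* Exponential tilting: [p] is the law of [X], and [q] is a multiple of that of
   [N]; the size-biased [Nhat] has weights [k * q k / D]. *)
pose p i := w i * rho ^+ i * om^-1; pose q k := v k * om ^+ k.
have iom0 : 0 < om^-1 by rewrite invr_gt0.
have p0 i : 0 <= p i by rewrite /p !mulr_ge0 ?exprn_ge0 ?(ltW rho_gt0) ?(ltW iom0).
have q0 k : 0 <= q k by rewrite /q mulr_ge0 // exprn_ge0 // ltW.
have wr0 i : 0 <= w i * rho ^+ i by rewrite mulr_ge0 // exprn_ge0 // ltW.
have [w_sum w_mass] := nneseries_partial_sums wr0 omE.
have p1 M : \sum_(i < M) p i <= 1.
  by rewrite -mulr_suml ler_pdivrMr // mul1r.
have p_mass e : 0 < e -> exists A, 1 - e <= \sum_(i < A) p i.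
  move=> e0; have eo : 0 < e * om by rewrite mulr_gt0.
  have [A HA] := w_mass _ eo; exists A.
  by rewrite -mulr_suml ler_pdivlMr // mulrBl mul1r.
pose dV := fine (pser (pseries_diffs v) om).
have dVE : pser (pseries_diffs v) om = dV%:E.
  by rewrite fineK // ge0_fin_numE // ltW.
have dV0 : 0 < dV by rewrite -lte_fin -dVE.
have vd0 i : 0 <= pseries_diffs v i by rewrite /pseries_diffs mulr_ge0.
have vdo0 i : 0 <= pseries_diffs v i * om ^+ i by rewrite mulr_ge0 // exprn_ge0 // ltW.
have [vd_sum _] := nneseries_partial_sums vdo0 dVE.
pose D := om * dV; have D0 : 0 < D by rewrite mulr_gt0.
have qD M : \sum_(k < M) q k * k%:R <= D.
  case: M => [|M]; first by rewrite big_ord0 ltW.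
  rewrite big_ord_recl mulr0 add0r; apply: le_trans (ler_wpM2l (ltW om_gt0) (vd_sum M)).
  rewrite mulr_sumr; apply: ler_sum => i _.
  by rewrite /q /pseries_diffs lift0 exprS le_eqVlt; apply/orP; left; apply/eqP; ring.
have [k0 vk0] : exists k0, 0 < v k0.+1.
  apply: contrapT => H.
  have vz i : pseries_diffs v i * om ^+ i = 0.
    rewrite /pseries_diffs; suff -> : v i.+1 = 0 by rewrite mulr0 mul0r.
    apply/eqP; rewrite eq_le v_ge0 andbT leNgt; apply/negP => vi; apply: H.
    by exists i.
  have : (pser (pseries_diffs v) om <= 0%:E)%E.
    by apply: nneseries_le_bound => // M; rewrite big1.
  by rewrite dVE lee_fin leNgt dV0.
have v_sum M : \sum_(k < M) q k <= D.
  apply: le_trans (qD M); apply: ler_sum => k _.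
  case: k => [[|k] kM] /=; first by rewrite /q v0 !mul0r.
  by rewrite ler_peMr // ler1n.
pose V := fine (pser v om).
have pv0 : (0 <= pser v om)%E by apply: nneseries_ge0 => i _ _; rewrite lee_fin; exact: q0.
have VE : pser v om = V%:E.
  rewrite fineK // ge0_fin_numE //.
  by apply: le_lt_trans (nneseries_le_bound q0 v_sum) _; exact: ltry.
have [V_sum _] := nneseries_partial_sums q0 VE.
have V0 : 0 < V.
  apply: lt_le_trans (V_sum k0.+2); rewrite big_ord_recr /= ltr_wpDl ?sumr_ge0 //.
  by rewrite mulr_gt0 // exprn_gt0.
have pX k : p k = nat_pmf X k.
  have H1 := pgf_taylor_enclosed X_pgf.
  have H2 := taylor_enclosedZ (ltW iom0) (pser_taylor_enclosed w_ge0 (ltW rho_gt0) omE).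
  rewrite (taylor_enclosed_unique (u := nat_pmf X) H1 (u' := p)) //.
  move: H2; congr taylor_enclosed; apply/funext => z; rewrite /p mulrC //.
have Xs_pmf i k : P ((Xs i : T -> nat) @^-1` [set k]) = (p k)%:E.
  by have := Xs_law i [set k]; rewrite /distribution /pushforward => ->; rewrite nat_pmfE pX.
have qN k : q k = V * nat_pmf N k.
  have H1 := pgf_taylor_enclosed N_pgf.
  have iV0 : 0 <= V^-1 by rewrite invr_ge0 ltW.
  have H2 := taylor_enclosedZ iV0 (pser_taylor_enclosed v_ge0 (ltW om_gt0) VE).
  rewrite (taylor_enclosed_unique (u := nat_pmf N) H1 (u' := fun k => V^-1 * q k)).
    by rewrite mulrA divff ?mul1r // gt_eqF.
  by move: H2; congr taylor_enclosed; apply/funext => z; rewrite mulrC.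
have Nhat_law k : nat_pmf Nhat k = k%:R * q k / D.
  have H1 := pgf_taylor_enclosed Nhat_pgf.
  have iV0 : 0 <= dV^-1 by rewrite invr_ge0 ltW.
  have H2 := taylor_enclosedZ iV0
    (taylor_enclosed_shift (pser_taylor_enclosed vd0 (ltW om_gt0) dVE)).
  rewrite (taylor_enclosed_unique (u := nat_pmf Nhat) H1 (u' := fun k =>
    dV^-1 * (if k is k'.+1 then pseries_diffs v k' * om ^+ k' else 0))).
    case: k => [|k]; first by rewrite mulr0 !mul0r.
    rewrite /pseries_diffs /q /D exprS; field.
    by rewrite !gt_eqF.
  by move: H2; congr taylor_enclosed; apply/funext => z; rewrite mulrC.
have sj : single_jump p q.
  case: conditions => [[Lv [Lw [a [b [Lvs Lws b2 ab [_ vE wE]]]]]]|[[rad ratio c2]|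
    [[Lw [a [delta [Lws a1 d0 EN wE]]]]|[a [cw [a1 c0 wE H]]]]]].
  - apply: (single_jump_regular_weights v_ge0 w_ge0 rho_gt0 om_gt0 p1 qD Lvs Lws b2 _ _ vE wE).
      by case: ab => [/andP[]|[-> _]] //; apply: lt_trans b2; rewrite ltr1n.
    by case: ab => [/andP[_ ?]|?]; [left|right].
  - exact: (single_jump_beyond_radius v_ge0 w_ge0 rho_gt0 om_gt0 p1 p_mass).
  - exact: (single_jump_moment_with_room v_ge0 w_ge0 rho_gt0 om_gt0 p1 (ltW V0) qN Lws a1 d0 EN wE).
  - exact: (single_jump_power_law v_ge0 w_ge0 rho_gt0 om_gt0 p1 qD (ltW V0) qN pX a1 c0 wE H).
pose S := [set (X : T -> nat)] `|` [set (N : T -> nat)] `|` range (fun i => Xs i : T -> nat).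
have S_Xs i : S (Xs i : T -> nat) by right; exists i.
pose U n := fine (gibbs_u v w n) * rho ^+ n.
have K_law' n : (0 < n)%N -> (0 < gibbs_u v w n)%E -> 0 < U n ->
    forall s, s != [::] -> sumn s = n ->
    Q n (K n @^-1` [set s]) = (q (size s) * \prod_(x <- s) p x / U n)%:E.
  move=> n0 un0 Un0 s sn sumsn; rewrite (K_law n n0 un0).2 //; congr EFin.
  have -> : \prod_(x <- s) p x = \prod_(x <- s) w x * rho ^+ n / om ^+ size s.
    rewrite -sumsn; elim: (s) => [|x s' IH]; first by rewrite !big_nil divr1 mulr1.
    rewrite !big_cons IH /p /= exprD exprS; field.
    by rewrite expf_neq0 ?gt_eqF.
  have g0 : fine (gibbs_u v w n) != 0.
    by apply: contraTneq Un0 => g0; rewrite /U g0 mul0r ltxx.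
  rewrite /U /q; field.
  by rewrite g0 ?expf_neq0 ?gt_eqF.
have bounds e : 0 < e <= 1 -> \forall n \near \oo,
   (forall A, A `<=` Nplus -> `|fine (Q n (K n @^-1` A)) -
      fine (P (int_event (Xi (fun i => Xs i : T -> nat) Nhat J n) A))| <= 3 * e) /\
   (forall x : R, `|fine (Q n [set t | (size (K n t))%:R <= x]) -
      fine (P [set t | (Nhat t)%:R <= x])| <= 8 * e) /\ gibbs_sizes v w n (Q n) (K n).
  move=> /[dup] e01 /andP[e0 _].
  have [B HB] := bounded_data_likely Xs Nhat_gt0 J_unif e0.
  (* [B * B] bounds the sum of at most [B] entries that are at most [B]. *)
  have L : \forall n \near \oo, (B * B + B < n)%N by exact: nbhs_infty_ge.
  apply: filterS2 (partition_function_upper v_ge0 w_ge0 rho_gt0 om_gt0 p1 D0 qD sj vk0 (B * B) e01) L.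
  move=> n [un0 Un0 Ue] nB.
  have n0 : (0 < n)%N by exact: leq_ltn_trans nB.
  have gs := K_law n n0 un0.
  split => [A AN|].
    exact: (total_variation_bound S_Xs p0 q0 D0 Xs_pmf Xs_indep Nhat_law Nhat_indep
      J_unif J_indep Un0 gs.1 (K_law' n n0 un0 Un0) e01 nB Ue HB AN).
  split => // x.
  exact: (size_law_bound S_Xs p0 q0 D0 Xs_pmf Xs_indep Nhat_gt0 Nhat_law Nhat_indep
      J_unif J_indep Un0 gs.1 (K_law' n n0 un0 Un0) e01 nB Ue HB).
split.
  move=> x _.
  have mN : measurable [set t | (Nhat t)%:R <= x].
    exact: (measurable_preimage_nat Nhat [set k | k%:R <= x]).
  rewrite -(fineK (fin_num_measure P _ mN)); apply/fine_cvgP; split.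
    apply: filterS (bounds 1 _) => [n [_ [_ gs]]|]; last by rewrite ltr01 lexx.
    apply: fin_num_measure.
    exact: (measurable_countable_preimage gs.1 [set s | (size s)%:R <= x]).
  apply/cvgrPdist_le => e e0.
  have e10 : 0 < Num.min (e / 8) 1 <= 1.
    by rewrite lt_min ltr01 divr_gt0 //= ge_min lexx orbT.
  apply: filterS (bounds _ e10) => n [_ [/(_ x) H _]].
  rewrite distrC; apply: le_trans H _.
  have : Num.min (e / 8) 1 <= e / 8 by rewrite ge_min lexx.
  lra.
apply: cvg_ereal0 => [n|e e0].
  apply: (@le_trans _ _ `|Q n (K n @^-1` set0)
            - P (int_event (Xi (fun i => Xs i : T -> nat) Nhat J n) set0)|%E).
    exact: abse_ge0.
  by apply: ereal_sup_ubound; exists set0.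
have e10 : 0 < Num.min (e / 3) 1 <= 1.
  by rewrite lt_min ltr01 divr_gt0 //= ge_min lexx orbT.
apply: filterS (bounds _ e10) => n [H [_ gs]].
apply: ge_ereal_sup => _ [A AN <-].
have mQ : measurable (K n @^-1` A) by exact: measurable_countable_preimage gs.1 A.
have mP := measurable_int_event Xs Nhat J n A.
rewrite -(fineK (fin_num_measure (Q n) _ mQ)) -(fineK (fin_num_measure P _ mP)).
rewrite -EFinB abse_EFin lee_fin; apply: le_trans (H A AN) _.
have : Num.min (e / 3) 1 <= e / 3 by rewrite ge_min lexx.
lra.
Qed.
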